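(* Let $f(z)=\mathbb{E}_{\zeta\sim Z}[F(z;\zeta)]$ satisfy the deterministic and stochastic assumptions in the context. Let $\beta>\mu^{-1}$, $c=(3\beta L+1)\rho/6$, and let $\Delta_0>0$ satisfy $\Delta_0\ge h_\beta(\boldsymbol z_0)-\bar\Phi$. Then, for sufficiently small $\varepsilon>0$, running the S-ACQRN method (described in the context) for $$T=\left\lfloor\frac{\Delta_0c^{1/2}}{6\varepsilon^{3/2}}\right\rfloor+1$$ iterations, the output $z_{\mathrm{out}}$ satisfies $$\mathbb{E}[\|\nabla h_\beta(z_{\mathrm{out}})\|]=O(\varepsilon)\qquad\text{and}\qquad-\mathbb{E}[\lambda_{\min}(\nabla^2h_\beta(z_{\mathrm{out}}))]\le O(\sqrt{c\varepsilon}).$$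
   Context: Write $z=(x,y)\in\mathbb{R}^n\times\mathbb{R}^m=\mathbb{R}^{n+m}$. $\|\cdot\|$ is the Euclidean norm for vectors and the spectral norm for matrices; $\|\cdot\|_F$ is the Frobenius norm. Deterministic assumptions: $f$ is thrice continuously differentiable; for each $x$, $f(x,\cdot)$ is $\mu$-strongly concave ($\mu>0$); for each $y$, $f(\cdot,y)$ is possibly nonconvex; with constants $L,\rho>0$, $\nabla f$ is $L$-Lipschitz and $\nabla^2f$ is $\rho$-Lipschitz (in spectral norm) on $\mathbb{R}^{n+m}$; with $\Phi(x):=\max_yf(x,y)$, $\bar\Phi:=\inf_x\Phi(x)>-\infty$. Stochastic assumptions (derivatives of $F$ are in $z$; $\zeta\sim Z$; $\sigma_1,\sigma_2$ constants): for all $z,z_1,z_2$, $\mathbb{E}[\nabla F(z;\zeta)]=\nabla f(z)$, $\mathbb{E}[\nabla^2F(z;\zeta)]=\nabla^2f(z)$, $\mathbb{E}\|\nabla F(z;\zeta)-\nabla f(z)\|^3\le\sigma_1^3$, $\mathbb{E}\|\nabla F(z_1;\zeta)-\nabla F(z_2;\zeta)\|^3\le L^3\|z_1-z_2\|^3$, $\mathbb{E}\|\nabla^2F(z;\zeta)\|_F^3\le\sigma_2^3$, $\mathbb{E}\|\nabla^2F(z_1;\zeta)-\nabla^2F(z_2;\zeta)\|_F^3\le\rho^3\|z_1-z_2\|^3$. Notation: $h_\beta(z):=f(z)+\frac\beta2\|\nabla_yf(z)\|^2$ and $P:=\begin{pmatrix}0&0\\0&I_m\end{pmatrix}$. For independent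 i.i.d. batches $\mathcal{B}_1=\{\zeta_{i,1}\}_{i=1}^B$, $\mathcal{B}_2=\{\zeta_{i,2}\}_{i=1}^B$ from $Z$: $Q(z;\mathcal{B}_1,\mathcal{B}_2):=\frac1B\sum_{i=1}^B[I+\beta\nabla^2F(z;\zeta_{i,1})P]\nabla F(z;\zeta_{i,2})$; $W(z;\mathcal{B}_1,\mathcal{B}_2):=$ the symmetric part $\frac12(A+A^\top)$ of $A=\frac1B\sum_{i=1}^B[I+\beta\nabla^2F(z;\zeta_{i,1})P]\nabla^2F(z;\zeta_{i,2})$; $G_y(z;\mathcal{B}_1):=\frac1B\sum_{i=1}^B\nabla_yF(z;\zeta_{i,1})$. S-ACQRN method. Inputs: deterministic $\boldsymbol z_0$, tolerance $\varepsilon>0$, $\Delta_0>0$, iteration count $T$, positive integer cycle lengths $S^g,S^h$, $\beta>\mu^{-1}$. Constants: $\alpha_1=2\beta\rho$, $\alpha_2=12c$ with $c=(3\beta L+1)\rho/6$, $R_\Delta=2\sqrt{\mu\Delta_0/(\beta\mu-1)}$, $c_1=(1+\beta\sigma_2)^2\sigma_1^2+\beta^2\sigma_2^2R_\Delta^2$, $c_2=L^2(1+\beta\sigma_2)^2+\beta^2\rho^2(\sigma_1^2+R_\Delta^2)$, $c_3=1+\beta(L+\sigma_2)$. For $k=0,\dots,T-1$: draw fresh independent i.i.d. batches $\mathcal{B}^g_{k,1},\mathcal{B}^g_{k,2},\mathcal{B}^h_{k,1},\mathcal{B}^h_{k,2},\mathcal{B}^g_{k,y}$ from $Z$, whose (positive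 integer) sizes are determined by the past and satisfy (i) $|\mathcal{B}^g_{k,1}|=|\mathcal{B}^g_{k,2}|\ge64c_1\varepsilon^{-2}$ if $S^g\mid k$, and $\ge\lfloor64c_2S^g\|\boldsymbol\xi_{k-1}\|^2\varepsilon^{-2}\rfloor+1$ otherwise; (ii) $|\mathcal{B}^h_{k,1}|=|\mathcal{B}^h_{k,2}|\ge648\sigma_2^2c_3^2(c\varepsilon)^{-1}$ if $S^h\mid k$, and $\ge\lfloor648\rho^2c_3^2S^h\|\boldsymbol\xi_{k-1}\|^2(c\varepsilon)^{-1}\rfloor+1$ otherwise; (iii) $|\mathcal{B}^g_{k,y}|\ge36(\sigma_1\beta\rho)^2(c\varepsilon)^{-1}$. Set $\boldsymbol g_k=Q(\boldsymbol z_k;\mathcal{B}^g_{k,1},\mathcal{B}^g_{k,2})$ if $S^g\mid k$, and $\boldsymbol g_k=Q(\boldsymbol z_k;\mathcal{B}^g_{k,1},\mathcal{B}^g_{k,2})-Q(\boldsymbol z_{k-1};\mathcal{B}^g_{k,1},\mathcal{B}^g_{k,2})+\boldsymbol g_{k-1}$ otherwise; $\bar{\boldsymbol H}_k=W(\boldsymbol z_k;\mathcal{B}^h_{k,1},\mathcal{B}^h_{k,2})$ if $S^h\mid k$, and $\bar{\boldsymbol H}_k=W(\boldsymbol z_k;\mathcal{B}^h_{k,1},\mathcal{B}^h_{k,2})-W(\boldsymbol z_{k-1};\mathcal{B}^h_{k,1},\mathcal{B}^h_{k,2})+\bar{\boldsymbol H}_{k-1}$ otherwise; $\boldsymbol g_{y,k}=G_y(\boldsymbol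 z_k;\mathcal{B}^g_{k,y})$. Choose a global minimizer $\boldsymbol\xi_k\in\arg\min_{\xi}\ \boldsymbol g_k^\top\xi+\frac12\xi^\top[\bar{\boldsymbol H}_k+\alpha_1\|\boldsymbol g_{y,k}\|I_{n+m}]\xi+\frac{\alpha_2}6\|\xi\|^3$ and set $\boldsymbol z_{k+1}=\boldsymbol z_k+\boldsymbol\xi_k$. Output: $z_{\mathrm{out}}=\boldsymbol z_{\tilde k}$, $\tilde k$ uniform on $\{1,\dots,T\}$ (drawn independently of the run). The $O(\cdot)$'s hide universal constants; ''sufficiently small'' depends on the problem data, $\beta$ and $\Delta_0$. *)

(* Defs.v *)
From HB Require Import structures.
From mathcomp Require Import all_boot all_order all_algebra.
From mathcomp Require Import all_classical all_reals all_analysis.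

Set Implicit Arguments.
Unset Strict Implicit.
Unset Printing Implicit Defensive.

Import Order.TTheory GRing.Theory Num.Theory.
Import numFieldNormedType.Exports.

Local Open Scope classical_set_scope.
Local Open Scope ring_scope.

(* The library norm on matrices is the sup norm; the Euclidean norm of a
   column vector is its Frobenius norm. *)
Definition fnorm {R : realType} {p q : nat} (A : 'M[R]_(p, q)) : R :=
  Num.sqrt (\sum_i \sum_j A i j ^+ 2).

Definition enorm {R : realType} {p : nat} (v : 'cV[R]_p) : R := fnorm v.

Definition snorm {R : realType} {p q : nat} (A : 'M[R]_(p, q)) : R :=
  sup [set enorm (A *m v) | v in [set v : 'cV[R]_q | enorm v <= 1]].

Definition lambda_min {R : realType} {p : nat} (A : 'M[R]_p) : R :=
  inf [set a | eigenvalue A a].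

Definition grad {R : realType} {p : nat} (f : 'cV[R]_p -> R) (z : 'cV[R]_p) :
    'cV[R]_p :=
  \col_i 'D_(delta_mx i 0) f z.

Definition hess {R : realType} {p : nat} (f : 'cV[R]_p -> R) (z : 'cV[R]_p) :
    'M[R]_p :=
  \matrix_(i, j) 'D_(delta_mx i 0) ('D_(delta_mx j 0) f) z.

Fixpoint continuously_differentiable {R : realType} {p : nat} (k : nat)
    (f : 'cV[R]_p -> R) : Prop :=
  if k is k'.+1 then
    (forall z, differentiable f z) /\
    (forall v, continuously_differentiable k' ('D_v f))
  else continuous f.

Definition twice_differentiable {R : realType} {p : nat}
    (f : 'cV[R]_p -> R) : Prop :=
  (forall z, differentiable f z) /\
  (forall v z, differentiable ('D_v f) z).

Definition strongly_concave {R : realType} {m : nat} (mu : R)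
    (u : 'cV[R]_m -> R) : Prop :=
  forall (y1 y2 : 'cV[R]_m) (t : R), 0 <= t <= 1 ->
    t * u y1 + (1 - t) * u y2 + mu / 2 * t * (1 - t) * enorm (y1 - y2) ^+ 2
      <= u (t *: y1 + (1 - t) *: y2).

Definition grad_y {R : realType} {n m : nat} (f : 'cV[R]_(n + m) -> R)
    (z : 'cV[R]_(n + m)) : 'cV[R]_m :=
  dsubmx (grad f z).

(* Under strong concavity the supremum is attained, so it is max_y f(x,y). *)
Definition Phi {R : realType} {n m : nat} (f : 'cV[R]_(n + m) -> R)
    (x : 'cV[R]_n) : R :=
  sup (range (fun y : 'cV[R]_m => f (col_mx x y))).

Definition Phi_bar {R : realType} {n m : nat} (f : 'cV[R]_(n + m) -> R) : R :=
  inf (range (Phi f)).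

Definition h_ {R : realType} {n m : nat} (beta : R) (f : 'cV[R]_(n + m) -> R)
    (z : 'cV[R]_(n + m)) : R :=
  f z + beta / 2 * enorm (grad_y f z) ^+ 2.

Record deterministic_assumptions {R : realType} {n m : nat} (mu L rho : R)
    (f : 'cV[R]_(n + m) -> R) : Prop := {
  mu_gt0 : 0 < mu;
  L_gt0 : 0 < L;
  rho_gt0 : 0 < rho;
  f_C3 : continuously_differentiable 3 f;
  f_concave : forall x : 'cV[R]_n,
    strongly_concave mu (fun y => f (col_mx x y));
  grad_lipschitz : forall z1 z2,
    enorm (grad f z1 - grad f z2) <= L * enorm (z1 - z2);
  hess_lipschitz : forall z1 z2,
    snorm (hess f z1 - hess f z2) <= rho * enorm (z1 - z2);
  Phi_lbounded : has_lbound (range (Phi f)) }.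

Record stochastic_assumptions {R : realType} {n m : nat}
    {d : measure_display} {U : measurableType d} (Z : probability U R)
    (L rho sigma1 sigma2 : R)
    (f : 'cV[R]_(n + m) -> R) (F : 'cV[R]_(n + m) -> U -> R) : Prop := {
  F_measurable : forall z, measurable_fun setT (F z);
  F_diff : forall s, twice_differentiable (F^~ s);
  F_mean : forall z, ('E_Z[F z] = (f z)%:E)%E;
  gradF_mean : forall z i,
    ('E_Z[fun s => grad (F^~ s) z i 0%R] = (grad f z i 0%R)%:E)%E;
  hessF_mean : forall z i j,
    ('E_Z[fun s => hess (F^~ s) z i j] = (hess f z i j)%:E)%E;
  gradF_moment : forall z,
    ('E_Z[fun s => (enorm (grad (F^~ s) z - grad f z) ^+ 3)%R]
      <= (sigma1 ^+ 3)%:E)%E;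
  gradF_lipschitz : forall z1 z2,
    ('E_Z[fun s => (enorm (grad (F^~ s) z1 - grad (F^~ s) z2) ^+ 3)%R]
      <= (L ^+ 3 * enorm (z1 - z2) ^+ 3)%:E)%E;
  hessF_moment : forall z,
    ('E_Z[fun s => (fnorm (hess (F^~ s) z) ^+ 3)%R]
      <= (sigma2 ^+ 3)%:E)%E;
  hessF_lipschitz : forall z1 z2,
    ('E_Z[fun s => (fnorm (hess (F^~ s) z1 - hess (F^~ s) z2) ^+ 3)%R]
      <= (rho ^+ 3 * enorm (z1 - z2) ^+ 3)%:E)%E }.

(* In the estimators, a batch is given by its size [B] and a sequence whose
   first [B] terms are its samples. *)

Definition projP {R : realType} {n m : nat} : 'M[R]_(n + m) :=
  block_mx 0 0 0 1%:M.

Definition precond {R : realType} {n m : nat} {U : Type} (beta : R)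
    (F : 'cV[R]_(n + m) -> U -> R) (s : U) (z : 'cV[R]_(n + m)) :
    'M[R]_(n + m) :=
  1%:M + beta *: (hess (F^~ s) z *m projP).

Definition Q_est {R : realType} {n m : nat} {U : Type} (beta : R)
    (F : 'cV[R]_(n + m) -> U -> R) (B : nat) (b1 b2 : nat -> U)
    (z : 'cV[R]_(n + m)) : 'cV[R]_(n + m) :=
  B%:R^-1 *: \sum_(i < B) precond beta F (b1 i) z *m grad (F^~ (b2 i)) z.

Definition W_est {R : realType} {n m : nat} {U : Type} (beta : R)
    (F : 'cV[R]_(n + m) -> U -> R) (B : nat) (b1 b2 : nat -> U)
    (z : 'cV[R]_(n + m)) : 'M[R]_(n + m) :=
  let A :=
    B%:R^-1 *: \sum_(i < B) precond beta F (b1 i) z *m hess (F^~ (b2 i)) z in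
  2^-1 *: (A + A^T).

Definition Gy_est {R : realType} {n m : nat} {U : Type}
    (F : 'cV[R]_(n + m) -> U -> R) (B : nat) (b : nat -> U)
    (z : 'cV[R]_(n + m)) : 'cV[R]_m :=
  B%:R^-1 *: \sum_(i < B) grad_y (F^~ (b i)) z.

Definition cst_c {R : realType} (L rho beta : R) : R :=
  (3 * beta * L + 1) * rho / 6.

Definition alpha1 {R : realType} (rho beta : R) : R :=
  2 * beta * rho.

Definition alpha2 {R : realType} (L rho beta : R) : R :=
  12 * cst_c L rho beta.

Definition R_Delta {R : realType} (mu beta Delta0 : R) : R :=
  2 * Num.sqrt (mu * Delta0 / (beta * mu - 1)).

Definition cst_c1 {R : realType} (mu sigma1 sigma2 beta Delta0 : R) : R :=
  (1 + beta * sigma2) ^+ 2 * sigma1 ^+ 2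
  + beta ^+ 2 * sigma2 ^+ 2 * R_Delta mu beta Delta0 ^+ 2.

Definition cst_c2 {R : realType}
    (mu L rho sigma1 sigma2 beta Delta0 : R) : R :=
  L ^+ 2 * (1 + beta * sigma2) ^+ 2
  + beta ^+ 2 * rho ^+ 2 * (sigma1 ^+ 2 + R_Delta mu beta Delta0 ^+ 2).

Definition cst_c3 {R : realType} (L sigma2 beta : R) : R :=
  1 + beta * (L + sigma2).

(* [Num.truncn] is the floor, as a natural number, of a nonnegative real. *)
Definition iterations {R : realType} (L rho beta Delta0 eps : R) : nat :=
  (Num.truncn (Delta0 * Num.sqrt (cst_c L rho beta)
               / (6 * eps `^ (3 / 2)))).+1.

Definition cubic_model {R : realType} {p : nat} (g : 'cV[R]_p) (H : 'M[R]_p)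
    (a2 : R) (xi : 'cV[R]_p) : R :=
  (g^T *m xi) 0 0 + 2^-1 * (xi^T *m H *m xi) 0 0 + a2 / 6 * enorm xi ^+ 3.

Inductive batch := Bg1 | Bg2 | Bh1 | Bh2 | Bgy.

Definition batches : seq batch := [:: Bg1; Bg2; Bh1; Bh2; Bgy].

(* [past k] is the sigma-algebra of the information available at the start of
   iteration [k].  Iteration [k] has at its disposal, for every batch [b], an
   infinite sequence [sample k b] from which the batch takes the first terms. *)
Record process (R : realType) (n m : nat) (U Omega : Type) := Process {
  past : nat -> set (set Omega);
  sample : nat -> batch -> nat -> Omega -> U;
  size_g : nat -> Omega -> nat;
  size_h : nat -> Omega -> nat;
  size_gy : nat -> Omega -> nat;
  iter_g : nat -> Omega -> 'cV[R]_(n + m);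
  iter_H : nat -> Omega -> 'M[R]_(n + m);
  iter_gy : nat -> Omega -> 'cV[R]_m;
  step : nat -> Omega -> 'cV[R]_(n + m);
  iterate : nat -> Omega -> 'cV[R]_(n + m);
  out_index : Omega -> nat }.

Definition z_out {R : realType} {n m : nat} {U Omega : Type}
    (X : process R n m U Omega) (w : Omega) : 'cV[R]_(n + m) :=
  iterate X (out_index X w) w.

Record sacqrn_run {R : realType} {n m : nat}
    {d : measure_display} {U : measurableType d} (Z : probability U R)
    (F : 'cV[R]_(n + m) -> U -> R)
    (mu L rho sigma1 sigma2 beta Delta0 eps : R) (z0 : 'cV[R]_(n + m))
    (Sg Sh T : nat)
    {d' : measure_display} {Omega : measurableType d'} (P : probability Omega R)
    (X : process R n m U Omega) : Prop := {
  past_sigma_algebra : forall k, sigma_algebra setT (past X k);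
  past_measurable : forall k, past X k `<=` measurable;
  past_incr : forall k, past X k `<=` past X k.+1;
    sample_adapted : forall k b i (A : set U), (k < T)%N -> measurable A ->
    past X k.+1 (sample X k b i @^-1` A);
  (* Given [past X k], the samples of iteration [k] are i.i.d. of law [Z];
     taking some [A b i] to be [setT] gives all finite subfamilies. *)
  sample_fresh : forall k (M : nat) (A : batch -> nat -> set U) (E : set Omega),
    (k < T)%N -> (forall b i, measurable (A b i)) -> past X k E ->
    fine (P (E `&` [set w | forall b i, (i < M)%N -> A b i (sample X k b i w)]))
    = fine (P E) * \prod_(b <- batches) \prod_(i < M) fine (Z (A b i));
  size_g_past : forall k N, (k < T)%N -> past X k [set w | size_g X k w = N];
  size_h_past : forall k N, (k < T)%N -> past X k [set w | size_h X k w = N];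
  size_gy_past : forall k N, (k < T)%N -> past X k [set w | size_gy X k w = N];
  size_gt0 : forall k w, (k < T)%N ->
    [/\ (0 < size_g X k w)%N, (0 < size_h X k w)%N & (0 < size_gy X k w)%N];
  size_g_large : forall k w, (k < T)%N ->
    if (Sg %| k)%N then
      64 * cst_c1 mu sigma1 sigma2 beta Delta0 / eps ^+ 2 <= (size_g X k w)%:R
    else
      ((Num.truncn (64 * cst_c2 mu L rho sigma1 sigma2 beta Delta0 * Sg%:R
          * enorm (step X k.-1 w) ^+ 2 / eps ^+ 2)).+1 <= size_g X k w)%N;
  size_h_large : forall k w, (k < T)%N ->
    if (Sh %| k)%N then
      648 * sigma2 ^+ 2 * cst_c3 L sigma2 beta ^+ 2 / (cst_c L rho beta * eps)
        <= (size_h X k w)%:R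
    else
      ((Num.truncn (648 * rho ^+ 2 * cst_c3 L sigma2 beta ^+ 2 * Sh%:R
          * enorm (step X k.-1 w) ^+ 2 / (cst_c L rho beta * eps))).+1
        <= size_h X k w)%N;
  size_gy_large : forall k w, (k < T)%N ->
    36 * (sigma1 * beta * rho) ^+ 2 / (cst_c L rho beta * eps)
      <= (size_gy X k w)%:R;
  iter_gE : forall k w, (k < T)%N ->
    let Qk := Q_est beta F (size_g X k w)
      (fun i => sample X k Bg1 i w) (fun i => sample X k Bg2 i w) in
    iter_g X k w =
      if (Sg %| k)%N then Qk (iterate X k w)
      else Qk (iterate X k w) - Qk (iterate X k.-1 w) + iter_g X k.-1 w;
  iter_HE : forall k w, (k < T)%N ->
    let Wk := W_est beta F (size_h X k w)
      (fun i => sample X k Bh1 i w) (fun i => sample X k Bh2 i w) in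
    iter_H X k w =
      if (Sh %| k)%N then Wk (iterate X k w)
      else Wk (iterate X k w) - Wk (iterate X k.-1 w) + iter_H X k.-1 w;
  iter_gyE : forall k w, (k < T)%N ->
    iter_gy X k w =
      Gy_est F (size_gy X k w) (fun i => sample X k Bgy i w) (iterate X k w);
  step_adapted : forall k i (A : set R), (k < T)%N -> measurable A ->
    past X k.+1 ((fun w => step X k w i 0) @^-1` A);
  step_argmin : forall k w xi, (k < T)%N ->
    let model := cubic_model (iter_g X k w)
      (iter_H X k w + (alpha1 rho beta * enorm (iter_gy X k w))%:M)
      (alpha2 L rho beta) in
    model (step X k w) <= model xi;
  iterate0 : forall w, iterate X 0 w = z0;
  iterateS : forall k w, (k < T)%N ->
    iterate X k.+1 w = iterate X k w + step X k w;
  out_index_range : forall w, (1 <= out_index X w <= T)%N;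
  out_index_measurable : forall j, measurable [set w | out_index X w = j];
  (* [E := setT] gives uniformity, and then general [E] independence. *)
  out_index_uniform : forall j (E : set Omega), (1 <= j <= T)%N ->
    past X T E ->
    fine (P (E `&` [set w | out_index X w = j])) = fine (P E) / T%:R }.

(* Main.v *)
Require Import Defs.
From HB Require Import structures.
From mathcomp Require Import all_boot all_order all_algebra.
From mathcomp Require Import all_classical all_reals all_analysis.
From mathcomp Require Import measurable_realfun ring lra.
Set Implicit Arguments.
Unset Strict Implicit.
Unset Printing Implicit Defensive.
Import Order.TTheory GRing.Theory Num.Theory.
Import numFieldNormedType.Exports.
Local Open Scope classical_set_scope.
Local Open Scope ring_scope.

(** Let [h] be the penalized objective, [tau = Num.sqrt (c * eps)],
    [eta = eps ^+ 2 / tau], and let [Hbar = (I + beta *: (hess f *m P)) *m hess f],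
    the part of [hess h] that contains no third derivative of [f].

    Why the subproblem is a model of [h]. The part of [hess h] that [Hbar] neglects
    is the third derivative of [f] in the direction [P *m grad f]; as [hess f] is
    Lipschitz, its quadratic form is at most [beta * rho * |grad_y f|]
    ([normr_form_T3]), which the regularization by [|g_y|] compensates
    ([h_descent]). Strong concavity in [y] controls [|grad_y f|], both by
    [|grad h|] ([grad_h_ge]) and by the gap [h - Phi_bar] ([h_gap]).

    One iteration. A global minimizer of a cubic model satisfies a first-order
    equation, makes the regularized matrix positive semidefinite and decreases the
    model by a multiple of the cube of its length ([cubic_model_stationary],
    [cubic_model_psd], [cubic_model_decrease]). With the Taylor estimates for [h]
    and Young's inequality this yields three inequalities that hold surely. The
    first says that [h] decreases by a gain, up to a cost that is a sum of powers
    of the errors of the estimates ([step_decrease]); the two others bound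
    [|grad h|] and [- lambda_min (hess h)] at the new point by multiples of [eps]
    and of [tau], plus weighted sums of that cost and that gain ([step_grad],
    [step_lambda]).

    The errors. The error of a recursive estimate is the error of the previous
    iteration plus an average of centered noise that is independent of the past
    ([err_gE], [integral_freeze]). Second moments therefore add up. The errors of
    [H] and of [g_y] are needed in third moment, for which centered noise of third
    moment [dl ^+ 3] is shown to act on [(|y| ^+ 2 + s) `^ (3 / 2)] at worst as
    the addition of [3 * dl ^+ 2] to [s] ([cube_step]). Adding the samples of a
    batch one by one divides that charge by the size of the batch
    ([batch_potential]), and the sizes are such that the charges of a cycle sum to
    [c * eps] or [eps ^+ 2], up to a factor below 1 ([err_H_moment],
    [err_y_moment], [err_g_moment]). For the gradient this presupposes that
    [|grad_y f| ^+ 2] has mean at most [R_Delta ^+ 2], which follows from [h_gap]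
    and from the decrease of [h] so far, by induction on the iteration
    ([cost_bound]).

    Conclusion. The mean cost of an iteration is at most [eta]. As [T] is about
    [Delta0 / (6 * eta)], the total cost is at most [T * eta] and the total gain at
    most [7 * (T * eta)]. The output averages over the iterates ([integral_z_out]),
    and the weights of [step_grad] and [step_lambda] turn [eta] into [eps] and
    [tau]. *)

(** * The Frobenius inner product *)

Section Frobenius.
Context {R : realType}.

Definition fdot {p q : nat} (A B : 'M[R]_(p, q)) : R :=
  \sum_i \sum_j A i j * B i j.

Section FrobeniusInner.
Context {p q : nat}.
Implicit Types (A B C : 'M[R]_(p, q)) (a : R).

Lemma fdotC A B : fdot A B = fdot B A.
Proof. by apply: eq_bigr => i _; apply: eq_bigr => j _; rewrite mulrC. Qed.

Lemma fdotDl A B C : fdot (A + B) C = fdot A C + fdot B C.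
Proof.
rewrite -big_split; apply: eq_bigr => i _; rewrite -big_split.
by apply: eq_bigr => j _; rewrite mxE mulrDl.
Qed.

Lemma fdotZl a A B : fdot (a *: A) B = a * fdot A B.
Proof.
rewrite /fdot mulr_sumr; apply: eq_bigr => i _; rewrite mulr_sumr.
by apply: eq_bigr => j _; rewrite mxE mulrA.
Qed.

Lemma fdotNl A B : fdot (- A) B = - fdot A B.
Proof. by rewrite -scaleN1r fdotZl mulN1r. Qed.

Lemma fdotDr A B C : fdot A (B + C) = fdot A B + fdot A C.
Proof. by rewrite fdotC fdotDl !(fdotC A). Qed.

Lemma fdotZr a A B : fdot A (a *: B) = a * fdot A B.
Proof. by rewrite fdotC fdotZl fdotC. Qed.

Lemma fdotNr A B : fdot A (- B) = - fdot A B.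
Proof. by rewrite fdotC fdotNl fdotC. Qed.

Lemma fdot0l A : fdot 0 A = 0.
Proof. by rewrite -(scale0r 0) fdotZl mul0r. Qed.

Lemma fdot_ge0 A : 0 <= fdot A A.
Proof. by apply: sumr_ge0 => i _; apply: sumr_ge0 => j _; rewrite -expr2 sqr_ge0. Qed.

Lemma fnorm_ge0 A : 0 <= fnorm A.
Proof. exact: sqrtr_ge0. Qed.

Lemma fnorm_sqr A : fnorm A ^+ 2 = fdot A A.
Proof.
rewrite /fnorm sqr_sqrtr.
  by apply: eq_bigr => i _; apply: eq_bigr => j _; rewrite expr2.
by apply: sumr_ge0 => i _; apply: sumr_ge0 => j _; rewrite sqr_ge0.
Qed.

Lemma entry_le_fnorm A i j : `|A i j| <= fnorm A.
Proof.
rewrite -(@ler_pXn2r _ 2) ?nnegrE ?fnorm_ge0// fnorm_sqr real_normK ?num_real//.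
rewrite /fdot (bigD1 i)//= (bigD1 j)//= -expr2.
rewrite -addrA lerDl addr_ge0//.
  by apply: sumr_ge0 => k _; rewrite -expr2 sqr_ge0.
by apply: sumr_ge0 => k _; apply: sumr_ge0 => l _; rewrite -expr2 sqr_ge0.
Qed.

Lemma fnorm_eq0 A : fnorm A = 0 -> A = 0.
Proof.
move=> A0; apply/matrixP => i j; rewrite mxE.
by apply/normr0_eq0/le_anti; rewrite normr_ge0 -A0 entry_le_fnorm.
Qed.

Lemma fnorm0 : fnorm (0 : 'M[R]_(p, q)) = 0.
Proof.
apply/eqP; have := fnorm_sqr (0 : 'M[R]_(p, q)).
by rewrite fdot0l => /eqP; rewrite expf_eq0.
Qed.

Lemma fnormZ a A : fnorm (a *: A) = `|a| * fnorm A.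
Proof.
apply/eqP; rewrite -(@eqrXn2 _ 2) ?mulr_ge0 ?fnorm_ge0//.
by rewrite exprMn !fnorm_sqr fdotZl fdotZr real_normK ?num_real// mulrA expr2.
Qed.

Lemma fnormN A : fnorm (- A) = fnorm A.
Proof. by rewrite -scaleN1r fnormZ normrN1 mul1r. Qed.

Lemma fnormB A B : fnorm (A - B) = fnorm (B - A).
Proof. by rewrite -opprB fnormN. Qed.

(** The square of [|B| A - |A| B] is nonnegative. *)
Lemma fdot_le A B : fdot A B <= fnorm A * fnorm B.
Proof.
have [B0|Bn0] := eqVneq (fnorm B) 0.
  by rewrite (fnorm_eq0 B0) fdotC fdot0l fnorm0 mulr0.
have Bgt0 : 0 < fnorm B by rewrite lt0r Bn0 fnorm_ge0.
have [A0|An0] := eqVneq (fnorm A) 0.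
  by rewrite (fnorm_eq0 A0) fdot0l fnorm0 mul0r.
have Agt0 : 0 < fnorm A by rewrite lt0r An0 fnorm_ge0.
have := fdot_ge0 (fnorm B *: A - fnorm A *: B).
rewrite fdotDl !fdotDr !fdotNl !fdotNr !fdotZl !fdotZr -!fnorm_sqr (fdotC B A).
move=> H; have {}H : 0 <= (2 * fnorm A * fnorm B) * (fnorm A * fnorm B - fdot A B).
  by move: H; lra.
by move: H; rewrite pmulr_rge0 ?subr_ge0// !mulr_gt0.
Qed.

Lemma fdot_ge A B : - (fnorm A * fnorm B) <= fdot A B.
Proof. by rewrite lerNl -fdotNl -(fnormN A) fdot_le. Qed.

Lemma ler_fnormD A B : fnorm (A + B) <= fnorm A + fnorm B.
Proof.
rewrite -(@ler_pXn2r _ 2) ?nnegrE ?addr_ge0 ?fnorm_ge0//.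
rewrite sqrrD !fnorm_sqr fdotDl !fdotDr (fdotC B A) -mulr_natr.
have := fdot_le A B; lra.
Qed.

Lemma ler_fnormB A B : fnorm (A - B) <= fnorm A + fnorm B.
Proof. by rewrite (le_trans (ler_fnormD _ _))// fnormN. Qed.

Lemma ler_distfnorm A B : fnorm A <= fnorm B + fnorm (A - B).
Proof. by rewrite -{1}(subrK B A) addrC (le_trans (ler_fnormD _ _))// addrC. Qed.

Lemma fnormD_sqr A B :
  fnorm (A + B) ^+ 2 = fnorm A ^+ 2 + 2 * fdot A B + fnorm B ^+ 2.
Proof. by rewrite !fnorm_sqr fdotDl !fdotDr (fdotC B A); lra. Qed.

End FrobeniusInner.

Lemma fnorm_tr p q (A : 'M[R]_(p, q)) : fnorm A^T = fnorm A.
Proof.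
congr Num.sqrt; rewrite exchange_big/=.
by apply: eq_bigr => i _; apply: eq_bigr => j _; rewrite !mxE.
Qed.

(** The entries of a product are inner products of rows with columns, to which
    the Cauchy-Schwarz inequality applies. *)
Lemma fnorm_mulmx p q r (A : 'M[R]_(p, q)) (B : 'M[R]_(q, r)) :
  fnorm (A *m B) <= fnorm A * fnorm B.
Proof.
rewrite -(@ler_pXn2r _ 2) ?nnegrE ?mulr_ge0 ?fnorm_ge0// exprMn.
have sqrE k l (C : 'M[R]_(k, l)) : fnorm C ^+ 2 = \sum_i fnorm (row i C) ^+ 2.
  rewrite fnorm_sqr; apply: eq_bigr => i _; rewrite fnorm_sqr /fdot big_ord1.
  by apply: eq_bigr => j _; rewrite !mxE.
rewrite -(fnorm_tr B) (sqrE _ _ A) (sqrE _ _ B^T) [leLHS]fnorm_sqr /fdot mulr_suml.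
apply: ler_sum => i _; rewrite mulr_sumr; apply: ler_sum => j _.
have -> : (A *m B) i j = fdot (row i A) (row j B^T).
  rewrite /fdot big_ord1 mxE; apply: eq_bigr => k _; by rewrite !mxE.
rewrite -exprMn -expr2 -[leLHS]real_normK ?num_real//.
rewrite ler_pXn2r ?nnegrE ?mulr_ge0 ?fnorm_ge0//.
by rewrite ler_norml fdot_le fdot_ge.
Qed.

End Frobenius.

(** * Quadratic forms and the smallest eigenvalue *)

Section SpectralNorm.
Context {R : realType} {p : nat}.
Implicit Types (A B : 'M[R]_p) (v w : 'cV[R]_p).

Definition form A v : R := fdot v (A *m v).

Lemma dot_trE v w : (v^T *m w) 0 0 = fdot v w.
Proof. by rewrite mxE /fdot; apply: eq_bigr => i _; rewrite big_ord1 mxE. Qed.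

Lemma fdot_mulmxl (A : 'M[R]_p) v w : fdot (A *m v) w = fdot v (A^T *m w).
Proof. by rewrite -!dot_trE trmx_mul mulmxA. Qed.

Lemma formE A v : (v^T *m A *m v) 0 0 = form A v.
Proof. by rewrite -mulmxA dot_trE. Qed.

Lemma formDl A B v : form (A + B) v = form A v + form B v.
Proof. by rewrite /form mulmxDl fdotDr. Qed.

Lemma formZl a A v : form (a *: A) v = a * form A v.
Proof. by rewrite /form -scalemxAl fdotZr. Qed.

Lemma form_scalar a v : form a%:M v = a * fnorm v ^+ 2.
Proof. by rewrite /form mul_scalar_mx fdotZr fnorm_sqr. Qed.

Lemma formBl A B v : form (A - B) v = form A v - form B v.
Proof. by rewrite /form mulmxBl fdotDr fdotNr. Qed.

Lemma form_tr A v : form A^T v = form A v.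
Proof. by rewrite /form -fdot_mulmxl fdotC. Qed.

Lemma formD A v w : A^T = A ->
  form A (v + w) = form A v + 2 * fdot w (A *m v) + form A w.
Proof.
move=> sA; rewrite /form mulmxDr !fdotDr !fdotDl (fdotC v (A *m w)).
by rewrite (fdot_mulmxl A w) sA; lra.
Qed.

Lemma formZ A a v : form A (a *: v) = a ^+ 2 * form A v.
Proof. by rewrite /form -scalemxAr fdotZl fdotZr mulrA expr2. Qed.

Lemma normr_form_le A (l : R) v : (forall w, fnorm (A *m w) <= l * fnorm w) ->
  `|form A v| <= l * fnorm v ^+ 2.
Proof.
move=> Al; have h : fnorm v * fnorm (A *m v) <= l * fnorm v ^+ 2.
  rewrite [leRHS](_ : _ = fnorm v * (l * fnorm v)); last by ring.
  by rewrite ler_wpM2l// fnorm_ge0.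
by rewrite ler_norml (le_trans (fdot_le _ _) h) lerNl (le_trans _ h)// lerNl fdot_ge.
Qed.

Lemma normr_form_le_fnorm A v : `|form A v| <= fnorm A * fnorm v ^+ 2.
Proof. by apply: normr_form_le => w; exact: fnorm_mulmx. Qed.

(** The supremum that defines [snorm] is finite because the Frobenius norm
    bounds it; then scale [v] to the unit ball. *)
Lemma snorm_bound (q : nat) (A : 'M[R]_(q, p)) v :
  fnorm (A *m v) <= snorm A * fnorm v.
Proof.
have supA : has_sup [set enorm (A *m v) | v in [set v : 'cV[R]_p | enorm v <= 1]].
  split; first by exists (enorm (A *m 0)); exists 0 => //=; rewrite /enorm fnorm0.
  exists (fnorm A) => _ [w /= w1 <-]; rewrite /enorm (le_trans (fnorm_mulmx _ _))//.
  by rewrite ler_piMr// fnorm_ge0.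
have [v0|vn0] := eqVneq (fnorm v) 0.
  by rewrite (fnorm_eq0 v0) mulmx0 !fnorm0 mulr0.
have vgt0 : 0 < fnorm v by rewrite lt0r vn0 fnorm_ge0.
rewrite -ler_pdivrMr//.
have -> : fnorm (A *m v) / fnorm v = enorm (A *m ((fnorm v)^-1 *: v)).
  by rewrite -scalemxAr /enorm fnormZ mulrC ger0_norm// invr_ge0 ltW.
apply: ub_le_sup; first exact: supA.2.
exists ((fnorm v)^-1 *: v) => //=.
by rewrite /enorm fnormZ ger0_norm ?mulVf// invr_ge0 ltW.
Qed.

End SpectralNorm.

Section LambdaMin.
Context {R : realType} {p : nat}.
Implicit Types (A B : 'M[R]_p) (v w : 'cV[R]_p).

(** Eigenvectors are row vectors, but a matrix and its transpose have the same
    quadratic form. *)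
Lemma eigenvalue_form A a : eigenvalue A a ->
  exists2 v, 0 < fnorm v & form A v = a * fnorm v ^+ 2.
Proof.
move=> /eigenvalueP[u uA un0]; exists u^T.
  rewrite lt0r fnorm_ge0 andbT; apply/eqP => /fnorm_eq0 /(congr1 trmx).
  by rewrite trmxK trmx0 => u0; rewrite u0 eqxx in un0.
by rewrite -form_tr /form -trmx_mul uA linearZ/= fdotZr fnorm_sqr.
Qed.

Lemma eigenvalue_ge A s a : (forall v, - s * fnorm v ^+ 2 <= form A v) ->
  eigenvalue A a -> - s <= a.
Proof.
move=> As /eigenvalue_form[v v0 Av]; have := As v.
by rewrite Av ler_pM2r// exprn_gt0.
Qed.

Lemma eigenvalue_le A s a : (forall v, form A v <= s * fnorm v ^+ 2) ->
  eigenvalue A a -> a <= s.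
Proof.
move=> As /eigenvalue_form[v v0 Av]; have := As v.
by rewrite Av ler_pM2r// exprn_gt0.
Qed.

(** The sign of [s] matters when there is no eigenvalue: the infimum is then 0. *)
Lemma lambda_min_ge A s : 0 <= s -> (forall v, - s * fnorm v ^+ 2 <= form A v) ->
  - s <= lambda_min A.
Proof.
move=> s0 As; rewrite /lambda_min.
have [->|/set0P E] := eqVneq [set a | eigenvalue A a] set0.
  by rewrite inf0 oppr_le0.
by apply: lb_le_inf => // a /=; exact: eigenvalue_ge.
Qed.

Lemma lambda_min_le A s : 0 <= s -> (forall v, `|form A v| <= s * fnorm v ^+ 2) ->
  lambda_min A <= s.
Proof.
move=> s0 As; rewrite /lambda_min.
have [->|/set0P[a Aa]] := eqVneq [set a | eigenvalue A a] set0; first by rewrite inf0.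
apply: (@le_trans _ _ a); last first.
  by apply: eigenvalue_le Aa => v; rewrite (le_trans (ler_norm _)).
apply: ge_inf => //; exists (- s) => b /=.
by apply: eigenvalue_ge => v; rewrite mulNr; have := As v; rewrite ler_norml => /andP[].
Qed.

End LambdaMin.

Section Rayleigh.
Context {R : realType} {p : nat}.
Implicit Types (A B : 'M[R]_p) (v w : 'cV[R]_p).

(** The perturbation principle behind all first-order conditions below: a
    perturbation of size [t] leaves a remainder of order [t], and [t] tends to 0. *)
Lemma le0_of_le_small (a b : R) :
  0 <= b -> (forall t, 0 < t -> t <= 1 -> a <= t * b) -> a <= 0.
Proof.
move=> b0 h; rewrite leNgt; apply/negP => a0.
have b1 : 0 < 2 * (a + b + 1) by rewrite mulr_gt0// ltr_wpDl// addr_ge0// ltW.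
have := h (a / (2 * (a + b + 1))) _ _.
rewrite divr_gt0// => /(_ isT); rewrite ler_pdivrMr// mul1r.
have -> : a <= 2 * (a + b + 1) by lra.
move=> /(_ isT); rewrite mulrAC ler_pdivlMr//; apply/negP; rewrite -ltNge.
by rewrite ltr_pM2l//; lra.
Qed.

Lemma continuous_finsum (T : topologicalType) (x : T) (I : finType)
    (f : I -> T -> R) : (forall i, {for x, continuous (f i)}) ->
  {for x, continuous (fun y => \sum_i f i y)}.
Proof.
move=> fc; rewrite /prop_for /continuous_at.
by apply: cvg_big => [|i _]; [exact: add_continuous|exact: fc].
Qed.

Lemma continuous_fnorm q r : continuous (fun A : 'M[R]_(q, r) => fnorm A).
Proof.
move=> A; apply: (@continuous_comp _ _ _
    (fun A : 'M[R]_(q, r) => \sum_i \sum_j A i j ^+ 2) (@Num.sqrt R)).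
  apply: continuous_finsum => i; apply: continuous_finsum => j.
  by apply: (@continuousM _ _ (fun B : 'M[R]_(q, r) => B i j)
    (fun B : 'M[R]_(q, r) => B i j)); exact: coord_continuous.
exact: sqrt_continuous.
Qed.

Lemma mx_norm_le (q r : nat) (A : 'M[R]_(q, r)) (C : R) : 0 <= C ->
  (forall i j, `|A i j| <= C) -> `|A| <= C.
Proof.
move=> C0 AC; rewrite [leLHS]/Num.norm/= mx_normE -[C]/((NngNum C0)%:num) num_le.
apply/bigmax_leP; split; first by rewrite -num_le/=.
by move=> i _; rewrite -num_le/=.
Qed.

(** The unit sphere is compact. The bound is stated for all vectors, by
    homogeneity. *)
Lemma form_min_on_sphere A : (0 < p)%N ->
  exists2 v : 'cV[R]_p, fnorm v = 1 &
    forall w, form A v * fnorm w ^+ 2 <= form A w.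
Proof.
move=> p0.
pose S := [set u : 'rV[R]_p | fnorm u = 1].
have S0 : S !=set0.
  exists (delta_mx 0 (Ordinal p0)); rewrite /S/=; apply/eqP.
  rewrite -(@eqrXn2 _ 2) ?fnorm_ge0// fnorm_sqr expr1n /fdot big_ord1.
  rewrite (bigD1 (Ordinal p0))//= mxE !eqxx mulr1 big1 ?addr0// => j jn.
  by rewrite mxE (negbTE jn) andbF mul0r.
have cS : compact S.
  apply: bounded_closed_compact.
    exists 1; split => // x x1 u /= u1; apply: mx_norm_le => [|i j].
      by rewrite ltW// (lt_trans _ x1).
    by rewrite (le_trans (entry_le_fnorm _ _ _))// u1 ltW.
  apply: (@closed_comp _ _ (fun u : 'rV[R]_p => fnorm u) [set 1]).
    by move=> u _; exact: continuous_fnorm.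
  exact: closed_eq.
have cf : {within S, continuous (fun u : 'rV[R]_p => form A u^T)}.
  apply: continuous_subspaceT => u; rewrite /form /fdot.
  have uc k l : {for u, continuous (fun w : 'rV[R]_p => w^T k l)}.
    rewrite /prop_for /continuous_at mxE; under eq_fun do rewrite mxE; exact: coord_continuous.
  apply: continuous_finsum => i; apply: continuous_finsum => j.
  apply: (@continuousM _ _ (fun w : 'rV[R]_p => w^T i j)
    (fun w : 'rV[R]_p => (A *m w^T) i j)); first exact: uc.
  rewrite /prop_for /continuous_at; under eq_fun do rewrite mxE; rewrite mxE.
  apply: (@continuous_finsum _ u _ (fun k (w : 'rV[R]_p) => A i k * w^T k j)) => k.
  apply: (@continuousM _ _ (fun w : 'rV[R]_p => A i k) (fun w : 'rV[R]_p => w^T k j)).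
    exact: cst_continuous.
  exact: uc.
have [u uS umin] := compact_EVT_min S0 cS cf.
exists u^T; first by rewrite fnorm_tr; move: uS; rewrite inE.
move=> w; have [w0|wn0] := eqVneq (fnorm w) 0.
  by rewrite (fnorm_eq0 w0) /form fnorm0 expr0n/= mulr0 fdot0l.
have wgt0 : 0 < fnorm w by rewrite lt0r wn0 fnorm_ge0.
have /umin : ((fnorm w)^-1 *: w)^T \in S.
  by rewrite inE /S/= fnorm_tr fnormZ ger0_norm ?mulVf// invr_ge0 ltW.
rewrite trmxK formZ exprVn mulrC ler_pdivlMr// exprn_gt0//.
Qed.

(** A minimizer [u] of the form on the sphere is an eigenvector: otherwise the
    residual [A *m u - a *: u] would be a direction of decrease. *)
Lemma min_eigenvalue A : A^T = A -> (0 < p)%N ->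
  exists2 a, eigenvalue A a & forall v, a * fnorm v ^+ 2 <= form A v.
Proof.
move=> sA /(form_min_on_sphere A)[u u1 umin].
pose a := form A u.
have uA : A *m u = a *: u.
  apply/eqP; rewrite -subr_eq0; apply/eqP/fnorm_eq0.
  set d := A *m u - a *: u.
  apply/eqP; rewrite -sqrf_eq0; apply/eqP/le_anti; rewrite sqr_ge0 andbT.
  (* perturb the minimizer in direction - d *)
  pose K := `|form A d| + `|a| * fnorm d ^+ 2.
  apply: (@le0_of_le_small _ K) => [|t t0 _].
    by rewrite addr_ge0// mulr_ge0// sqr_ge0.
  have := umin (u + (- t) *: d).
  rewrite formD// fnormD_sqr formZ fdotZl fdotZr fnormZ u1 -/a => H.
  have dd : fnorm d ^+ 2 = fdot d (A *m u) - a * fdot u d.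
    by rewrite fnorm_sqr {1}/d fdotDl fdotNl fdotZl fdotC.
  have fK : form A d - a * fnorm d ^+ 2 <= K.
    rewrite /K lerD ?ler_norm// -mulNr ler_wpM2r ?sqr_ge0// -normrN ler_norm//.
  move: H; rewrite exprMn real_normK ?num_real// => H.
  have {}H : 2 * t * fnorm d ^+ 2 <= t ^+ 2 * (form A d - a * fnorm d ^+ 2).
    by rewrite dd; move: H; rewrite dd; lra.
  have {}H : t * (2 * fnorm d ^+ 2) <= t * (t * K).
    apply: (le_trans _ (_ : t ^+ 2 * K <= _)); last by rewrite expr2 mulrA.
    rewrite [leLHS](_ : _ = 2 * t * fnorm d ^+ 2); last by ring.
    by rewrite (le_trans H)// ler_wpM2l// sqr_ge0.
  rewrite ler_pM2l// in H; rewrite (le_trans _ H)// mulrC.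
  by rewrite ler_peMr ?sqr_ge0// ler1n.
have eA : eigenvalue A a.
  apply/eigenvalueP; exists u^T; first by rewrite -{1}sA -trmx_mul uA linearZ.
  apply/eqP => /(congr1 trmx); rewrite trmxK trmx0 => u0.
  by move: u1; rewrite u0 fnorm0 => /esym/eqP; rewrite oner_eq0.
by exists a.
Qed.

Lemma lambda_min_form A v : A^T = A -> lambda_min A * fnorm v ^+ 2 <= form A v.
Proof.
move=> sA; have [p0|] := posnP p.
  rewrite (_ : v = 0) ?/form ?fnorm0 ?expr0n/= ?mulr0 ?fdot0l//.
  by apply/matrixP => i; have := ltn_ord i; rewrite [X in (_ < X)%N]p0.
move=> /(min_eigenvalue sA)[a Aa amin].
apply: le_trans (amin v); rewrite ler_wpM2r ?sqr_ge0//.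
apply: ge_inf => //; exists (- (fnorm A)) => b /=.
apply: eigenvalue_ge => w; rewrite mulNr.
by have := normr_form_le_fnorm A w; rewrite ler_norml => /andP[].
Qed.

(** Test the form of one matrix on an eigenvector of the other. *)
Lemma lambda_min_lipschitz A B : A^T = A -> B^T = B ->
  `|lambda_min A - lambda_min B| <= fnorm (A - B).
Proof.
move=> sA sB; suff h (C D : 'M[R]_p) : C^T = C -> D^T = D ->
    lambda_min C - lambda_min D <= fnorm (C - D).
  by rewrite ler_norml h// andbT lerNl opprB fnormB h.
move=> sC sD; have [p0|p0] := posnP p.
  rewrite (_ : C = D) ?subrr ?fnorm0//.
  by apply/matrixP => i; have := ltn_ord i; rewrite [X in (_ < X)%N]p0.
rewrite lerBlDr addrC -lerBlDr; rewrite {2}/lambda_min.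
apply: lb_le_inf.
  by have [a Da _] := min_eigenvalue sD p0; exists a.
move=> b /= /eigenvalue_form[v v0 Dv].
rewrite -(@ler_pM2r _ (fnorm v ^+ 2)) ?exprn_gt0// -Dv mulrBl.
have := lambda_min_form v sC; have := normr_form_le_fnorm (C - D) v.
rewrite formBl ler_norml => /andP[_]; lra.
Qed.

End Rayleigh.

(** * Global minimizers of a cubic model *)

Section CubicNorm.
Context {R : realType} {p q : nat}.
Implicit Types (Y D : 'M[R]_(p, q)).

(** Here [w] and [r] are two norms at distance at most [d] and [t] is an inner
    product. The first-order term of [w ^+ 3] is read off [w ^+ 2 - r ^+ 2], and
    the rest is a multiple of [(w - r) ^+ 2]. *)
Lemma cube_expand (w r t d : R) : 0 <= r -> 0 <= w -> 0 <= d ->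
  w <= r + d -> r <= w + d -> w ^+ 2 = r ^+ 2 + 2 * t + d ^+ 2 ->
  w ^+ 3 <= r ^+ 3 + 3 * r * t + 3 * r * d ^+ 2 + d ^+ 3.
Proof.
move=> r0 w0 d0 wr rw E.
have -> : w ^+ 3 = r ^+ 3 + 3 / 2 * r * (w ^+ 2 - r ^+ 2)
    + (w - r) ^+ 2 * (w + r / 2) by field.
have h1 : (w - r) ^+ 2 <= d ^+ 2.
  rewrite -real_normK ?num_real// ler_pXn2r ?nnegrE// ler_norml; lra.
have h2 : (w - r) ^+ 2 * (w + r / 2) <= d ^+ 2 * (r + d + r / 2).
  by rewrite ler_pM ?sqr_ge0//; lra.
by rewrite E; move: h2; rewrite !exprS expr0; lra.
Qed.

(** The norm of [Y] completed by an orthogonal coordinate of square [a]. In the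
    moment bounds, [a] stands for the noise of the samples still to be added. *)
Definition augnorm (a : R) Y : R := Num.sqrt (fnorm Y ^+ 2 + a).

Lemma augnorm_ge0 a Y : 0 <= augnorm a Y. Proof. exact: sqrtr_ge0. Qed.

Lemma augnorm_sqr a Y : 0 <= a -> augnorm a Y ^+ 2 = fnorm Y ^+ 2 + a.
Proof. by move=> a0; rewrite sqr_sqrtr// addr_ge0// sqr_ge0. Qed.

Lemma augnorm0 Y : augnorm 0 Y = fnorm Y.
Proof. by rewrite /augnorm addr0 sqrtr_sqr ger0_norm// fnorm_ge0. Qed.

Lemma fnorm_le_augnorm a Y : 0 <= a -> fnorm Y <= augnorm a Y.
Proof.
move=> a0; rewrite -(@ler_pXn2r _ 2) ?nnegrE ?augnorm_ge0 ?fnorm_ge0//.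
by rewrite augnorm_sqr// lerDl.
Qed.

Lemma augnormD_le a Y D : 0 <= a -> augnorm a (Y + D) <= augnorm a Y + fnorm D.
Proof.
move=> a0; rewrite -(@ler_pXn2r _ 2) ?nnegrE ?addr_ge0 ?augnorm_ge0 ?fnorm_ge0//.
rewrite sqrrD !augnorm_sqr// fnormD_sqr -mulr_natr.
have := fdot_le Y D; have := fnorm_le_augnorm Y a0; have := fnorm_ge0 D.
move=> D0 YY YD.
have : fnorm Y * fnorm D <= augnorm a Y * fnorm D by rewrite ler_wpM2r.
lra.
Qed.

Lemma augnorm_cube a Y D : 0 <= a ->
  augnorm a (Y + D) ^+ 3 <= augnorm a Y ^+ 3 + 3 * augnorm a Y * fdot Y D
    + 3 * augnorm a Y * fnorm D ^+ 2 + fnorm D ^+ 3.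
Proof.
move=> a0; apply: cube_expand; rewrite ?augnorm_ge0 ?fnorm_ge0//.
- exact: augnormD_le.
- by rewrite -{1}(addrK D Y) -(fnormN D) augnormD_le.
- by rewrite !augnorm_sqr// fnormD_sqr; lra.
Qed.

Lemma fnorm_cube Y D : fnorm (Y + D) ^+ 3 <= fnorm Y ^+ 3 +
  3 * fnorm Y * fdot Y D + 3 * fnorm Y * fnorm D ^+ 2 + fnorm D ^+ 3.
Proof. by have := augnorm_cube Y D (lexx 0); rewrite !augnorm0. Qed.

End CubicNorm.

Section CubicModel.
Context {R : realType} {p : nat} (g : 'cV[R]_p) (A : 'M[R]_p) (s : R)
  (xi : 'cV[R]_p).
Hypothesis sA : A^T = A.
Hypothesis s_ge0 : 0 <= s.
Hypothesis xi_min : forall v, cubic_model g A (2 * s) xi <= cubic_model g A (2 * s) v.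

Lemma cubic_modelE v :
  cubic_model g A (2 * s) v = fdot g v + 2^-1 * form A v + s / 3 * fnorm v ^+ 3.
Proof.
rewrite /cubic_model dot_trE formE /enorm.
by congr (_ + _ * _); rewrite -[RHS]/(s / 3); field.
Qed.

(** Moving from the minimizer against the residual [G] would decrease the model. *)
Lemma cubic_model_stationary : g + A *m xi + (s * fnorm xi) *: xi = 0.
Proof.
move GE : (_ + _) => G; apply: fnorm_eq0; apply/eqP; rewrite -sqrf_eq0; apply/eqP.
apply/le_anti; rewrite sqr_ge0 andbT.
pose r := fnorm xi; pose d := fnorm G.
have r0 : 0 <= r by exact: fnorm_ge0.
have d0 : 0 <= d by exact: fnorm_ge0.
pose K := 2^-1 * `|form A G| + s * r * d ^+ 2 + s / 3 * d ^+ 3.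
have K0 : 0 <= K.
  have h1 : 0 <= `|form A G| by [].
  have h2 : 0 <= s * r * d ^+ 2 by rewrite !mulr_ge0// sqr_ge0.
  have h3 : 0 <= s / 3 * d ^+ 3 by rewrite mulr_ge0 ?divr_ge0// exprn_ge0.
  by rewrite /K; lra.
(* compare with the point xi - t G, for t small *)
have key t : 0 < t -> t <= 1 -> d ^+ 2 <= t * K.
  move=> t0 t1; have := xi_min (xi + (- t) *: G); rewrite !cubic_modelE.
  have := fnorm_cube xi ((- t) *: G).
  rewrite fdotDr fdotZr formD// formZ !fdotZl fdotZr fnormZ normrN (gtr0_norm t0).
  rewrite -/r -/d => cube mini.
  have Gd : d ^+ 2 = fdot g G + fdot G (A *m xi) + s * r * fdot xi G.
    by rewrite /d fnorm_sqr -{1}GE !fdotDl fdotZl (fdotC (A *m xi)).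
  have fG : 2^-1 * (t ^+ 2 * form A G) <= t ^+ 2 * (2^-1 * `|form A G|).
    by rewrite mulrCA ler_wpM2l ?sqr_ge0// ler_wpM2l// ler_norm.
  have s3 : 0 <= s / 3 by rewrite divr_ge0.
  have {cube}cube := ler_wpM2l s3 cube.
  have t3 : s / 3 * d ^+ 3 * t ^+ 3 <= s / 3 * d ^+ 3 * t ^+ 2.
    rewrite ler_wpM2l ?mulr_ge0 ?exprn_ge0//.
    by rewrite exprS ler_piMl ?sqr_ge0.
  suff : t * d ^+ 2 <= t ^+ 2 * K by rewrite (expr2 t) -mulrA ler_pM2l.
  rewrite [in leLHS]Gd /K.
  move: t3 cube mini fG; rewrite !exprMn sqrrN; lra.
exact: (@le0_of_le_small _ _ K).
Qed.

(** This is where global optimality is used. Reflecting [xi] in the hyperplane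
    orthogonal to [w] does not change its norm, so that the two values of the
    model differ by the regularized form at a multiple of [w]. Directions
    orthogonal to [xi] are limits of others, and for [xi = 0] the model at small
    multiples of [v] is dominated by the form. *)
Lemma cubic_model_psd v : - (s * fnorm xi) * fnorm v ^+ 2 <= form A v.
Proof.
have G0 := cubic_model_stationary.
rewrite mulNr lerNl -subr_ge0 opprK addrC.
pose Q v := form A v + s * fnorm xi * fnorm v ^+ 2.
rewrite -/(Q v).
(* reflecting xi along w keeps its norm *)
have Q_ge0 w : fdot w xi != 0 -> 0 <= Q w.
  move=> wxi; have w0 : 0 < fnorm w.
    rewrite lt0r fnorm_ge0 andbT; apply: contra_neq wxi => /fnorm_eq0 ->.
    by rewrite fdot0l.
  pose t := - (2 * fdot w xi / fnorm w ^+ 2).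
  have n0 : fnorm w ^+ 2 != 0 by rewrite sqrf_eq0 gt_eqF.
  have tn : t * fnorm w ^+ 2 = - (2 * fdot w xi) by rewrite /t mulNr mulfVK.
  have nE : fnorm (xi + t *: w) = fnorm xi.
    apply/eqP; rewrite -(@eqrXn2 _ 2) ?fnorm_ge0//; apply/eqP.
    rewrite fnormD_sqr fnormZ exprMn real_normK ?num_real// fdotZr (fdotC xi).
    by rewrite (expr2 t) -mulrA tn; ring.
  have := xi_min (xi + t *: w); rewrite !cubic_modelE nE.
  rewrite fdotDr fdotZr formD// formZ !fdotZl => H.
  have wG : fdot g w + fdot w (A *m xi) + s * fnorm xi * fdot w xi = 0.
    have := fdot0l w; rewrite -G0 !fdotDl fdotZl (fdotC (A *m xi)).
    by rewrite (fdotC xi).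
  have : 0 <= t ^+ 2 * Q w.
    rewrite /Q mulrDr (mulrCA (t ^+ 2)) (expr2 t) -(mulrA t t (_ ^+ 2)) tn.
    suff -> : t * t * form A w + s * fnorm xi * (t * - (2 * fdot w xi))
      = 2 * (t * fdot g w + 2^-1 * (2 * (t * fdot w (A *m xi)) + t ^+ 2 * form A w)) by lra.
    rewrite (_ : fdot g w = - fdot w (A *m xi) - s * fnorm xi * fdot w xi); last by lra.
    by rewrite expr2; field.
  rewrite pmulr_rge0// exprn_even_gt0//= oppr_eq0 mulf_neq0 ?invr_neq0//.
  by rewrite mulf_neq0// pnatr_eq0.
have [vxi|] := eqVneq (fdot v xi) 0; last exact: Q_ge0.
have [xi0|xin0] := eqVneq (fnorm xi) 0.
  move: G0; rewrite (fnorm_eq0 xi0) mulmx0 scaler0 !addr0 => g0.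
  rewrite /Q xi0 mulr0 mul0r addr0 -oppr_le0.
  pose K := 2 * s / 3 * fnorm v ^+ 3.
  apply: (@le0_of_le_small _ _ K) => [|t t0 _].
    by rewrite /K !mulr_ge0 ?invr_ge0 ?fnorm_ge0.
  have := xi_min (t *: v); rewrite !cubic_modelE (fnorm_eq0 xi0) g0 !fdot0l.
  rewrite fnorm0 expr0n/= mulr0 {1}/form fdot0l formZ fnormZ (gtr0_norm t0) => H.
  suff : t ^+ 2 * - form A v <= t ^+ 2 * (t * K) by rewrite ler_pM2l ?exprn_gt0.
  move: H; rewrite /K exprMn (exprS t 2); move: (t ^+ 2) (form A v) (fnorm v ^+ 3).
  by move=> t2 F V; lra.
(* v + t xi is not orthogonal to xi, for any t > 0 *)
rewrite -oppr_le0; pose K := 2 * `|fdot v (A *m xi)| + `|Q xi|.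
have x0 : 0 < fnorm xi by rewrite lt0r xin0 fnorm_ge0.
apply: (@le0_of_le_small _ _ K) => [|t t0 t1]; first by rewrite /K addr_ge0.
have : 0 <= Q (v + t *: xi).
  apply: Q_ge0; rewrite fdotDl vxi add0r fdotZl mulf_neq0 ?gt_eqF//.
  by rewrite -fnorm_sqr exprn_gt0.
move=> H; have {}H : 0 <= Q v + 2 * (t * fdot xi (A *m v)) + t ^+ 2 * Q xi.
  move: H; rewrite /Q formD// formZ fdotZl fnormD_sqr fdotZr vxi fnormZ exprMn.
  rewrite real_normK ?num_real//; move: (form A v) (form A xi) (fdot xi (A *m v)).
  by move: (fnorm v ^+ 2) (fnorm xi ^+ 2) (t ^+ 2) => *; lra.
have h1 : t * fdot xi (A *m v) <= t * `|fdot v (A *m xi)|.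
  by rewrite ler_wpM2l ?(ltW t0)// -{1}sA -fdot_mulmxl fdotC ler_norm.
have h2 : t ^+ 2 * Q xi <= t * `|Q xi|.
  rewrite expr2 -mulrA ler_wpM2l ?(ltW t0)//.
  rewrite (@le_trans _ _ (t * `|Q xi|)) ?ler_wpM2l ?(ltW t0) ?ler_norm//.
  by rewrite ler_piMl.
rewrite /K !mulrDr (mulrCA t 2).
by move: (Q v) (t ^+ 2 * _) H h1 h2 => *; lra.
Qed.

(** Multiply the first-order condition by [xi] and use the second-order one at
    [xi]. *)
Lemma cubic_model_decrease : cubic_model g A (2 * s) xi <= - (s / 6 * fnorm xi ^+ 3).
Proof.
rewrite cubic_modelE.
have := cubic_model_psd xi; have := fdot0l xi; rewrite -cubic_model_stationary.
rewrite !fdotDl fdotZl -fnorm_sqr (fdotC (A *m xi)) -/(form A xi) !exprS expr0.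
lra.
Qed.

End CubicModel.

(** * Directional derivatives *)

Section DirectionalDerivatives.
Context {R : realType} {p : nat}.
Implicit Types (g : 'cV[R]_p -> R) (u v w z : 'cV[R]_p).

(** A countable limit, which keeps measurability. *)
Lemma derivable_cvg_seq g z v : derivable g z v ->
  (n.+1%:R * (g (z + n.+1%:R^-1 *: v) - g z)) @[n --> \oo] --> 'D_v g z.
Proof.
move=> dg.
have h0 : (@harmonic R) n @[n --> \oo] --> (0 : R)^'.
  move=> A; rewrite /dnbhs /within/= => -[e /= e0 eA].
  have : \forall n \near \oo, `|0 - harmonic n| < e.
    by move/cvgrPdist_lt : (@cvg_harmonic R); apply.
  by apply: filterS => n /eA; apply; rewrite gt_eqF// harmonic_gt0.
have := cvg_comp _ _ h0 dg.
rewrite [X in X @ _ --> _](_ : _ = fun n => n.+1%:R * (g (z + n.+1%:R^-1 *: v) - g z))//.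
by apply/funext => n; rewrite /= /harmonic /= invrK [_ + z]addrC.
Qed.

Lemma derive_le g z v (C : R) : derivable g z v ->
  (forall t, 0 < t -> t <= 1 -> g (z + t *: v) - g z <= C * t) -> 'D_v g z <= C.
Proof.
move=> /derivable_cvg_seq dg h.
have <- := cvg_lim (@Rhausdorff R) dg; apply: limr_le.
  by apply/cvg_ex; eexists; exact: dg.
near=> n; rewrite mulrC -ler_pdivlMr//.
by rewrite h ?invr_gt0// invf_le1// ler1n.
Unshelve. all: by end_near. Qed.

Lemma derive_ge g z v (C : R) : derivable g z v ->
  (forall t, 0 < t -> t <= 1 -> C * t <= g (z + t *: v) - g z) -> C <= 'D_v g z.
Proof.
move=> dg h; rewrite -lerN2 -deriveN//; apply: derive_le.
  exact: derivableN.
by move=> t t0 t1; rewrite mulNr -opprD lerN2 h.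
Qed.

Lemma derive_fdot g z v : differentiable g z -> 'D_v g z = fdot (grad g z) v.
Proof.
move=> dg; rewrite deriveE// {1}(matrix_sum_delta v).
rewrite linear_sum/=; apply: eq_bigr => i _.
by rewrite !big_ord1 linearZ/= -deriveE// mxE mulrC.
Qed.

Lemma is_derive_line g z u (t : R) : (forall z, differentiable g z) ->
  is_derive t (1 : R) (fun t => g (z + t *: u)) ('D_u g (z + t *: u)).
Proof.
move=> dg.
have E : (fun h : R => h^-1 *: (((fun t : R => g (z + t *: u)) \o shift t) (h *: (1 : R))
    - g (z + t *: u)))
    = (fun h : R => h^-1 *: ((g \o shift (z + t *: u)) (h *: u) - g (z + t *: u))).
  by apply/funext => h /=; rewrite -[h *: 1]/(h * 1) mulr1 scalerDl addrCA.
have /diff_derivable : differentiable g (z + t *: u) by [].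
move=> /(_ u); rewrite /derivable -E => dt.
apply: DeriveDef => //.
by rewrite /derive E.
Qed.

Lemma le_of_derive_le (phi dphi : R -> R) :
  (forall t, is_derive t (1 : R) phi (dphi t)) ->
  (forall t, 0 <= t <= 1 -> dphi t <= 0) -> phi 1 <= phi 0.
Proof.
move=> dphiE dphi0; apply: (@ler0_derive1_nincr _ phi 0 1) => //.
- by move=> t; rewrite in_itv/= => /andP[t0 t1]; rewrite derive1E derive_val dphi0 ?ltW.
- apply: derivable_within_continuous => t _; exact: ex_derive.
Qed.

(** Subtract from [phi] the primitive of the bound; the function left decreases. *)
Lemma increment_le (phi dphi : R -> R) (a b c : R) :
  (forall t, is_derive t (1 : R) phi (dphi t)) ->
  (forall t, 0 <= t <= 1 -> dphi t <= a + b * t + c * t ^+ 2) ->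
  phi 1 <= phi 0 + a + b / 2 + c / 3.
Proof.
move=> phiE le_dphi.
pose psi := phi - a \*: id - (b / 2) \*: (id ^+ 2) - (c / 3) \*: (id ^+ 3) : R -> R.
pose dpsi t := dphi t - a *: 1 - (b / 2) *: ((2%:R * t ^+ 1) *: 1)
  - (c / 3) *: ((3%:R * t ^+ 2) *: 1).
have psiE t : is_derive t (1 : R) psi (dpsi t).
  by apply: is_deriveB; apply: is_deriveB; apply: is_deriveB.
have scE (x y : R) : x *: (y : R^o) = x * y by [].
have := @le_of_derive_le psi dpsi psiE _.
rewrite /psi !fctE /= !scE !expr1n !expr0n/= !mulr0 !mulr1 !subr0 => h.
suff : phi 1 - a - b / 2 - c / 3 <= phi 0 by lra.
apply: h => t /le_dphi; rewrite /dpsi !scE !mulr1 expr1.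
by move: (t ^+ 2) => t2; lra.
Qed.

(** Schwarz's theorem: both mixed derivatives are limits of the same second
   difference quotient, by the mean value theorem applied in either order. *)
Lemma derive_swap g z u v :
  (forall z, differentiable g z) -> (forall w z, differentiable ('D_w g) z) ->
  {for z, continuous ('D_u ('D_v g))} -> {for z, continuous ('D_v ('D_u g))} ->
  'D_u ('D_v g) z = 'D_v ('D_u g) z.
Proof.
move=> dg ddg cuv cvu.
pose S u v (r : R) := g (z + r *: u + r *: v) - g (z + r *: u) - g (z + r *: v) + g z.
have SC w x r : S w x r = S x w r.
  by rewrite /S (addrAC z) -!addrA; congr (_ + _); rewrite addrCA.
have mean w x (r : R) : 0 < r -> exists a b : R,
    [/\ 0 <= a <= r, 0 <= b <= r &
    S w x r = r ^+ 2 * 'D_x ('D_w g) (z + a *: w + b *: x)].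
  move=> r0.
  pose phi (a : R) := g (z + r *: x + a *: w) - g (z + a *: w).
  have dphi (a : R) : is_derive a (1 : R) phi
      ('D_w g (z + r *: x + a *: w) - 'D_w g (z + a *: w)).
    by apply: is_deriveB; exact: is_derive_line.
  have [a a0r Ea] := MVT_segment (ltW r0) (fun a _ => dphi a)
    (derivable_within_continuous (fun a _ => @ex_derive _ _ _ _ _ _ _ (dphi a))).
  pose psi (b : R) := 'D_w g (z + a *: w + b *: x).
  have dpsi (b : R) : is_derive b (1 : R) psi ('D_x ('D_w g) (z + a *: w + b *: x)).
    by apply: is_derive_line.
  have [b b0r Eb] := MVT_segment (ltW r0) (fun a _ => dpsi a)
    (derivable_within_continuous (fun a _ => @ex_derive _ _ _ _ _ _ _ (dpsi a))).
  exists a, b; split; rewrite ?in_itv// in a0r b0r *.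
  have -> : S w x r = phi r - phi 0.
    by rewrite /S /phi scale0r !addr0 (addrAC z (r *: x)) opprB; ring.
  rewrite Ea subr0 (addrAC z (r *: x)) -[_ - _]/(psi r - _).
  have -> : 'D_w g (z + a *: w) = psi 0 by rewrite /psi scale0r addr0.
  by rewrite Eb subr0 expr2; ring.
have closeby (e X Y W W' : R) : W' = W -> `|X - W| < e -> `|Y - W'| < e ->
    `|X - Y| <= e + e.
  by move=> ->; rewrite !ltr_distl ler_norml => /andP[? ?] /andP[? ?]; lra.
have near_eq (e : R) : 0 < e -> `|'D_u ('D_v g) z - 'D_v ('D_u g) z| <= e + e.
  move=> e0.
  move/cvgrPdist_lt : cuv => /(_ _ e0) /nbhs_ballP[d1 /= d10 B1].
  move/cvgrPdist_lt : cvu => /(_ _ e0) /nbhs_ballP[d2 /= d20 B2].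
  pose M := `|u| + `|v| + 1.
  have M0 : 0 < M by rewrite ltr_wpDl// addr_ge0.
  pose r := Num.min d1 d2 / (2 * M).
  have r0 : 0 < r by rewrite divr_gt0 ?mulr_gt0// lt_min d10.
  have small (a b d : R) w x : `|w| + `|x| + 1 = M -> 0 <= a <= r -> 0 <= b <= r ->
      Num.min d1 d2 <= d -> ball z d (z + a *: w + b *: x).
    move=> ME /andP[a0 ar] /andP[b0 br] md.
    rewrite -ball_normE /ball_/= -addrA opprD addrA subrr add0r normrN.
    apply: le_lt_trans (_ : r * M < d).
      rewrite (le_trans (ler_normD _ _))// !normrZ !ger0_norm// -ME !mulrDr mulr1.
      rewrite (@le_trans _ _ (r * `|w| + r * `|x|)) ?lerDl ?(ltW r0)//.
      by rewrite lerD ?ler_wpM2r.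
    apply: lt_le_trans md; rewrite /r invfM mulrA mulfVK ?gt_eqF//.
    by rewrite ltr_pdivrMr// ltr_pMr ?ltr1n// lt_min d10.
  clearbody r.
  have [a [b [ar br Sab]]] := mean u v r r0.
  have [a' [b' [ar' br' Sab']]] := mean v u r r0.
  have r2 : r ^+ 2 != 0 by rewrite expf_neq0// gt_eqF.
  have E : 'D_v ('D_u g) (z + a *: u + b *: v) = 'D_u ('D_v g) (z + a' *: v + b' *: u).
    have := SC u v r; rewrite Sab Sab'; exact: (@mulfI R _ r2).
  have /B2/= h2 : ball z d2 (z + a *: u + b *: v).
    by apply: (small a b d2 u v erefl ar br); rewrite ge_min lexx orbT.
  have /B1/= h1 : ball z d1 (z + a' *: v + b' *: u).
    by apply: (small a' b' d1 v u _ ar' br'); [rewrite (addrC `|v|)|rewrite ge_min lexx].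
  exact: closeby E h1 h2.
move: ('D_u _ z) ('D_v _ z) near_eq => X Y near_eq.
apply/eqP; rewrite -subr_eq0 -normr_eq0; apply/eqP/le_anti; rewrite normr_ge0 andbT.
apply/ler_addgt0Pl => e e0; rewrite addr0.
by rewrite [e]splitr near_eq// divr_gt0.
Qed.

End DirectionalDerivatives.

(** * Taylor estimates *)

(** Reduces estimates of vectors to one-variable calculus. *)
Lemma fnorm_le_dual {R : realType} {q : nat} (y : 'cV[R]_q) (C : R) :
  0 <= C -> (forall w, fdot w y <= C * fnorm w) -> fnorm y <= C.
Proof.
move=> C0 h; have [->//|y0] := eqVneq (fnorm y) 0.
have := h y; rewrite -fnorm_sqr expr2 ler_pM2r//.
by rewrite lt0r y0 fnorm_ge0.
Qed.

Section TwiceDifferentiable.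
Context {R : realType} {p : nat} (f : 'cV[R]_p -> R).
Implicit Types (u v z : 'cV[R]_p).
Hypothesis fD2 : twice_differentiable f.

Lemma grad_derive v z : grad ('D_v f) z = hess f z *m v.
Proof.
have -> : 'D_v f = \sum_(j < p) (v j 0 \*: 'D_(delta_mx j 0) f).
  apply/funext => y; rewrite derive_fdot ?fct_sumE /fdot; last exact: fD2.1.
  by apply: eq_bigr => j _; rewrite big_ord1 mxE mulrC.
apply/colP => i; rewrite !mxE derive_sum; last first.
  by move=> j; apply: derivableZ; apply: diff_derivable; exact: fD2.2.
apply: eq_bigr => j _; rewrite deriveZ; last by apply: diff_derivable; exact: fD2.2.
by rewrite mxE [RHS]mulrC.
Qed.

Lemma derive2_form u v z : 'D_u ('D_v f) z = fdot u (hess f z *m v).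
Proof. by rewrite derive_fdot ?grad_derive 1?fdotC//; exact: fD2.2. Qed.

End TwiceDifferentiable.

Section SmoothFunction.
Context {R : realType} {p : nat} (f : 'cV[R]_p -> R).
Implicit Types (u v w z xi : 'cV[R]_p).
Hypothesis fC3 : continuously_differentiable 3 f.

Lemma C3_diff z : differentiable f z. Proof. by case: fC3. Qed.

Lemma C3_diff2 v z : differentiable ('D_v f) z.
Proof. by case: fC3 => _ /(_ v)[]. Qed.

Lemma C3_diff3 u v z : differentiable ('D_u ('D_v f)) z.
Proof. by case: fC3 => _ /(_ v)[_ /(_ u)[]]. Qed.

Lemma C3_continuous3 u v w : continuous ('D_u ('D_v ('D_w f))).
Proof. by case: fC3 => _ /(_ w)[_ /(_ v)[_ /(_ u)]]. Qed.

Lemma C3_twice : twice_differentiable f.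
Proof. by split; [exact: C3_diff|exact: C3_diff2]. Qed.

Lemma C3_twice_derive w : twice_differentiable ('D_w f).
Proof. by split => [z|v z]; [exact: C3_diff2|exact: C3_diff3]. Qed.

Lemma C3_grad v z : 'D_v f z = fdot (grad f z) v.
Proof. by rewrite derive_fdot//; exact: C3_diff. Qed.

Lemma hess_sym z : (hess f z)^T = hess f z.
Proof.
apply/matrixP => i j; rewrite !mxE; apply: derive_swap.
- exact: C3_diff.
- exact: C3_diff2.
- exact: differentiable_continuous (C3_diff3 _ _ _).
- exact: differentiable_continuous (C3_diff3 _ _ _).
Qed.

Lemma fdot_hessC u v z : fdot u (hess f z *m v) = fdot v (hess f z *m u).
Proof. by rewrite fdotC fdot_mulmxl hess_sym. Qed.

Lemma derive_swap2 u v : 'D_u ('D_v f) = 'D_v ('D_u f).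
Proof.
by apply/funext => z; rewrite !(derive2_form C3_twice) fdot_hessC.
Qed.

Lemma derive_swap3 u v w z : 'D_u ('D_v ('D_w f)) z = 'D_v ('D_u ('D_w f)) z.
Proof.
apply: derive_swap.
- exact: C3_diff2.
- by move=> x; exact: C3_diff3.
- exact: C3_continuous3.
- exact: C3_continuous3.
Qed.

(** The third derivative is symmetric. *)
Lemma derive_rot3 v w z : 'D_v ('D_v ('D_w f)) z = 'D_w ('D_v ('D_v f)) z.
Proof.
transitivity ('D_v ('D_w ('D_v f)) z); last exact: derive_swap3.
exact: (congr1 (fun F => 'D_v F z) (derive_swap2 v w)).
Qed.

Variables L rho : R.
Hypothesis L_ge0 : 0 <= L.
Hypothesis rho_ge0 : 0 <= rho.
Hypothesis gradL : forall z1 z2, enorm (grad f z1 - grad f z2) <= L * enorm (z1 - z2).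
Hypothesis hessL : forall z1 z2, snorm (hess f z1 - hess f z2) <= rho * enorm (z1 - z2).

Lemma hess_lip z1 z2 v :
  fnorm ((hess f z1 - hess f z2) *m v) <= rho * fnorm (z1 - z2) * fnorm v.
Proof.
by rewrite (le_trans (snorm_bound _ _))// ler_wpM2r ?fnorm_ge0//; exact: hessL.
Qed.

Lemma hess_lip_step z d v :
  fnorm ((hess f (z + d) - hess f z) *m v) <= rho * fnorm d * fnorm v.
Proof.
have E : z + d - z = d by rewrite addrC addKr.
by rewrite (le_trans (hess_lip _ _ _))// E.
Qed.

Lemma grad_lip_step z d : fnorm (grad f (z + d) - grad f z) <= L * fnorm d.
Proof.
have E : z + d - z = d by rewrite addrC addKr.
by rewrite (le_trans (gradL _ _))// E.
Qed.

(** Second derivatives are limits of difference quotients of the gradient. *)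
Lemma hess_bound z v : fnorm (hess f z *m v) <= L * fnorm v.
Proof.
apply: fnorm_le_dual => [|w]; first by rewrite mulr_ge0 ?fnorm_ge0.
rewrite fdot_hessC -(derive2_form C3_twice); apply: derive_le => [|t t0 _].
  by apply: diff_derivable; exact: C3_diff2.
rewrite !C3_grad -fdotNl -fdotDl (le_trans (fdot_le _ _))//.
rewrite (@le_trans _ _ (L * fnorm (z + t *: v - z) * fnorm w))//.
  by rewrite ler_wpM2r ?fnorm_ge0//; exact: gradL.
rewrite addrAC subrr add0r fnormZ gtr0_norm//.
by rewrite le_eqVlt; apply/orP; left; apply/eqP; ring.
Qed.

Lemma grad_taylor z xi :
  fnorm (grad f (z + xi) - grad f z - hess f z *m xi) <= rho / 2 * fnorm xi ^+ 2.
Proof.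
apply: fnorm_le_dual => [|w]; first by rewrite mulr_ge0 ?divr_ge0 ?sqr_ge0.
have := @increment_le _ (fun t : R => 'D_w f (z + t *: xi)) _
  (fdot w (hess f z *m xi)) (rho * fnorm xi ^+ 2 * fnorm w) 0
  (fun t => is_derive_line z xi t (C3_diff2 w)).
rewrite scale1r scale0r addr0 mul0r addr0 !C3_grad => h.
rewrite !fdotDr !fdotNr !(fdotC w (grad _ _)).
suff : forall t : R, 0 <= t <= 1 -> 'D_xi ('D_w f) (z + t *: xi) <=
    fdot w (hess f z *m xi) + rho * fnorm xi ^+ 2 * fnorm w * t + 0 * t ^+ 2.
  by move=> /h; lra.
move=> t /andP[t0 _]; rewrite (derive2_form C3_twice) fdot_hessC mul0r addr0 -lerBlDl.
rewrite -fdotNr -fdotDr -mulmxBl (le_trans (fdot_le _ _))//.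
rewrite (@le_trans _ _ (fnorm w * (rho * fnorm (z + t *: xi - z) * fnorm xi)))//.
  by rewrite ler_wpM2l ?fnorm_ge0// hess_lip.
rewrite addrAC subrr add0r fnormZ ger0_norm//.
by rewrite le_eqVlt; apply/orP; left; apply/eqP; ring.
Qed.

(** Integrate [grad_taylor] along the segment. *)
Lemma taylor3 z xi : f (z + xi) <= f z + fdot (grad f z) xi
  + 2^-1 * form (hess f z) xi + rho / 6 * fnorm xi ^+ 3.
Proof.
have := @increment_le _ (fun t : R => f (z + t *: xi)) _
  (fdot (grad f z) xi) (form (hess f z) xi) (rho / 2 * fnorm xi ^+ 3)
  (fun t => is_derive_line z xi t C3_diff).
rewrite scale1r scale0r addr0 => h.
suff : forall t : R, 0 <= t <= 1 -> 'D_xi f (z + t *: xi) <=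
    fdot (grad f z) xi + form (hess f z) xi * t + rho / 2 * fnorm xi ^+ 3 * t ^+ 2.
  by move=> /h; lra.
move=> t /andP[t0 _]; rewrite C3_grad.
have /(ler_wpM2r (fnorm_ge0 xi)) := grad_taylor z (t *: xi).
move/(le_trans (fdot_le _ _)); rewrite !fdotDl !fdotNl -scalemxAr fdotZl.
rewrite (fdotC (_ *m _)) -/(form _ _) fnormZ ger0_norm// exprMn (exprS _ 2).
by move: (fnorm xi ^+ 2) (t ^+ 2) => x2 t2 hh; lra.
Qed.

End SmoothFunction.

(** * The penalized objective *)

Section Projection.
Context {R : realType} {n m : nat}.
Implicit Types (v w : 'cV[R]_(n + m)).
Local Notation P := (projP : 'M[R]_(n + m)).

Lemma projP_col (q : nat) (v : 'M[R]_(n + m, q)) : P *m v = col_mx 0 (dsubmx v).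
Proof.
by rewrite -{1}(vsubmxK v) mul_block_col !mul0mx mul1mx !add0r.
Qed.

Lemma projP_tr : P^T = P.
Proof. by rewrite tr_block_mx !trmx0 trmx1. Qed.

Lemma projP_idem v : P *m (P *m v) = P *m v.
Proof. by rewrite !projP_col col_mxKd. Qed.

Lemma fnorm_col_mx (q r s : nat) (u : 'M[R]_(q, s)) (w : 'M[R]_(r, s)) :
  fnorm (col_mx u w) ^+ 2 = fnorm u ^+ 2 + fnorm w ^+ 2.
Proof.
rewrite !fnorm_sqr /fdot big_split_ord/=; congr (_ + _).
  by apply: eq_bigr => i _; apply: eq_bigr => j _; rewrite col_mxEu.
by apply: eq_bigr => i _; apply: eq_bigr => j _; rewrite col_mxEd.
Qed.

Lemma fnorm_projP (q : nat) (v : 'M[R]_(n + m, q)) : fnorm (P *m v) = fnorm (dsubmx v).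
Proof.
apply/eqP; rewrite -(@eqrXn2 _ 2) ?fnorm_ge0// projP_col fnorm_col_mx fnorm0.
by rewrite expr0n/= add0r.
Qed.

Lemma fnorm_projP_le (q : nat) (v : 'M[R]_(n + m, q)) : fnorm (P *m v) <= fnorm v.
Proof.
rewrite fnorm_projP -(@ler_pXn2r _ 2) ?nnegrE ?fnorm_ge0//.
by rewrite -{2}(vsubmxK v) fnorm_col_mx lerDr sqr_ge0.
Qed.

Lemma fdot_projP v w : fdot (P *m v) w = fdot v (P *m w).
Proof. by rewrite fdot_mulmxl projP_tr. Qed.

Lemma fdot_projPP v w : fdot (P *m v) (P *m w) = fdot v (P *m w).
Proof. by rewrite fdot_projP projP_idem. Qed.

Lemma fdot_projP_sum v w :
  fdot v (P *m w) = \sum_(j < m) v (rshift n j) 0 * w (rshift n j) 0.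
Proof.
rewrite projP_col /fdot big_split_ord/= big1 ?add0r; last first.
  by move=> i _; rewrite big_ord1 col_mxEu mxE mulr0.
by apply: eq_bigr => j _; rewrite big_ord1 col_mxEd mxE.
Qed.

Lemma fnorm_grad_y (f : 'cV[R]_(n + m) -> R) z :
  enorm (grad_y f z) = fnorm (P *m grad f z).
Proof. by rewrite fnorm_projP. Qed.

End Projection.

Section EntrywiseContinuity.
Context {R : realType} {T : topologicalType}.

(** Entries are enough: products, Frobenius norms and smallest eigenvalues are
    continuous functions of them. *)
Definition cont_mx {q r : nat} (A : T -> 'M[R]_(q, r)) :=
  forall i j, continuous (fun z => A z i j).

Lemma cont_mxD q r (A B : T -> 'M[R]_(q, r)) :
  cont_mx A -> cont_mx B -> cont_mx (fun z => A z + B z).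
Proof.
move=> cA cB i j z; have -> : (fun z => (A z + B z) i j) = fun z => A z i j + B z i j.
  by apply/funext => y; rewrite mxE.
by apply: continuousD; [exact: cA|exact: cB].
Qed.

Lemma cont_mx_cst q r (A : 'M[R]_(q, r)) : cont_mx (fun _ : T => A).
Proof. by move=> i j z; exact: cst_continuous. Qed.

Lemma cont_mxZ q r (a : T -> R) (A : T -> 'M[R]_(q, r)) :
  continuous a -> cont_mx A -> cont_mx (fun z => a z *: A z).
Proof.
move=> ca cA i j z; have -> : (fun z => (a z *: A z) i j) = fun z => a z * A z i j.
  by apply/funext => y; rewrite mxE.
by apply: continuousM; [exact: ca|exact: cA].
Qed.

Lemma cont_mxM q r s (A : T -> 'M[R]_(q, r)) (B : T -> 'M[R]_(r, s)) :
  cont_mx A -> cont_mx B -> cont_mx (fun z => A z *m B z).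
Proof.
move=> cA cB i j z.
have -> : (fun z => (A z *m B z) i j) = fun z => \sum_k A z i k * B z k j.
  by apply/funext => y; rewrite mxE.
apply: continuous_finsum => k.
by apply: (@continuousM _ _ (fun z => A z i k) (fun z => B z k j)); [exact: cA|exact: cB].
Qed.

Lemma cont_mx_sum q r (I : finType) (A : I -> T -> 'M[R]_(q, r)) :
  (forall i, cont_mx (A i)) -> cont_mx (fun z => \sum_i A i z).
Proof.
move=> cA i j z.
have -> : (fun z => (\sum_i A i z) i j) = fun z => \sum_k A k z i j.
  by apply/funext => y; rewrite summxE.
by apply: continuous_finsum => k; exact: cA.
Qed.

Lemma cont_mx_fnorm q r (A : T -> 'M[R]_(q, r)) :
  cont_mx A -> continuous (fun z => fnorm (A z)).
Proof.
move=> cA z; apply: (@continuous_comp _ _ _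
    (fun z => \sum_i \sum_j A z i j ^+ 2) (@Num.sqrt R)); last exact: sqrt_continuous.
apply: continuous_finsum => i; apply: continuous_finsum => j.
by apply: (@continuousM _ _ (fun z => A z i j) (fun z => A z i j)); exact: cA.
Qed.

Lemma cont_mx_lambda_min q (A : T -> 'M[R]_q) :
  (forall z, (A z)^T = A z) -> cont_mx A -> continuous (fun z => lambda_min (A z)).
Proof.
move=> sA cA z; apply/cvgrPdist_lt => e e0.
have cAz : cont_mx (fun y => A z + -1 *: A y).
  by apply: cont_mxD; [exact: cont_mx_cst|apply: cont_mxZ => // y; exact: cst_continuous].
have := cont_mx_fnorm cAz (x := z).
rewrite /continuous_at scaleN1r subrr fnorm0 => /cvgrPdist_lt/(_ _ e0).
apply: filterS => y; rewrite sub0r normrN ger0_norm ?fnorm_ge0// scaleN1r.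
by apply: le_lt_trans; exact: lambda_min_lipschitz.
Qed.

End EntrywiseContinuity.

Section PrecondIncrement.
Context {R : realType} {q : nat}.

(** The increment of the gradient of the penalized objective, beyond its linear
    part, in terms of quantities that Lipschitz bounds control. *)
Lemma precond_increment (b : R) (H1 H0 Q : 'M[R]_q) (g1 g0 x : 'cV[R]_q) :
  g1 + b *: (H1 *m (Q *m g1)) - (g0 + b *: (H0 *m (Q *m g0)))
    - (H0 *m x + b *: (H0 *m (Q *m (H0 *m x)))) =
  (g1 - g0 - H0 *m x)
    + b *: ((H1 - H0) *m (Q *m g1) + H0 *m (Q *m (g1 - g0 - H0 *m x))).
Proof.
rewrite !mulmxBr mulmxBl; move: (H0 *m (Q *m (H0 *m x))) (H0 *m x) => X1 X2.
move: (H1 *m (Q *m g1)) (H0 *m (Q *m g0)) (H0 *m (Q *m g1)) => X3 X4 X5.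
by apply/matrixP => i j; rewrite !mxE; ring.
Qed.

Lemma precond_increment2 (b : R) (H1 H0 Q : 'M[R]_q) (v : 'cV[R]_q) :
  H1 *m v + b *: (H1 *m (Q *m (H1 *m v))) - (H0 *m v + b *: (H0 *m (Q *m (H0 *m v)))) =
  (H1 - H0) *m v + b *: ((H1 - H0) *m (Q *m (H1 *m v))
    + H0 *m (Q *m ((H1 - H0) *m v))).
Proof.
rewrite !mulmxBl !mulmxBr.
move: (H1 *m v) (H0 *m v) => X1 X2.
move: (H1 *m (Q *m X1)) (H0 *m (Q *m X1)) (H0 *m (Q *m X2)) => X3 X4 X5.
by apply/matrixP => i j; rewrite !mxE; ring.
Qed.

End PrecondIncrement.

Section Penalty.
Context {R : realType} {n m : nat} (mu L rho : R) (f : 'cV[R]_(n + m) -> R).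
Hypothesis fA : deterministic_assumptions mu L rho f.
Variable beta : R.
Hypothesis beta_gt : mu^-1 < beta.
Implicit Types (u v w z xi : 'cV[R]_(n + m)).
Local Notation P := (projP : 'M[R]_(n + m)).
Local Notation g := (grad f).
Local Notation H := (hess f).
Local Notation h := (h_ beta f).
Local Notation c := (cst_c L rho beta).
Local Notation ey j := (delta_mx (rshift n j) 0 : 'cV[R]_(n + m)).

Let fC3 := f_C3 fA.
Let fT := C3_twice fC3.
Let mu0 := mu_gt0 fA.
Let L0 := ltW (L_gt0 fA).
Let rho0 := ltW (rho_gt0 fA).
Let Hv := hess_bound fC3 L0 (grad_lipschitz fA).
Let Hlip := hess_lip_step (hess_lipschitz fA).
Let glip := grad_lip_step (grad_lipschitz fA).
Let gT := grad_taylor fC3 rho0 (hess_lipschitz fA).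

Lemma beta_gt0 : 0 < beta.
Proof. by apply: lt_trans beta_gt; rewrite invr_gt0. Qed.
Let b0 := ltW beta_gt0.

Lemma gamma_gt0 : 0 < beta * mu - 1.
Proof. by rewrite subr_gt0 -ltr_pdivrMr// div1r. Qed.

Lemma cst_c_gt0 : 0 < c.
Proof.
rewrite /cst_c divr_gt0// mulr_gt0 ?(rho_gt0 fA)// ltr_wpDl//.
by rewrite !mulr_ge0.
Qed.

(** The Hessian of [h] without the term in the third derivative of [f]. *)
Definition Hbar z : 'M[R]_(n + m) := (1%:M + beta *: (H z *m P)) *m H z.

Lemma Hbar_mul z v : Hbar z *m v = H z *m v + beta *: (H z *m (P *m (H z *m v))).
Proof. by rewrite /Hbar mulmxDl mul1mx mulmxDl -!scalemxAl !mulmxA. Qed.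

Lemma Hbar_sym z : (Hbar z)^T = Hbar z.
Proof.
rewrite /Hbar !mulmxDl mul1mx -scalemxAl linearD/= linearZ/= !trmx_mul.
by rewrite projP_tr (hess_sym fC3) mulmxA.
Qed.

Lemma form_Hbar z v : form (Hbar z) v =
  form (H z) v + beta * fnorm (P *m (H z *m v)) ^+ 2.
Proof.
rewrite /form Hbar_mul fdotDr fdotZr fnorm_sqr fdot_projPP.
by rewrite [in RHS]fdot_mulmxl (hess_sym fC3).
Qed.

Lemma fdot_delta (i : 'I_(n + m)) (y : 'cV[R]_(n + m)) : fdot (delta_mx i 0) y = y i 0.
Proof.
rewrite /fdot (bigD1 i)//= big_ord1 mxE !eqxx mul1r big1 ?addr0// => k ki.
by rewrite big_ord1 mxE (negbTE ki) mul0r.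
Qed.

Lemma derive_entry w i z : 'D_w ('D_(delta_mx i 0) f) z = (H z *m w) i 0.
Proof. by rewrite (derive2_form fT) (fdot_hessC fC3) fdot_delta. Qed.

Lemma h_E z : h z = f z + beta / 2 * fnorm (P *m g z) ^+ 2.
Proof. by rewrite /h_ fnorm_grad_y. Qed.

Lemma h_sumE : h = f + (beta / 2) \*: (\sum_(j < m) ('D_(ey j) f) ^+ 2).
Proof.
apply/funext => z; rewrite h_E fnorm_sqr fdot_projPP fdot_projP_sum.
rewrite !fctE fct_sumE; congr (_ + _ * _).
by apply: eq_bigr => j _; rewrite mxE -expr2.
Qed.

(** The derivative of [h] in the direction [v], in a form that can be
    differentiated once more. *)
Definition dh v z := 'D_v f z + beta * \sum_(j < m) 'D_(ey j) f z * 'D_v ('D_(ey j) f) z.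

Lemma is_derive_h z v : is_derive z v h (dh v z).
Proof.
rewrite h_sumE /dh.
have d1 w : is_derive z w f ('D_w f z) by apply: derivableP; apply: diff_derivable; exact: C3_diff fC3 _.
have d2 (j : 'I_m) : is_derive z v ('D_(ey j) f) ('D_v ('D_(ey j) f) z).
  by apply: derivableP; apply: diff_derivable; exact: C3_diff2 fC3 _ _.
have D := is_deriveD (d1 v) (is_deriveZ (beta / 2)
  (is_derive_sum (fun j => is_deriveX 2 (d2 j)))).
apply: (is_derive_eq D).
rewrite -[_ *: _]/(_ * _); congr (_ + _).
rewrite !mulr_sumr; apply: eq_bigr => j _.
by rewrite -[_ *: _]/(_ * _) expr1; field.
Qed.

Lemma derive_h v z : 'D_v h z = dh v z.
Proof. by have dhz := is_derive_h z v; rewrite derive_val. Qed.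

Lemma grad_h z : grad h z = (1%:M + beta *: (H z *m P)) *m g z.
Proof.
apply/colP => i; rewrite mulmxDl mul1mx -scalemxAl.
rewrite [LHS]mxE. rewrite derive_h /dh.
rewrite (C3_grad fC3) fdotC fdot_delta [RHS]mxE [X in _ = _ + X]mxE.
congr (_ + _ * _); rewrite -mulmxA -fdot_delta -(fdot_hessC fC3).
rewrite fdot_projP fdot_projP_sum; apply: eq_bigr => j _.
by rewrite derive_entry; congr (_ * _); rewrite [RHS]mxE.
Qed.

Lemma grad_hE z : grad h z = g z + beta *: (H z *m (P *m g z)).
Proof. by rewrite grad_h mulmxDl mul1mx -scalemxAl mulmxA. Qed.

(** The third derivative of [f] contracted with [P *m grad f z]. *)
Definition T3 z : 'M[R]_(n + m) := \sum_(j < m) g z (rshift n j) 0 *: hess ('D_(ey j) f) z.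

Lemma is_derive_dh z u v : is_derive z u (dh v) ('D_u ('D_v f) z + beta *
  \sum_(j < m) ('D_(ey j) f z * 'D_u ('D_v ('D_(ey j) f)) z
     + 'D_v ('D_(ey j) f) z * 'D_u ('D_(ey j) f) z)).
Proof.
have -> : dh v = 'D_v f + beta \*: (\sum_(j < m) ('D_(ey j) f * 'D_v ('D_(ey j) f))).
  by apply/funext => y; rewrite /dh !fctE fct_sumE.
have d2 w v' : is_derive z w ('D_v' f) ('D_w ('D_v' f) z).
  by apply: derivableP; apply: diff_derivable; exact: C3_diff2 fC3 _ _.
have d3 j : is_derive z u ('D_v ('D_(ey j) f)) ('D_u ('D_v ('D_(ey j) f)) z).
  by apply: derivableP; apply: diff_derivable; exact: C3_diff3 fC3 _ _ _.
have D := is_deriveD (d2 u v) (is_deriveZ beta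
  (is_derive_sum (fun j => is_deriveM (d2 u (ey j)) (d3 j)))).
exact: (is_derive_eq D).
Qed.

Lemma hess_h z : hess h z = Hbar z + beta *: T3 z.
Proof.
apply/matrixP => i k; rewrite [LHS]mxE.
have -> : 'D_(delta_mx k 0) h = dh (delta_mx k 0).
  by apply/funext => y; rewrite derive_h.
have dhk := is_derive_dh z (delta_mx i 0) (delta_mx k 0).
rewrite derive_val /Hbar mulmxDl mul1mx -scalemxAl -mulmxA !mxE -addrA; congr (_ + _).
rewrite -mulrDr; congr (_ * _); rewrite big_split/= addrC; congr (_ + _).
  have -> : \sum_j H z i j * (P *m H z) j k =
    fdot (H z *m (delta_mx i 0 : 'cV_(n + m))) (P *m (H z *m (delta_mx k 0 : 'cV_(n + m)))).
    have {1}<- := hess_sym fC3 z.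
    rewrite /fdot mulmxA; apply: eq_bigr => j _.
    by rewrite big_ord1 -!colE !mxE.
  rewrite fdot_projP_sum; apply: eq_bigr => j _.
  by rewrite !derive_entry mulrC.
rewrite /T3 summxE; apply: eq_bigr => j _; by rewrite !mxE.
Qed.

Local Notation a z := (enorm (grad_y f z)).

(** The third derivative being symmetric, the form is the derivative of
    [form (H z) v] in the direction [P *m grad f z], and [H] is Lipschitz. *)
Lemma normr_form_T3 z v : `|form (T3 z) v| <= rho * a z * fnorm v ^+ 2.
Proof.
have vv y : 'D_v ('D_v f) y = form (H y) v by rewrite (derive2_form fT).
have -> : form (T3 z) v = 'D_(P *m g z) ('D_v ('D_v f)) z.
  rewrite derive_fdot; last exact: C3_diff3 fC3 _ _ _.
  rewrite fdot_projP_sum /T3 /form mulmx_suml.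
  have -> : fdot v (\sum_(j < m) g z (rshift n j) 0 *: hess ('D_(ey j) f) z *m v)
     = \sum_(j < m) fdot v (g z (rshift n j) 0 *: hess ('D_(ey j) f) z *m v).
    by elim/big_rec2: _ => [|j y1 y2 _ <-]; rewrite ?fdotDr// fdotC fdot0l.
  apply: eq_bigr => j _; rewrite -scalemxAl fdotZr mulrC; congr (_ * _).
  rewrite -(derive2_form (C3_twice_derive fC3 _)) [RHS]mxE.
  exact: (derive_rot3 fC3).
have dv3 : derivable ('D_v ('D_v f)) z (P *m g z).
  by apply: diff_derivable; exact: C3_diff3 fC3 _ _ _.
have bnd t : 0 < t -> `|'D_v ('D_v f) (z + t *: (P *m g z)) - 'D_v ('D_v f) z|
    <= rho * a z * fnorm v ^+ 2 * t.
  move=> t0; rewrite !vv -formBl.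
  rewrite (le_trans (normr_form_le (l := rho * fnorm (t *: (P *m g z))) _ _))//.
  rewrite fnormZ gtr0_norm// -fnorm_grad_y le_eqVlt; apply/orP; left; apply/eqP; ring.
rewrite ler_norml; apply/andP; split.
  apply: derive_ge => // t /bnd + _; rewrite ler_norml => /andP[h1 _].
  by rewrite mulNr.
by apply: derive_le => // t /bnd + _; rewrite ler_norml => /andP[].
Qed.

Lemma hess_h_sym z : (hess h z)^T = hess h z.
Proof.
rewrite hess_h linearD/= Hbar_sym linearZ/= /T3 linear_sum/=; congr (_ + _ *: _).
apply: eq_bigr => j _; rewrite linearZ/=; congr (_ *: _).
apply/matrixP => i k; rewrite !mxE.
exact: (derive_swap3 fC3).
Qed.

Lemma form_hess_h_ge z v :
  form (Hbar z) v - beta * rho * a z * fnorm v ^+ 2 <= form (hess h z) v.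
Proof.
rewrite hess_h formDl formZl lerD2l lerNl.
have := normr_form_T3 z v; rewrite ler_norml => /andP[h1 _].
rewrite -mulrN -!mulrA ler_wpM2l// lerNl mulrA//.
Qed.

Lemma normr_form_hess_h z v :
  `|form (hess h z) v| <= (L + beta * L ^+ 2 + beta * rho * a z) * fnorm v ^+ 2.
Proof.
rewrite hess_h formDl formZl form_Hbar !mulrDl (le_trans (ler_normD _ _))//.
rewrite lerD// ?(le_trans (ler_normD _ _))// ?lerD//.
- exact: normr_form_le.
- rewrite normrM !ger0_norm ?sqr_ge0// -mulrA ler_wpM2l// -exprMn.
  rewrite ler_pXn2r ?nnegrE ?mulr_ge0 ?fnorm_ge0//.
  by rewrite (le_trans (fnorm_projP_le _)).
- by rewrite normrM ger0_norm// -!mulrA ler_wpM2l// mulrA normr_form_T3.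
Qed.

Lemma grad_y_step z xi : a z <= a (z + xi) + L * fnorm xi.
Proof.
rewrite !fnorm_grad_y (le_trans (ler_distfnorm _ (P *m g (z + xi))))// lerD2l.
rewrite -mulmxBr (le_trans (fnorm_projP_le _))// fnormB.
exact: glip.
Qed.

Lemma PHv_le z v : fnorm (P *m (H z *m v)) <= L * fnorm v.
Proof. by rewrite (le_trans (fnorm_projP_le _)). Qed.

Lemma grad_h_taylor z xi : fnorm (grad h (z + xi) - grad h z - Hbar z *m xi)
  <= beta * rho * a z * fnorm xi + 3 * c * fnorm xi ^+ 2.
Proof.
rewrite !grad_hE Hbar_mul.
set r1 := g (z + xi) - g z - H z *m xi.
rewrite precond_increment -/r1.
have x0 := fnorm_ge0 xi.
have r1x : fnorm r1 <= rho / 2 * fnorm xi ^+ 2 by exact: gT.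
have a1 : a (z + xi) <= a z + L * fnorm xi.
  have := grad_y_step (z + xi) (- xi); by rewrite addrK fnormN.
rewrite (le_trans (ler_fnormD _ _))// fnormZ ger0_norm//.
have t1 : fnorm ((H (z + xi) - H z) *m (P *m g (z + xi)))
    <= rho * fnorm xi * (a z + L * fnorm xi).
  apply: (le_trans (Hlip _ _ _)); rewrite -fnorm_grad_y.
  by rewrite ler_wpM2l ?mulr_ge0.
have t2 : fnorm (H z *m (P *m r1)) <= L * (rho / 2 * fnorm xi ^+ 2).
  by rewrite (le_trans (Hv _ _))// ler_wpM2l// (le_trans (fnorm_projP_le _)).
have t3 := ler_wpM2l b0 (le_trans (ler_fnormD _ _) (lerD t1 t2)).
apply: (le_trans (lerD r1x t3)).
by rewrite /cst_c le_eqVlt; apply/orP; left; apply/eqP; field.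
Qed.

(** Expand [f] to third order, and [P *m grad f] to first order with remainder
    [r] before squaring. The terms in [r] other than [fdot y r] are of order 3,
    because [b + r] is an increment of the gradient. *)
Lemma h_descent z xi : h (z + xi) <= h z + fdot (grad h z) xi
  + 2^-1 * (form (Hbar z) xi + beta * rho * a z * fnorm xi ^+ 2) + c * fnorm xi ^+ 3.
Proof.
rewrite !h_E grad_hE form_Hbar fdotDl fdotZl fnorm_grad_y.
pose y := P *m g z; pose b := P *m (H z *m xi).
pose r := P *m (g (z + xi) - g z - H z *m xi).
have x0 := fnorm_ge0 xi.
have rx : fnorm r <= rho / 2 * fnorm xi ^+ 2 by rewrite (le_trans (fnorm_projP_le _)).
have ybr : P *m g (z + xi) = y + (b + r).
  by rewrite /y /b /r -!mulmxDr (addrC (H z *m xi)) subrK (addrC (g z)) subrK.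
have bx : fnorm b <= L * fnorm xi by exact: PHv_le.
have brx : fnorm (b + r) <= L * fnorm xi.
  rewrite /b /r -mulmxDr (addrC (H z *m _)) subrK (le_trans (fnorm_projP_le _))//.
have E2 : fnorm (P *m g (z + xi)) ^+ 2 = fnorm y ^+ 2 + 2 * fdot y b
    + fnorm b ^+ 2 + 2 * fdot y r + (fdot b r + fdot (b + r) r).
  by rewrite ybr !fnormD_sqr fdotDr fdotDl -(fnorm_sqr r); lra.
have hgx : fdot (H z *m y) xi = fdot y b.
  by rewrite fdotC (fdot_hessC fC3) /y /b fdot_projPP fdot_projP.
have e1 : fdot y r <= fnorm y * (rho / 2 * fnorm xi ^+ 2).
  by rewrite (le_trans (fdot_le _ _))// ler_wpM2l ?fnorm_ge0.
have e2 : fdot b r <= L * fnorm xi * (rho / 2 * fnorm xi ^+ 2).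
  by rewrite (le_trans (fdot_le _ _))// ler_pM ?fnorm_ge0.
have e3 : fdot (b + r) r <= L * fnorm xi * (rho / 2 * fnorm xi ^+ 2).
  by rewrite (le_trans (fdot_le _ _))// ler_pM ?fnorm_ge0.
have ft := taylor3 fC3 rho0 (hess_lipschitz fA) z xi.
rewrite E2 hgx -/y -/b.
have bb : beta / 2 * (2 * fdot y r + (fdot b r + fdot (b + r) r)) <=
  beta / 2 * (2 * (fnorm y * (rho / 2 * fnorm xi ^+ 2)) +
    (L * fnorm xi * (rho / 2 * fnorm xi ^+ 2) + L * fnorm xi * (rho / 2 * fnorm xi ^+ 2))).
  rewrite ler_wpM2l ?divr_ge0//; lra.
set S := fnorm y ^+ 2 + 2 * fdot y b + fnorm b ^+ 2 in bb *.
rewrite [leLHS](_ : _ = f (z + xi) + beta / 2 * S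
  + beta / 2 * (2 * fdot y r + (fdot b r + fdot (b + r) r))); last by rewrite /S; ring.
apply: (le_trans (lerD (lerD ft (lexx _)) bb)).
by rewrite /S /cst_c le_eqVlt; apply/orP; left; apply/eqP; field.
Qed.

Lemma Hbar_step z xi v : fnorm ((Hbar (z + xi) - Hbar z) *m v)
  <= 6 * c * fnorm xi * fnorm v.
Proof.
have -> : (Hbar (z + xi) - Hbar z) *m v = (H (z + xi) - H z) *m v
    + beta *: ((H (z + xi) - H z) *m (P *m (H (z + xi) *m v))
      + H z *m (P *m ((H (z + xi) - H z) *m v))).
  apply: (etrans (mulmxBl _ _ _)).
  apply: (etrans (f_equal2 (fun A B => A - B) (Hbar_mul _ _) (Hbar_mul _ _))).
  exact: precond_increment2.
have x0 := fnorm_ge0 xi; have v0 := fnorm_ge0 v.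
have dH w : fnorm ((H (z + xi) - H z) *m w) <= rho * fnorm xi * fnorm w by exact: Hlip.
rewrite (le_trans (ler_fnormD _ _))// fnormZ ger0_norm//.
have t1 : fnorm ((H (z + xi) - H z) *m (P *m (H (z + xi) *m v)))
    <= rho * fnorm xi * (L * fnorm v).
  by rewrite (le_trans (dH _))// ler_wpM2l ?mulr_ge0// PHv_le.
have t2 : fnorm (H z *m (P *m ((H (z + xi) - H z) *m v)))
    <= L * (rho * fnorm xi * fnorm v).
  by rewrite (le_trans (Hv _ _))// ler_wpM2l// (le_trans (fnorm_projP_le _)).
have t3 := ler_wpM2l b0 (le_trans (ler_fnormD _ _) (lerD t1 t2)).
apply: (le_trans (lerD (dH v) t3)).
have : 0 <= beta * L * (rho * fnorm xi * fnorm v) by rewrite !mulr_ge0.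
rewrite /cst_c; move: (fnorm xi) (fnorm v) => x w; lra.
Qed.

(** Compare strong concavity between [z] and [z + v] with the Taylor expansion at
    [z] of its value at [z + t *: v], as [t] tends to 0. *)
Lemma concave_upper z v : P *m v = v ->
  f (z + v) <= f z + fdot (g z) v - mu / 2 * fnorm v ^+ 2.
Proof.
move=> Pv; pose w := dsubmx v; have vE : v = col_mx 0 w by rewrite -projP_col Pv.
have nw : fnorm w = fnorm v by rewrite -fnorm_projP Pv.
pose K := 2^-1 * `|form (H z) v| + rho / 6 * fnorm v ^+ 3 + mu / 2 * fnorm v ^+ 2.
have K0 : 0 <= K.
  by rewrite !addr_ge0// mulr_ge0 ?divr_ge0 ?exprn_ge0 ?fnorm_ge0// ltW.
suff : f (z + v) + mu / 2 * fnorm v ^+ 2 - f z - fdot (g z) v <= 0 by lra.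
apply: (@le0_of_le_small _ _ K) => // t t0 t1.
have zE (s : R) : z + s *: v = col_mx (usubmx z) (dsubmx z + s *: w).
  by rewrite -{1}(vsubmxK z) vE scale_col_mx add_col_mx scaler0 addr0.
have t01 : 0 <= t <= 1 by rewrite ltW.
have := f_concave fA (usubmx z) (dsubmx z + 1 *: w) (dsubmx z + 0 *: w) t01.
have -> : t *: (dsubmx z + 1 *: w) + (1 - t) *: (dsubmx z + 0 *: w) = dsubmx z + t *: w.
  by apply/matrixP => i j; rewrite !mxE; ring.
rewrite -!zE scale1r scale0r addr0.
have -> : dsubmx z + 1 *: w - (dsubmx z + 0 *: w) = w.
  by apply/matrixP => i j; rewrite !mxE; ring.
rewrite /enorm nw => cc.
have := taylor3 fC3 rho0 (hess_lipschitz fA) z (t *: v).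
rewrite formZ fdotZr fnormZ gtr0_norm// => tt.
have ff : form (H z) v <= `|form (H z) v| by exact: ler_norm.
have t2 : 0 <= t ^+ 2 by rewrite sqr_ge0.
have f2 := ler_wpM2l t2 ff.
have V3 : 0 <= rho / 6 * fnorm v ^+ 3.
  by rewrite mulr_ge0 ?divr_ge0// exprn_ge0 ?fnorm_ge0.
have t3 : t ^+ 3 * (rho / 6 * fnorm v ^+ 3) <= t ^+ 2 * (rho / 6 * fnorm v ^+ 3).
  by rewrite ler_wpM2r// exprS ler_piMl.
rewrite -(ler_pM2l t0) [leRHS]mulrA -expr2 /K.
rewrite exprMn in tt.
move: (fnorm v ^+ 2) (fnorm v ^+ 3) (fdot (g z) v) `|form (H z) v| (form (H z) v)
  (t ^+ 3) cc tt f2 t3 => n2 n3 G F F' T3' cc tt f2 t3.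
rewrite expr2 in tt f2 t3 *.
lra.
Qed.

(** Add [concave_upper] at [z] and at [z + t *: v], in opposite directions. *)
Lemma form_concave z v : P *m v = v -> form (H z) v <= - mu * fnorm v ^+ 2.
Proof.
move=> Pv; rewrite /form -(derive2_form fT); apply: derive_le => [|t t0 _].
  by apply: diff_derivable; exact: C3_diff2 fC3 _ _.
rewrite !(C3_grad fC3).
have Ptv (s : R) : P *m (s *: v) = s *: v by rewrite -scalemxAr Pv.
have c1 := concave_upper z (Ptv t).
have := concave_upper (z + t *: v) (Ptv (- t)).
rewrite scaleNr addrK fnormN fdotNr !fdotZr fnormZ gtr0_norm// exprMn => c2.
rewrite -(ler_pM2l t0).
move: c1; rewrite fdotZr fnormZ gtr0_norm// exprMn => c1.
move: (fnorm v ^+ 2) (f _) (f _) (fdot _ _) (fdot _ _) c1 c2 => N a1 a2 b1 b2.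
by rewrite expr2; lra.
Qed.

(** In the inner product of [grad h z] with [y = P *m grad f z], the penalty
    contributes [beta] times the form of [H z] at [y], and [form_concave] applies. *)
Lemma grad_h_ge z : (beta * mu - 1) * a z <= fnorm (grad h z).
Proof.
rewrite fnorm_grad_y; set y := P *m g z.
have [->|y0] := eqVneq (fnorm y) 0; first by rewrite mulr0 fnorm_ge0.
have ypos : 0 < fnorm y by rewrite lt0r y0 fnorm_ge0.
have Py : P *m y = y by rewrite /y projP_idem.
have := fdot_ge y (grad h z); rewrite lerNl => /(le_trans _) le_h.
rewrite -(ler_pM2r ypos) [leRHS]mulrC; apply: le_h.
rewrite grad_hE -/y fdotDr fdotZr -[fdot y (H z *m y)]/(form (H z) y).
have -> : fdot y (g z) = fnorm y ^+ 2 by rewrite fnorm_sqr /y fdot_projPP fdot_projP.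
have := ler_wpM2l b0 (form_concave z Py); rewrite -mulrA -expr2.
move: (form _ _) (fnorm y ^+ 2) => F N; lra.
Qed.

(** Maximizing the concave upper bound of [f] in the second variable bounds [Phi]
    by [f z + a z ^+ 2 / (2 * mu)]. *)
Lemma h_gap z : (beta * mu - 1) / (2 * mu) * a z ^+ 2 <= h z - Phi_bar f.
Proof.
have aE : a z = fnorm (P *m g z) by rewrite fnorm_grad_y.
have Phi_le : Phi f (usubmx z) <= f z + a z ^+ 2 / (2 * mu).
  apply: ge_sup; first by exists (f (col_mx (usubmx z) 0)); exists 0.
  move=> _ [y _ <-]; pose v := col_mx 0 (y - dsubmx z) : 'cV[R]_(n + m).
  have Pv : P *m v = v by rewrite projP_col /v col_mxKd.
  have -> : col_mx (usubmx z) y = z + v.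
    by rewrite -{2}(vsubmxK z) /v add_col_mx addr0 addrC subrK.
  apply: (le_trans (concave_upper z Pv)); rewrite -addrA lerD2l.
  have : fdot (g z) v <= a z * fnorm v.
    by rewrite aE -{1}Pv -fdot_projP fdot_le.
  rewrite ler_pdivlMr ?mulr_gt0//; move: (fdot _ _) (a z) (fnorm v) => F A V FA.
  have := sqr_ge0 (A - mu * V); have := ler_wpM2r (ltW (mulr_gt0 (@ltr0Sn R 1) mu0)) FA.
  by rewrite sqrrB exprMn (expr2 mu) -mulr_natr; lra.
have : Phi_bar f <= Phi f (usubmx z).
  by apply: ge_inf; [exact: Phi_lbounded fA|exists (usubmx z)].
move=> /le_trans /(_ Phi_le); rewrite /h_.
have -> : (beta * mu - 1) / (2 * mu) * a z ^+ 2 = beta / 2 * a z ^+ 2 - a z ^+ 2 / (2 * mu).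
  by field; rewrite gt_eqF.
by set q := a z ^+ 2 / (2 * mu); lra.
Qed.

Lemma cont_g : cont_mx g.
Proof.
move=> i j z; under eq_fun do rewrite mxE.
exact: differentiable_continuous (C3_diff2 fC3 _ _).
Qed.

Lemma cont_H : cont_mx H.
Proof.
move=> i j z; under eq_fun do rewrite mxE.
exact: differentiable_continuous (C3_diff3 fC3 _ _ _).
Qed.

Lemma cont_precond : cont_mx (fun z => 1%:M + beta *: (H z *m P)).
Proof.
apply: cont_mxD; first exact: cont_mx_cst.
apply: cont_mxZ; first by move=> z; exact: cst_continuous.
by apply: cont_mxM; [exact: cont_H|exact: cont_mx_cst].
Qed.

Lemma cont_Hbar : cont_mx Hbar.
Proof. by apply: cont_mxM; [exact: cont_precond|exact: cont_H]. Qed.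

Lemma cont_grad_h : cont_mx (grad h).
Proof.
have -> : grad h = fun z => (1%:M + beta *: (H z *m P)) *m g z.
  by apply/funext => z; exact: grad_h.
by apply: cont_mxM; [exact: cont_precond|exact: cont_g].
Qed.

Lemma cont_hess_h : cont_mx (hess h).
Proof.
have -> : hess h = fun z => Hbar z + beta *: T3 z.
  by apply/funext => z; exact: hess_h.
apply: cont_mxD; first exact: cont_Hbar.
apply: cont_mxZ; first by move=> z; exact: cst_continuous.
apply: cont_mx_sum => j; apply: cont_mxZ; first exact: cont_g.
move=> i k z; under eq_fun do rewrite mxE.
exact: (C3_continuous3 fC3).
Qed.

Lemma continuous_grad_y : continuous (fun z => a z).
Proof.
under eq_fun do rewrite fnorm_grad_y.
by apply: cont_mx_fnorm; apply: cont_mxM; [exact: cont_mx_cst|exact: cont_g].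
Qed.

Lemma continuous_h : continuous h.
Proof.
move=> z; apply: (@continuousD _ _ _ f (fun z => beta / 2 * a z ^+ 2)).
  exact: differentiable_continuous (C3_diff fC3 _).
apply: (@continuousM _ _ (fun=> beta / 2) (fun z => a z ^+ 2)); first exact: cst_continuous.
by apply: (@continuousM _ _ (fun z => a z) (fun z => a z)); exact: continuous_grad_y.
Qed.

Lemma continuous_lambda_min_h : continuous (fun z => lambda_min (hess h z)).
Proof. by apply: cont_mx_lambda_min; [exact: hess_h_sym|exact: cont_hess_h]. Qed.

End Penalty.

(** * Measurability of random matrices and of derivatives *)

Section EntrywiseMeasurability.
Context {R : realType} {d : measure_display} {T : measurableType d}.

Definition meas_mx {q r : nat} (A : T -> 'M[R]_(q, r)) :=
  forall i j, measurable_fun setT (fun w => A w i j).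

Lemma meas_mxD q r (A B : T -> 'M[R]_(q, r)) :
  meas_mx A -> meas_mx B -> meas_mx (fun w => A w + B w).
Proof.
move=> mA mB i j; under eq_fun do rewrite mxE.
exact: measurable_funD.
Qed.

Lemma meas_mx_cst q r (A : 'M[R]_(q, r)) : meas_mx (fun _ : T => A).
Proof. by move=> i j; exact: measurable_cst. Qed.

Lemma meas_mxZ q r (a : T -> R) (A : T -> 'M[R]_(q, r)) :
  measurable_fun setT a -> meas_mx A -> meas_mx (fun w => a w *: A w).
Proof.
move=> ma mA i j; under eq_fun do rewrite mxE.
exact: measurable_funM.
Qed.

Lemma meas_mxN q r (A : T -> 'M[R]_(q, r)) : meas_mx A -> meas_mx (fun w => - A w).
Proof.
move=> mA i j; under eq_fun do rewrite mxE.
by apply: measurableT_comp.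
Qed.

Lemma meas_mxB q r (A B : T -> 'M[R]_(q, r)) :
  meas_mx A -> meas_mx B -> meas_mx (fun w => A w - B w).
Proof. by move=> mA mB; apply: meas_mxD => //; exact: meas_mxN. Qed.

Lemma meas_mx_tr q r (A : T -> 'M[R]_(q, r)) : meas_mx A -> meas_mx (fun w => (A w)^T).
Proof. by move=> mA i j; under eq_fun do rewrite mxE; exact: mA. Qed.

Lemma meas_mxM q r s (A : T -> 'M[R]_(q, r)) (B : T -> 'M[R]_(r, s)) :
  meas_mx A -> meas_mx B -> meas_mx (fun w => A w *m B w).
Proof.
move=> mA mB i j; under eq_fun do rewrite mxE.
by apply: measurable_sum => k; exact: measurable_funM.
Qed.

Lemma meas_mx_sum q r n (A : 'I_n -> T -> 'M[R]_(q, r)) :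
  (forall i, meas_mx (A i)) -> meas_mx (fun w => \sum_i A i w).
Proof.
move=> mA i j; under eq_fun do rewrite summxE.
by apply: measurable_sum => k; exact: mA.
Qed.

Lemma measurable_fun_sqrt (f : T -> R) :
  measurable_fun setT f -> measurable_fun setT (fun w => Num.sqrt (f w)).
Proof.
move=> mf; apply: (@measurableT_comp _ _ _ _ _ _ (@Num.sqrt R)) => //.
by apply: continuous_measurable_fun; exact: sqrt_continuous.
Qed.

Lemma measurable_fnorm q r (A : T -> 'M[R]_(q, r)) :
  meas_mx A -> measurable_fun setT (fun w => fnorm (A w)).
Proof.
move=> mA; apply: measurable_fun_sqrt.
apply: measurable_sum => i; apply: measurable_sum => j.
exact: measurable_funX.
Qed.

Lemma measurable_augnorm q r (a : T -> R) (A : T -> 'M[R]_(q, r)) :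
  measurable_fun setT a -> meas_mx A ->
  measurable_fun setT (fun w => augnorm (a w) (A w)).
Proof.
move=> ma mA; apply: measurable_fun_sqrt; apply: measurable_funD => //.
by apply: measurable_funX; exact: measurable_fnorm.
Qed.

End EntrywiseMeasurability.

Section Caratheodory.
Context {R : realType}.

(** Split according to the value of [K]. Both discretized points and batch sizes
    are instances of [K]. *)
Lemma measurable_fun_countable d d' (T : measurableType d) (Y : measurableType d')
    (I : countType) (K : T -> I) (f : I -> T -> Y) :
  (forall k, measurable [set w | K w = k]) ->
  (forall k, measurable_fun setT (f k)) ->
  measurable_fun setT (fun w => f (K w) w).
Proof.
move=> mK mf _ B mB; rewrite setTI.
have -> : (fun w => f (K w) w) @^-1` B = \bigcup_(i in setT)
    (if (unpickle i : option I) is Some k then [set w | K w = k] `&` f k @^-1` B else set0).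
  apply/seteqP; split => [w Bw|w [i _]].
    by exists (pickle (K w)) => //; rewrite pickleK.
  by case: unpickle => [k [<-]|].
apply: bigcupT_measurable => i; case: unpickle => [k|]; last exact: measurable0.
by apply: measurableI => //; rewrite -[X in measurable X]setTI; exact: mf.
Qed.

Lemma measurable_floor_fiber d (T : measurableType d) (x : T -> R) (k : int) :
  measurable_fun setT x -> measurable [set w | Num.floor (x w) = k].
Proof.
move=> mx; have -> : [set w | Num.floor (x w) = k] = x @^-1` `[k%:~R, (k + 1)%:~R[%classic.
  apply/seteqP; split => w /=.
    by move=> <-; rewrite in_itv/= ge_floor lt_succ_floor.
  by rewrite in_itv/= => xk; apply/floor_def.
by rewrite -[X in measurable X]setTI; apply: mx => //; exact: measurable_itv.
Qed.

(** Round [z] to a grid of mesh [1 / N.+1]. The rounded point takes countably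
    many values, and continuity gives the limit. *)
Lemma measurable_caratheodory d d' (T : measurableType d) (U : measurableType d')
    p (G : 'cV[R]_p -> U -> R) (z : T -> 'cV[R]_p) (s : T -> U) :
  (forall u, continuous (G ^~ u)) -> (forall z, measurable_fun setT (G z)) ->
  meas_mx z -> measurable_fun setT s ->
  measurable_fun setT (fun w => G (z w) (s w)).
Proof.
move=> cG mG mz ms.
pose K (N : nat) w : 'cV[int]_p := \col_i Num.floor (N.+1%:R * z w i 0).
pose q (N : nat) (k : 'cV[int]_p) : 'cV[R]_p := \col_i ((k i 0)%:~R / N.+1%:R).
apply: (@measurable_fun_cvg _ _ _ _ (fun N w => G (q N (K N w)) (s w))).
  move=> N; apply: (@measurable_fun_countable _ _ _ _ _ (K N) (fun k w => G (q N k) (s w))).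
    move=> k; have -> : [set w | K N w = k] =
        \bigcap_(i in [set: 'I_p]) [set w | Num.floor (N.+1%:R * z w i 0) = k i 0].
      apply/seteqP; split => w /=.
        by move=> <- i _; rewrite /= mxE.
      by move=> h; apply/colP => i; rewrite mxE; exact: h.
    apply: fin_bigcap_measurable => // i _; apply: measurable_floor_fiber.
    exact: measurable_funM.
  by move=> k; apply: measurableT_comp.
move=> w _.
apply: (@cvg_comp _ _ _ (fun N => q N (K N w)) (G^~ (s w)) \oo (nbhs (z w))); last exact: cG.
apply/cvgrPdist_le => e e0.
have : \forall N \near \oo, @harmonic R N < e.
  have := @cvg_harmonic R; move/cvgrPdist_lt => /(_ _ e0).
  by apply: filterS => N; rewrite sub0r normrN ger0_norm// harmonic_ge0.
apply: filterS => N Ne; apply: mx_norm_le => [|i j]; first exact: ltW.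
rewrite (ord1 j) !mxE; set x := z w i 0.
have N0 : 0 < N.+1%:R :> R by [].
rewrite (le_trans _ (ltW Ne))// -{1}[x](mulfK (lt0r_neq0 N0)) -mulrBl normrM.
rewrite (ger0_norm (x := _^-1)) ?invr_ge0// [leRHS]/= -[leRHS]mul1r.
rewrite ler_wpM2r ?invr_ge0// ler_norml mulrC.
have := ge_floor (N.+1%:R * x); have := lt_succ_floor (N.+1%:R * x).
by rewrite intrD; lra.
Qed.

Lemma measurable_continuous d (T : measurableType d) p (G : 'cV[R]_p -> R)
    (z : T -> 'cV[R]_p) : continuous G -> meas_mx z ->
  measurable_fun setT (fun w => G (z w)).
Proof.
move=> cG mz.
apply: (@measurable_caratheodory _ _ _ unit _ (fun z _ => G z) _ (fun=> tt)) => //.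
Qed.

Lemma meas_mx_continuous d (T : measurableType d) p q r (A : 'cV[R]_p -> 'M[R]_(q, r))
    (z : T -> 'cV[R]_p) : cont_mx A -> meas_mx z -> meas_mx (fun w => A (z w)).
Proof.
move=> cA mz i j.
exact: (@measurable_continuous _ _ _ (fun z => A z i j) z (cA i j) mz).
Qed.

Section Derivatives.
Context d' (U : measurableType d') p (F : 'cV[R]_p -> U -> R).
Hypothesis mF : forall z, measurable_fun setT (F z).
Hypothesis dF : forall s, twice_differentiable (F^~ s).

(** Difference quotients are functions of Caratheodory type. *)
Lemma measurable_derive d (T : measurableType d) (G : 'cV[R]_p -> U -> R)
    (v : 'cV[R]_p) (z : T -> 'cV[R]_p) (s : T -> U) :
  (forall z, measurable_fun setT (G z)) ->
  (forall s z, differentiable (G^~ s) z) ->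
  meas_mx z -> measurable_fun setT s ->
  measurable_fun setT (fun w => 'D_v (G^~ (s w)) (z w)).
Proof.
move=> mG dG mz ms.
have cG u : continuous (G^~ u) by move=> x; exact: differentiable_continuous.
apply: (@measurable_fun_cvg _ _ _ _ (fun n w =>
    n.+1%:R * (G (z w + n.+1%:R^-1 *: v) (s w) - G (z w) (s w)))).
  move=> n; apply: measurable_funM => //; apply: measurable_funB.
    apply: (measurable_caratheodory (z := fun w => z w + n.+1%:R^-1 *: v)) => //.
    by apply: meas_mxD => //; exact: meas_mx_cst.
  exact: measurable_caratheodory.
move=> w _; apply: derivable_cvg_seq; apply: diff_derivable; exact: dG.
Qed.

Lemma meas_grad d (T : measurableType d) (z : T -> 'cV[R]_p) (s : T -> U) :
  meas_mx z -> measurable_fun setT s ->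
  meas_mx (fun w => grad (F^~ (s w)) (z w)).
Proof.
move=> mz ms i j; under eq_fun do rewrite mxE.
by apply: measurable_derive => // u x; case: (dF u).
Qed.

Lemma meas_hess d (T : measurableType d) (z : T -> 'cV[R]_p) (s : T -> U) :
  meas_mx z -> measurable_fun setT s ->
  meas_mx (fun w => hess (F^~ (s w)) (z w)).
Proof.
move=> mz ms i j; under eq_fun do rewrite mxE.
apply: (@measurable_derive _ _ (fun z s => 'D_(delta_mx j 0) (F^~ s) z)) => //.
  move=> x; apply: (@measurable_derive _ _ F (delta_mx j 0) (fun=> x) id) => //.
  by move=> u y; case: (dF u).
by move=> u x; case: (dF u).
Qed.

End Derivatives.

End Caratheodory.

(** * Centered noise *)

Section Inequalities.
Context {R : realType}.
Implicit Types (u v x y : R).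

Lemma squareD_le x y : (x + y) ^+ 2 <= 2 * x ^+ 2 + 2 * y ^+ 2.
Proof.
have E : 2 * x ^+ 2 + 2 * y ^+ 2 - (x + y) ^+ 2 = (x - y) ^+ 2 by ring.
by rewrite -subr_ge0 E sqr_ge0.
Qed.

Lemma cubeD_le x y : 0 <= x -> 0 <= y -> (x + y) ^+ 3 <= 4 * x ^+ 3 + 4 * y ^+ 3.
Proof.
move=> x0 y0; have E : 4 * x ^+ 3 + 4 * y ^+ 3 - (x + y) ^+ 3 = 3 * ((x + y) * (x - y) ^+ 2) by ring.
by rewrite -subr_ge0 E mulr_ge0//; exact: mulr_ge0 (addr_ge0 x0 y0) (sqr_ge0 _).
Qed.

(** Young's inequality for the exponents 3 and 3/2. *)
Lemma young_cube u v : 0 <= u -> 0 <= v -> u * v ^+ 2 <= u ^+ 3 / 3 + 2 / 3 * v ^+ 3.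
Proof.
move=> u0 v0; have : 0 <= (u - v) ^+ 2 * (u + 2 * v).
  exact: mulr_ge0 (sqr_ge0 _) (addr_ge0 u0 (mulr_ge0 (ler0n _ 2) v0)).
have -> : (u - v) ^+ 2 * (u + 2 * v) = u ^+ 3 - 3 * (u * v ^+ 2) + 2 * v ^+ 3 by ring.
by lra.
Qed.

End Inequalities.

Section Freezing.
Context {R : realType} {d : measure_display} {Om : measurableType d}
  (P : probability Om R).
Local Open Scope ereal_scope.

Lemma measurable_id_sub (G : set (set Om)) : G `<=` measurable ->
  measurable_fun setT (id : Om -> g_sigma_algebraType G).
Proof.
move=> Gm _ B mB; rewrite setTI preimage_id.
exact: (smallest_sub (@sigma_algebra_measurable _ Om) Gm).
Qed.

(** Both sides are finite measures in [E] that agree on a pi-system. *)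
Lemma indep_pi_system (G : set (set Om)) (B : set Om) (r : R) : G `<=` measurable ->
  setI_closed G -> G setT -> measurable B -> (0 <= r)%R ->
  (forall E, G E -> P (E `&` B) = P E * r%:E) ->
  forall E, <<s G >> E -> P (E `&` B) = P E * r%:E.
Proof.
move=> Gm GI GT mB r0 h E sE.
have := @g_sigma_algebra_measure_unique _ R Om G Gm (fun=> setT) (fun=> GT) _
  (mrestr P mB) (mscale (NngNum r0) P) GI _ _ E sE.
move=> H; rewrite -[LHS]/(mrestr P mB E) H.
- by rewrite muleC.
- by rewrite bigcup_const.
- by move=> A GA; rewrite -[LHS]/(P (A `&` B)) h// muleC.
- by move=> _; rewrite -[ltLHS]/(P (setT `&` B)) setTI; apply: le_lt_trans (ltry 1); exact: probability_le1.
Qed.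

Context {d' : measure_display} {V : measurableType d'} (nu : probability V R).

(** By independence the pair [(w, zeta w)] has a product law; Tonelli's theorem
    then allows to integrate over [zeta w] with [w] frozen. *)
Lemma integral_freeze (G : set (set Om)) (zeta : Om -> V)
    (phi : g_sigma_algebraType G * V -> \bar R) :
  G `<=` measurable -> measurable_fun setT zeta ->
  (forall E A, <<s G >> E -> measurable A ->
    P (E `&` zeta @^-1` A) = P E * nu A) ->
  measurable_fun setT phi -> (forall x, 0 <= phi x) ->
  \int[P]_w phi (w, zeta w) = \int[P]_w \int[nu]_v phi (w, v).
Proof.
move=> Gm mzeta ind mphi phi0.
have mid := measurable_id_sub Gm.
pose idf : {mfun Om >-> g_sigma_algebraType G} :=
  HB.pack (id : Om -> g_sigma_algebraType G) (isMeasurableFun.Build _ _ _ _ _ mid).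
pose Q := distribution P idf.
pose pr := fun w : Om => (w : g_sigma_algebraType G, zeta w).
have mpr : measurable_fun setT pr by apply/measurable_fun_pairP.
pose prf : {mfun Om >-> (g_sigma_algebraType G * V)%type} :=
  HB.pack pr (isMeasurableFun.Build _ _ _ _ _ mpr).
transitivity (\int[distribution P prf]_x phi x).
{ by rewrite /distribution ge0_integral_pushforward. }
transitivity (\int[Q \x nu]_x phi x).
{ apply: eq_measure_integral => A mA _; apply/esym/product_measure_unique => // E B mE mB. }
rewrite fubini_tonelli1// /Q /distribution ge0_integral_pushforward//.
- exact: (measurable_fun_fubini_tonelli_F phi).
- by move=> y _; apply: integral_ge0.
Qed.

End Freezing.

Section IntegralBounds.
Context {R : realType} {d : measure_display} {V : measurableType d}
  (nu : probability V R).
Local Open Scope ereal_scope.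

(** In use, [l] is the inner product of a fixed matrix with centered noise. *)
Lemma integral_affine_le (X l N : V -> R) (c0 c2 b : R) :
  measurable_fun setT X -> (forall v, (0 <= X v)%R) ->
  nu.-integrable setT (EFin \o l) -> \int[nu]_v (l v)%:E = 0 ->
  measurable_fun setT N -> (forall v, (0 <= N v)%R) ->
  \int[nu]_v (N v)%:E <= b%:E -> (0 <= c2)%R ->
  (forall v, (X v <= c0 + l v + c2 * N v)%R) ->
  \int[nu]_v (X v)%:E <= (c0 + c2 * b)%:E.
Proof.
move=> mX X0 il l0 mN N0 Nb c20 XN.
have iN : nu.-integrable setT (EFin \o N).
  apply/integrableP; split; first exact/measurable_EFinP.
  rewrite (le_lt_trans _ (ltry b))//; apply: le_trans Nb.
  rewrite le_eqVlt; apply/orP; left; apply/eqP; apply: eq_integral => v _ /=.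
  by rewrite ger0_norm.
have icst : nu.-integrable setT (EFin \o cst c0) by exact: finite_measure_integrable_cst.
have icN : nu.-integrable setT (fun v => c2%:E * (N v)%:E) by exact: integrableZl.
have il' : nu.-integrable setT (fun v => c0%:E + (l v)%:E) by exact: integrableD.
apply: (@le_trans _ _ (\int[nu]_v ((c0%:E + (l v)%:E) + c2%:E * (N v)%:E))).
  apply: ge0_le_integral => //.
  - by move=> v _; rewrite lee_fin.
  - exact/measurable_EFinP.
  - by case/integrableP : (integrableD measurableT il' icN).
  - by move=> v _; rewrite -EFinM -!EFinD lee_fin.
rewrite integralD//= integralD//= l0 adde0 integral_cst//= probability_setT mule1.
rewrite integralZl// EFinD leeD2l// EFinM lee_wpmul2l// lee_fin.
Qed.

Lemma integral_le_affine (X N : V -> R) (c0 c2 b : R) :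
  measurable_fun setT X -> (forall v, (0 <= X v)%R) ->
  measurable_fun setT N -> (forall v, (0 <= N v)%R) ->
  \int[nu]_v (N v)%:E <= b%:E -> (0 <= c2)%R ->
  (forall v, (X v <= c0 + c2 * N v)%R) ->
  \int[nu]_v (X v)%:E <= (c0 + c2 * b)%:E.
Proof.
move=> mX X0 mN N0 Nb c20 XN.
apply: (@integral_affine_le X (cst 0%R) N) => //.
- exact: finite_measure_integrable_cst.
- by rewrite integral0.
- by move=> v; rewrite /= addr0.
Qed.

(** Young's inequality at a level [t] above [s], which may be 0; then let [t] tend
    to [s]. *)
Lemma moment2_of_moment3 (f : V -> R) (s : R) : measurable_fun setT f ->
  (forall v, (0 <= f v)%R) -> (0 <= s)%R ->
  \int[nu]_v (f v ^+ 3)%:E <= (s ^+ 3)%:E -> \int[nu]_v (f v ^+ 2)%:E <= (s ^+ 2)%:E.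
Proof.
move=> mf f0 s0 f3; apply/lee_addgt0Pr => e e0.
pose t := Num.sqrt (s ^+ 2 + e).
have se : (0 < s ^+ 2 + e)%R by rewrite ltr_wpDl// sqr_ge0.
have t0 : (0 < t)%R by rewrite sqrtr_gt0.
have t2 : (t ^+ 2 = s ^+ 2 + e)%R by rewrite sqr_sqrtr// ltW.
have st : (s <= t)%R.
  by rewrite -(@ler_pXn2r _ 2) ?nnegrE ?(ltW t0)// t2 lerDl ltW.
rewrite -EFinD -t2.
apply: (le_trans (@integral_le_affine _ (fun v => f v ^+ 3)%R (t ^+ 2 / 3)%R
  (2 / (3 * t))%R (s ^+ 3) _ _ _ _ f3 _ _)).
- exact: measurable_funX.
- by move=> v; rewrite sqr_ge0.
- exact: measurable_funX.
- by move=> v; rewrite exprn_ge0.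
- by rewrite divr_ge0// mulr_ge0// ltW.
- move=> v; set N := f v.
  rewrite -(ler_pM2l t0) (le_trans (young_cube (ltW t0) (f0 v)))// -/N.
  by rewrite le_eqVlt; apply/orP; left; apply/eqP; field; rewrite gt_eqF.
rewrite lee_fin.
have : (2 / (3 * t) * s ^+ 3 <= 2 / (3 * t) * t ^+ 3)%R.
  rewrite ler_wpM2l ?divr_ge0 ?mulr_ge0 ?(ltW t0)//.
  by rewrite ler_pXn2r ?nnegrE ?(ltW t0).
have -> : (2 / (3 * t) * t ^+ 3 = 2 / 3 * t ^+ 2)%R by field; rewrite gt_eqF.
by move: (2 / (3 * t) * _)%R => Q; lra.
Qed.

Lemma moment1_of_moment2 (f : V -> R) (s : R) : measurable_fun setT f ->
  (forall v, (0 <= f v)%R) -> (0 <= s)%R ->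
  \int[nu]_v (f v ^+ 2)%:E <= (s ^+ 2)%:E -> \int[nu]_v (f v)%:E <= s%:E.
Proof.
move=> mf f0 s0 f2; apply/lee_addgt0Pr => e e0.
pose t := (s + e)%R.
have t0 : (0 < t)%R by rewrite ltr_wpDl.
have st : (s <= t)%R by rewrite lerDl ltW.
rewrite -EFinD -/t.
apply: (le_trans (@integral_le_affine _ (fun v => f v ^+ 2)%R (t / 2)%R
  (1 / (2 * t))%R (s ^+ 2) mf f0 _ _ f2 _ _)).
- exact: measurable_funX.
- by move=> v; rewrite sqr_ge0.
- by rewrite divr_ge0// mulr_ge0// ltW.
- move=> v; set N := f v.
  have E : (2 * t * (t / 2 + 1 / (2 * t) * N ^+ 2) = t ^+ 2 + N ^+ 2)%R.
    by field; rewrite gt_eqF.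
  rewrite -(@ler_pM2l _ (2 * t)) ?mulr_gt0// E.
  have h : (0 <= (N - t) ^+ 2)%R by rewrite sqr_ge0.
  have E2 : ((N - t) ^+ 2 = t ^+ 2 + N ^+ 2 - 2 * t * N)%R by ring.
  by move: h; rewrite E2 subr_ge0.
rewrite lee_fin.
have : (1 / (2 * t) * s ^+ 2 <= 1 / (2 * t) * t ^+ 2)%R.
  rewrite ler_wpM2l ?divr_ge0 ?mulr_ge0 ?(ltW t0)//.
  by rewrite ler_pXn2r ?nnegrE ?(ltW t0).
have -> : (1 / (2 * t) * t ^+ 2 = t / 2)%R by field; rewrite gt_eqF.
by move: (1 / (2 * t) * _)%R => Q; lra.
Qed.

Lemma moment1_of_moment3 (f : V -> R) (s : R) : measurable_fun setT f ->
  (forall v, (0 <= f v)%R) -> (0 <= s)%R ->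
  \int[nu]_v (f v ^+ 3)%:E <= (s ^+ 3)%:E -> \int[nu]_v (f v)%:E <= s%:E.
Proof. by move=> mf f0 s0 /(moment2_of_moment3 mf f0 s0); exact: moment1_of_moment2. Qed.

End IntegralBounds.

Lemma integral_le_lin2 {R : realType} {d : measure_display} {V : measurableType d}
    (nu : probability V R) (X N1 N2 : V -> R) (c1 c2 b1 b2 : R) :
  measurable_fun setT X -> (forall v, 0 <= X v) ->
  measurable_fun setT N1 -> (forall v, 0 <= N1 v) -> 0 <= c1 ->
  measurable_fun setT N2 -> (forall v, 0 <= N2 v) -> 0 <= c2 ->
  (\int[nu]_v (N1 v)%:E <= b1%:E)%E -> (\int[nu]_v (N2 v)%:E <= b2%:E)%E ->
  (forall v, X v <= c1 * N1 v + c2 * N2 v) ->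
  (\int[nu]_v (X v)%:E <= (c1 * b1 + c2 * b2)%:E)%E.
Proof.
move=> mX X0 m1 N10 c10 m2 N20 c20 h1 h2 XN.
have mE (c : R) (N : V -> R) : measurable_fun setT N ->
    measurable_fun setT (fun v => (c * N v)%:E).
  by move=> mN; apply/measurable_EFinP; exact: measurable_funM.
have ge0E (c : R) (N : V -> R) : 0 <= c -> (forall v, 0 <= N v) ->
    forall v, setT v -> (0 <= (c * N v)%:E)%E.
  by move=> c0 N0 v _; rewrite lee_fin mulr_ge0.
have intZ (c b : R) (N : V -> R) : measurable_fun setT N -> (forall v, 0 <= N v) -> 0 <= c ->
    (\int[nu]_v (N v)%:E <= b%:E)%E -> (\int[nu]_v (c * N v)%:E <= (c * b)%:E)%E.
  move=> mN N0 c0 Nb; under eq_integral do rewrite EFinM.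
  rewrite ge0_integralZl_EFin//; last exact/measurable_EFinP.
    by rewrite EFinM lee_wpmul2l// lee_fin.
  by move=> v _; rewrite lee_fin.
apply: (@le_trans _ _ (\int[nu]_v ((c1 * N1 v)%:E + (c2 * N2 v)%:E))%E).
  apply: ge0_le_integral => //.
  - by move=> v _; rewrite lee_fin.
  - exact/measurable_EFinP.
  - by apply: emeasurable_funD; exact: mE.
  - by move=> v _; rewrite -EFinD lee_fin.
rewrite ge0_integralD//; try exact: mE; try exact: ge0E.
by rewrite EFinD leeD// intZ.
Qed.

Section CenteredStep.
Context {R : realType} {d : measure_display} {V : measurableType d}
  (nu : probability V R).
Local Open Scope ereal_scope.

Definition centered {q r : nat} (D : V -> 'M[R]_(q, r)) :=
  forall i j, nu.-integrable setT (fun v => (D v i j)%:E) /\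
    \int[nu]_v (D v i j)%:E = 0.

Context {q r : nat} (D : V -> 'M[R]_(q, r)).
Hypothesis cD : centered D.

Lemma centered_meas : meas_mx D.
Proof.
by move=> i j; have [/integrableP[mD _] _] := cD i j; exact/measurable_EFinP.
Qed.

Lemma centered_fdot (y : 'M[R]_(q, r)) :
  nu.-integrable setT (fun v => (fdot y (D v))%:E) /\
  \int[nu]_v (fdot y (D v))%:E = 0.
Proof.
have ii i j : nu.-integrable setT (fun v => (y i j * D v i j)%:E).
  under eq_fun do rewrite EFinM; exact: integrableZl (cD i j).1.
have is_ i : nu.-integrable setT (fun v => (\sum_j y i j * D v i j)%R%:E).
  under eq_fun do rewrite -sumEFin; exact: integrable_sum.
split.
  under eq_fun do rewrite /fdot -sumEFin; exact: integrable_sum.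
under eq_integral do rewrite /fdot -sumEFin.
rewrite integral_sum//= big1// => i _.
under eq_integral do rewrite -sumEFin.
rewrite integral_sum//= big1// => j _.
by under eq_integral do rewrite EFinM; rewrite integralZl ?(cD i j).2 ?mule0// (cD i j).1.
Qed.

Lemma centered_fdotZ (c : R) (y : 'M[R]_(q, r)) :
  nu.-integrable setT (EFin \o (fun v => c * fdot y (D v))%R) /\
  \int[nu]_v (c * fdot y (D v))%R%:E = 0.
Proof.
have [h1 h2] := centered_fdot (c *: y).
have E : (fun v => (fdot (c *: y) (D v))%:E) = EFin \o (fun v => c * fdot y (D v))%R.
  by apply/funext => v; rewrite /= fdotZl.
by rewrite -E -[X in \int[_]_x X x]/(EFin \o _) -E.
Qed.

(** The term [s], constant here, gives this the shape of [cube_step]. *)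
Lemma square_step (y : 'M[R]_(q, r)) (s b : R) : (0 <= s)%R ->
  \int[nu]_v (fnorm (D v) ^+ 2)%:E <= b%:E ->
  \int[nu]_v (fnorm (y + D v) ^+ 2 + s)%:E <= (fnorm y ^+ 2 + (s + b))%:E.
Proof.
move=> s0 Db; have [i0 l0] := centered_fdotZ 2 y.
have mD := centered_meas.
have := @integral_affine_le _ _ _ nu (fun v => fnorm (y + D v) ^+ 2 + s)%R
  (fun v => 2 * fdot y (D v))%R (fun v => fnorm (D v) ^+ 2)%R (fnorm y ^+ 2 + s) 1 b.
rewrite mul1r addrA; apply => //.
- apply: measurable_funD => //; apply: measurable_funX; apply: measurable_fnorm.
  by apply: meas_mxD => //; exact: meas_mx_cst.
- by move=> v; rewrite addr_ge0 ?sqr_ge0.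
- by apply: measurable_funX; exact: measurable_fnorm.
- by move=> v; rewrite sqr_ge0.
- by move=> v; rewrite fnormD_sqr; lra.
Qed.

(** For the third moment there is no Pythagoras identity, but centered noise of
    third moment [dl ^+ 3] counts for no more than an orthogonal coordinate of
    square [3 * dl ^+ 2]: the first-order term of [augnorm_cube] has mean zero.
    As this charge is added to a square, the charges of successive samples add
    up, and the average of [N] samples is charged [3 * dl ^+ 2 / N]. *)
Lemma cube_step (y : 'M[R]_(q, r)) (s dl : R) : (0 <= s)%R -> (0 <= dl)%R ->
  \int[nu]_v (fnorm (D v) ^+ 3)%:E <= (dl ^+ 3)%:E ->
  \int[nu]_v (augnorm s (y + D v) ^+ 3)%:E <= (augnorm (s + 3 * dl ^+ 2) y ^+ 3)%:E.
Proof.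
move=> s0 dl0 D3; pose r0 := augnorm s y; have r0p : (0 <= r0)%R by exact: augnorm_ge0.
have [i0 l0] := centered_fdotZ (3 * r0) y.
have mD := centered_meas.
have mfD : measurable_fun setT (fun v => fnorm (D v)) by exact: measurable_fnorm.
have D2 := moment2_of_moment3 mfD (fun v => fnorm_ge0 _) dl0 D3.
pose N v := (3 * r0 * fnorm (D v) ^+ 2 + 1 * fnorm (D v) ^+ 3)%R.
have r3 : (0 <= 3 * r0)%R by rewrite mulr_ge0.
have N0 v : (0 <= N v)%R.
  by rewrite addr_ge0// mulr_ge0 ?sqr_ge0 ?exprn_ge0 ?fnorm_ge0.
have mN : measurable_fun setT N.
  by apply: measurable_funD; apply: measurable_funM => //; exact: measurable_funX.
have IN : \int[nu]_v (N v)%:E <= (3 * r0 * dl ^+ 2 + 1 * dl ^+ 3)%:E.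
  apply: (@integral_le_lin2 _ _ _ nu _ (fun v => fnorm (D v) ^+ 2)%R (fun v => fnorm (D v) ^+ 3)%R) => //.
  - exact: measurable_funX.
  - by move=> v; rewrite sqr_ge0.
  - exact: measurable_funX.
  - by move=> v; rewrite exprn_ge0// fnorm_ge0.
apply: (@le_trans _ _ (r0 ^+ 3 + 1 * (3 * r0 * dl ^+ 2 + 1 * dl ^+ 3))%:E).
  apply: (@integral_affine_le _ _ _ nu _ _ _ (r0 ^+ 3) 1 _ _ _ i0 l0 mN N0 IN) => //.
  - apply: measurable_funX; apply: measurable_augnorm => //.
    by apply: meas_mxD => //; exact: meas_mx_cst.
  - by move=> v; rewrite exprn_ge0// augnorm_ge0.
  - by move=> v; have := augnorm_cube y (D v) s0; rewrite -/r0 /N !mul1r !addrA.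
rewrite lee_fin !mul1r addrA.
have s'0 : (0 <= s + 3 * dl ^+ 2)%R by rewrite addr_ge0// mulr_ge0// sqr_ge0.
set w := augnorm _ y; have w0 : (0 <= w)%R by exact: augnorm_ge0.
have w2 : (w ^+ 2 = r0 ^+ 2 + 3 * dl ^+ 2)%R by rewrite !augnorm_sqr// addrA.
rewrite -(@ler_pXn2r _ 2) ?nnegrE ?addr_ge0 ?mulr_ge0 ?exprn_ge0//.
rewrite -exprM mulnC exprM w2.
(* homogeneous form of (t^3 + 3 t + 1)^2 <= (t^2 + 3)^3, where t = r0 / dl *)
have h1 : (0 <= r0 ^+ 2 * dl ^+ 2 * (r0 - dl) ^+ 2)%R.
  exact: mulr_ge0 (mulr_ge0 (sqr_ge0 _) (sqr_ge0 _)) (sqr_ge0 _).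
have h2 : (0 <= dl ^+ 4 * (r0 - dl) ^+ 2)%R by rewrite mulr_ge0 ?sqr_ge0 ?exprn_ge0.
have h3 : (0 <= r0 ^+ 2 * dl ^+ 4)%R by rewrite mulr_ge0 ?sqr_ge0 ?exprn_ge0.
have h4 : (0 <= r0 ^+ 4 * dl ^+ 2)%R by rewrite mulr_ge0 ?sqr_ge0 ?exprn_ge0.
have h5 : (0 <= dl ^+ 6)%R by rewrite exprn_ge0.
rewrite -subr_ge0 (_ : (_ - _ = 2 * (r0 ^+ 4 * dl ^+ 2) + r0 ^+ 2 * dl ^+ 2 * (r0 - dl) ^+ 2
  + 14 * (r0 ^+ 2 * dl ^+ 4) + 3 * (dl ^+ 4 * (r0 - dl) ^+ 2) + 23 * dl ^+ 6)%R); last by ring.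
by lra.
Qed.

End CenteredStep.

(** * Averages over a batch of random size *)

Section Batch.
Context {R : realType} {d : measure_display} {Om : measurableType d}
  (P : probability Om R) {d' : measure_display} {U : measurableType d'}
  (Z : probability U R).
Local Open Scope ereal_scope.

Variables (G : set (set Om)) (z1 z2 : nat -> Om -> U).
Hypothesis G_sigma : sigma_algebra setT G.
Hypothesis G_meas : G `<=` measurable.
Hypothesis mz1 : forall i, measurable_fun setT (z1 i).
Hypothesis mz2 : forall i, measurable_fun setT (z2 i).

Definition cylinder (A1 A2 : nat -> set U) (M : nat) : set Om :=
  [set w | forall i, (i < M)%N -> A1 i (z1 i w) /\ A2 i (z2 i w)].

Hypothesis fresh : forall M (A1 A2 : nat -> set U) E,
  (forall i, measurable (A1 i)) -> (forall i, measurable (A2 i)) -> G E ->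
  P (E `&` cylinder A1 A2 M) = P E * (\prod_(i < M) (fine (Z (A1 i)) * fine (Z (A2 i))))%:E.

(** These events form a pi-system, which is enough to test independence. *)
Definition history (i : nat) : set (set Om) :=
  [set D | exists E A1 A2, [/\ G E, forall j, measurable (A1 j),
    forall j, measurable (A2 j) & D = E `&` cylinder A1 A2 i]].

Let GT : G setT.
Proof.
by case: G_sigma => G0 GC _; rewrite -[setT]setD0; exact: GC.
Qed.

Let GI A B : G A -> G B -> G (A `&` B).
Proof.
move=> GA GB; have E := measurable_g_measurableTypeE G_sigma.
by have := @measurableI _ (g_sigma_algebraType G) A B; rewrite E; apply.
Qed.

Lemma measurable_cylinder A1 A2 M : (forall i, measurable (A1 i)) ->
  (forall i, measurable (A2 i)) -> measurable (cylinder A1 A2 M).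
Proof.
move=> m1 m2; have -> : cylinder A1 A2 M =
    \bigcap_(i in `I_M) (z1 i @^-1` A1 i `&` z2 i @^-1` A2 i).
  by apply/seteqP; split => w h i /h.
apply: bigcap_measurableType => i _; apply: measurableI.
  by rewrite -[X in measurable X]setTI; exact: mz1.
by rewrite -[X in measurable X]setTI; exact: mz2.
Qed.

Lemma history_meas i : history i `<=` measurable.
Proof.
by move=> _ [E [A1 [A2 [GE m1 m2 ->]]]]; apply: measurableI; [exact: G_meas|exact: measurable_cylinder].
Qed.

Lemma history_setI i : setI_closed (history i).
Proof.
move=> _ _ [E [A1 [A2 [GE m1 m2 ->]]]] [F [B1 [B2 [GF n1 n2 ->]]]].
exists (E `&` F), (fun j => A1 j `&` B1 j), (fun j => A2 j `&` B2 j); split.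
- exact: GI.
- by move=> j; exact: measurableI.
- by move=> j; exact: measurableI.
apply/seteqP; split => w.
  by move=> [[Ew Aw] [Fw Bw]]; split=> // j ji; have [? ?] := Aw j ji; have [? ?] := Bw j ji.
by move=> [[Ew Fw] h]; split; split => // j /h [[? ?] [? ?]].
Qed.

Lemma G_history i : G `<=` history i.
Proof.
move=> E GE; exists E, (fun=> setT), (fun=> setT); split => //.
by rewrite setIidl// => w _ j _.
Qed.

(** For a rectangle, the new pair extends the cylinder by one coordinate; and
    rectangles generate the product sigma-algebra. *)
Lemma history_fresh i D B : <<s history i >> D -> measurable B ->
  P (D `&` (fun w => (z1 i w, z2 i w)) @^-1` B) = P D * (Z \x Z) B.
Proof.
move=> sD mB.
have rect B1 B2 : measurable B1 -> measurable B2 ->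
    P (D `&` (fun w => (z1 i w, z2 i w)) @^-1` (B1 `*` B2)) = P D * (Z B1 * Z B2).
  move=> m1 m2.
  have -> : Z B1 * Z B2 = (fine (Z B1) * fine (Z B2))%:E.
    by rewrite EFinM !fineK// fin_num_measure.
  apply: (indep_pi_system _ _ _ _ _ _ sD).
  - exact: history_meas.
  - exact: history_setI.
  - exact: G_history GT.
  - have -> : (fun w => (z1 i w, z2 i w)) @^-1` (B1 `*` B2) = z1 i @^-1` B1 `&` z2 i @^-1` B2 by [].
    apply: measurableI.
      by rewrite -[X in measurable X]setTI; exact: mz1.
    by rewrite -[X in measurable X]setTI; exact: mz2.
  - by rewrite mulr_ge0// fine_ge0.
  move=> _ [E [A1 [A2 [GE mA1 mA2 ->]]]].
  pose A1' j := if (j < i)%N then A1 j else B1.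
  pose A2' j := if (j < i)%N then A2 j else B2.
  have -> : E `&` cylinder A1 A2 i `&` (fun w => (z1 i w, z2 i w)) @^-1` (B1 `*` B2)
      = E `&` cylinder A1' A2' i.+1.
    rewrite -setIA; congr (_ `&` _); apply/seteqP; split => w.
      move=> [h [/= b1 b2]] j; rewrite ltnS leq_eqVlt => /orP[/eqP ->|ji].
        by rewrite /A1' /A2' ltnn.
      by rewrite /A1' /A2' ji; exact: h.
    move=> h; split; last by have := h i (ltnSn i); rewrite /A1' /A2' ltnn.
    by move=> j ji; have := h j (ltnW ji); rewrite /A1' /A2' ji.
  rewrite !fresh//; first last.
  - by move=> j; rewrite /A2'; case: ifP.
  - by move=> j; rewrite /A1'; case: ifP.
  rewrite big_ord_recr/= {2}/A1' {2}/A2' ltnn EFinM muleA; congr (_ * _%:E * _).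
  by apply: eq_bigr => j _; rewrite /A1' /A2' ltn_ord.
have mD : measurable D.
  exact: (smallest_sub (@sigma_algebra_measurable _ Om) (@history_meas i)).
have mpr : measurable_fun setT (fun w => (z1 i w, z2 i w)) by exact: measurable_fun_pair.
pose prf : {mfun Om >-> (U * U)%type} :=
  HB.pack (fun w => (z1 i w, z2 i w)) (isMeasurableFun.Build _ _ _ _ _ mpr).
pose m1 := pushforward (mrestr P mD) prf.
have PD : P D = (fine (P D))%:E by rewrite fineK// fin_num_measure.
have pD0 : (0 <= fine (P D))%R by rewrite fine_ge0.
pose m2 := mscale (NngNum pD0) (Z \x Z).
have : m1 B = m2 B.
  apply: (measure_unique [set A `*` B | A in measurable & B in measurable] (fun=> setT)) => //.
  - exact: measurable_prod_measurableType.
  - move=> _ _ [X1 mX1 [X2 mX2 <-]] [Y1 mY1 [Y2 mY2 <-]].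
    exists (X1 `&` Y1); first exact: measurableI.
    by exists (X2 `&` Y2); [exact: measurableI|rewrite setXI].
  - by exists setT => //; exists setT => //; rewrite setXTT.
  - by rewrite bigcup_const.
  - move=> _ [X1 mX1 [X2 mX2 <-]].
    rewrite -[LHS]/(P ((fun w => (z1 i w, z2 i w)) @^-1` (X1 `*` X2) `&` D)) setIC rect//.
    rewrite -[RHS]/((fine (P D))%:E * (Z \x Z) (X1 `*` X2)).
    by rewrite product_measure1E// -PD.
  - move=> _; rewrite -[ltLHS]/(P (setT `&` D)).
    by apply: le_lt_trans (ltry 1); apply: probability_le1; exact: measurableI.
rewrite -[m1 B]/(P ((fun w => (z1 i w, z2 i w)) @^-1` B `&` D)) setIC => ->.
by rewrite -[LHS]/((fine (P D))%:E * (Z \x Z) B) -PD.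
Qed.

Lemma sub_history_measurable i d2 (Y : measurableType d2) (f : Om -> Y) :
  measurable_fun setT (f : g_sigma_algebraType G -> Y) ->
  measurable_fun setT (f : g_sigma_algebraType (history i) -> Y).
Proof.
move=> mf _ B mB; have := mf measurableT B mB.
apply: (smallest_sub _ _) => [|E GE]; first exact: smallest_sigma_algebra.
by apply: sub_sigma_algebra; exact: G_history.
Qed.

Lemma history_z1 i j : (j < i)%N ->
  measurable_fun setT (z1 j : g_sigma_algebraType (history i) -> U).
Proof.
move=> ji _ B mB; apply: sub_sigma_algebra.
exists setT, (fun l => if l == j then B else setT), (fun=> setT); split => //.
  by move=> l; case: ifP.
rewrite !setTI; apply/seteqP; split => w.
  by move=> Bw l _ /=; split => //; case: eqP => // ->.
by move=> h; have [] := h j ji; rewrite eqxx.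
Qed.

Lemma history_z2 i j : (j < i)%N ->
  measurable_fun setT (z2 j : g_sigma_algebraType (history i) -> U).
Proof.
move=> ji _ B mB; apply: sub_sigma_algebra.
exists setT, (fun=> setT), (fun l => if l == j then B else setT); split => //.
  by move=> l; case: ifP.
rewrite !setTI; apply/seteqP; split => w.
  by move=> Bw l _ /=; split => //; case: eqP => // ->.
by move=> h; have [] := h j ji; rewrite eqxx.
Qed.

Context {q r : nat}.
Local Notation OmG := (g_sigma_algebraType G).
Variables (N : Om -> nat) (Y : OmG -> 'M[R]_(q, r)) (phi : OmG * (U * U) -> 'M[R]_(q, r)).
Hypothesis GN : forall k, G [set w | N w = k].
Hypothesis N_gt0 : forall w, (0 < N w)%N.
Hypothesis mY : meas_mx Y.
Hypothesis mphi : meas_mx phi.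

Definition batch_sum (w : Om) : 'M[R]_(q, r) :=
  Y w + (N w)%:R^-1 *: \sum_(i < N w) phi (w, (z1 i w, z2 i w)).

(* [pot s y] will be [fnorm y ^+ 2 + s] or [augnorm s y ^+ 3]. *)
Variables (pot : R -> 'M[R]_(q, r) -> R) (b : OmG -> R) (a : R).
Hypothesis a_ge0 : (0 <= a)%R.
Hypothesis b_ge0 : forall w, (0 <= b w)%R.
Hypothesis mb : measurable_fun setT b.
Hypothesis pot_ge0 : forall s y, (0 <= pot s y)%R.
Hypothesis mpot : forall d0 (T : measurableType d0) (s : T -> R) (y : T -> 'M[R]_(q, r)),
  measurable_fun setT s -> meas_mx y -> measurable_fun setT (fun t => pot (s t) (y t)).
Hypothesis pot_step : forall w y s n, (0 <= s)%R -> (0 < n)%N ->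
  \int[Z \x Z]_v (pot s (y + n%:R^-1 *: phi (w, v)))%:E
    <= (pot (s + b w / n%:R ^+ 2) y)%:E.

Let part n i (w : Om) : 'M[R]_(q, r) :=
  Y w + n%:R^-1 *: \sum_(j < i) phi (w, (z1 j w, z2 j w)).

(* What is left of the charge when [i] of the [n] samples have been added. *)
Let credit n i (w : Om) : R := (a + (n - i)%:R * (b w / n%:R ^+ 2))%R.

Let meas_phi_hist d2 (T : measurableType d2) (f : T -> OmG) (g1 g2 : T -> U) :
  measurable_fun setT f -> measurable_fun setT g1 -> measurable_fun setT g2 ->
  meas_mx (fun t => phi (f t, (g1 t, g2 t))).
Proof.
move=> mf m1 m2 k l.
apply: (@measurableT_comp _ _ _ _ _ _ (fun x => phi x k l)); first exact: mphi.
by apply: measurable_fun_pair => //; exact: measurable_fun_pair.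
Qed.

Let id_hist i : measurable_fun setT (id : g_sigma_algebraType (history i) -> OmG).
Proof. by apply: sub_history_measurable; exact: measurable_id. Qed.

Let id_pair_hist i : measurable_fun setT
  (fun x : (g_sigma_algebraType (history i) * (U * U))%type => (x.1 : OmG, x.2)).
Proof.
apply: measurable_fun_pair; last exact: measurable_snd.
by apply: (measurableT_comp (@id_hist i)); exact: measurable_fst.
Qed.

Let meas_part n i : meas_mx (part n i : g_sigma_algebraType (history i) -> 'M[R]_(q, r)).
Proof.
apply: meas_mxD.
  by move=> k l; apply: (sub_history_measurable (f := fun w => Y w k l)); exact: mY.
apply: meas_mxZ; first exact: measurable_cst.
apply: meas_mx_sum => j.
apply: (@meas_phi_hist _ (g_sigma_algebraType (history i)) id (z1 j) (z2 j)).
- exact: id_hist.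
- exact: history_z1.
- exact: history_z2.
Qed.

Let potw n i (w : Om) : R := (\1_[set w | N w = n] w * pot (credit n i w) (part n i w))%R.

Let mcredit n i : measurable_fun setT (credit n i : g_sigma_algebraType (history i) -> R).
Proof.
have mb' := sub_history_measurable (i := i) mb.
by apply: measurable_funD => //; apply: measurable_funM => //; apply: measurable_funM.
Qed.

Let credit_ge0 n i w : (0 <= credit n i w)%R.
Proof. by rewrite addr_ge0// mulr_ge0// divr_ge0// exprn_ge0. Qed.

Let measN k : measurable [set w | N w = k].
Proof. exact/G_meas/GN. Qed.

Let mindic n i : measurable_fun setT
  (\1_[set w | N w = n] : g_sigma_algebraType (history i) -> R).
Proof.
have mE : @measurable _ (g_sigma_algebraType (history i)) [set w | N w = n].
  by apply: sub_sigma_algebra; apply: G_history; exact: GN.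
exact: measurable_indic.
Qed.

Let potw_step n i : (0 < n)%N -> (i < n)%N ->
  \int[P]_w (potw n i.+1 w)%:E <= \int[P]_w (potw n i w)%:E.
Proof.
move=> n0 i_n.
pose Om_i := g_sigma_algebraType (history i).
pose Psi (x : Om_i * (U * U)) : R := (\1_[set w | N w = n] x.1 *
  pot (credit n i.+1 x.1) (part n i x.1 + n%:R^-1 *: phi (x.1, x.2)))%R.
have Psi0 x : (0 <= Psi x)%R by rewrite mulr_ge0// indicE ler0n.
have mcr : measurable_fun setT (credit n i.+1 : Om_i -> R).
  have mb' := sub_history_measurable (i := i) mb.
  by apply: measurable_funD => //; apply: measurable_funM => //; apply: measurable_funM.
have mPsi : measurable_fun setT Psi.
  apply: measurable_funM.
    have m1 : measurable_fun setT (fun w : Om_i => \1_[set w | N w = n] w : R) by exact: mindic.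
    by apply: (measurableT_comp m1); exact: measurable_fst.
  apply: mpot.
    by apply: (measurableT_comp mcr); exact: measurable_fst.
  apply: meas_mxD.
    move=> k l; apply: (measurableT_comp (@meas_part n i k l)).
    exact: measurable_fst.
  apply: meas_mxZ; first exact: measurable_cst.
  move=> k l; exact: (measurableT_comp (mphi k l) (@id_pair_hist i)).
have E w : potw n i.+1 w = Psi (w, (z1 i w, z2 i w)).
  rewrite /potw /Psi /=; congr (_ * pot _ _)%R.
  by rewrite /part big_ord_recr/= scalerDr addrA.
under eq_integral do rewrite E.
have mz : measurable_fun setT (fun w => (z1 i w, z2 i w)) by exact: measurable_fun_pair.
rewrite (@integral_freeze _ _ _ P _ _ (Z \x Z) (history i) _
  (fun x => (Psi x)%:E))//; last 3 first.
- exact: history_meas.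
- by move=> D B sD mB; exact: history_fresh.
- exact/measurable_EFinP.
have mid := measurable_id_sub (@history_meas i).
apply: ge0_le_integral => //.
- by move=> w _; apply: integral_ge0 => v _; rewrite lee_fin.
- have mPE : measurable_fun setT (fun x => (Psi x)%:E) by exact/measurable_EFinP.
  have Psi0E x : 0 <= (Psi x)%:E by rewrite lee_fin.
  pose ZZ : probability (U * U)%type R := Z \x Z.
  have mF := measurable_fun_fubini_tonelli_F (m2 := ZZ) _ mPE Psi0E.
  exact: (measurableT_comp mF mid).
- apply/measurable_EFinP.
  apply: (measurableT_comp (f := potw n i : Om_i -> R)) => //.
  apply: measurable_funM => //; apply: mpot => //; exact: meas_part.
move=> w _; rewrite /Psi /potw /=; rewrite indicE.
have [_|_] := boolP (w \in _); last first.
  rewrite mul0r; under eq_integral do rewrite mul0r.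
  by rewrite integral0.
rewrite mul1r; under eq_integral do rewrite mul1r.
apply: (le_trans (pot_step _ _ _ _)) => //.
rewrite lee_fin le_eqVlt; apply/orP; left; apply/eqP; congr (pot _ _).
rewrite /credit -addrA; congr (_ + _)%R.
by rewrite -(subnSK i_n) -[in RHS]natr1 mulrDl mul1r.
Qed.

Let potw_part n : (0 < n)%N ->
  \int[P]_w (potw n n w)%:E <= \int[P]_w (potw n 0 w)%:E.
Proof.
move=> n0; suff h k : (k <= n)%N -> \int[P]_w (potw n k w)%:E <= \int[P]_w (potw n 0 w)%:E.
  exact: h.
elim: k => // k IH kn; apply: le_trans (IH (ltnW kn)).
exact: potw_step.
Qed.

Lemma measurable_batch_sum d2 (T : measurableType d2) (f : T -> Om) :
  measurable_fun setT (f : T -> OmG) ->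
  (forall i, measurable_fun setT (fun t => z1 i (f t))) ->
  (forall i, measurable_fun setT (fun t => z2 i (f t))) ->
  meas_mx (fun t => batch_sum (f t)).
Proof.
move=> mf m1 m2 k l.
apply: (@measurable_fun_countable _ _ _ _ _ (fun t => N (f t))
  (fun n t => (Y (f t) + n%:R^-1 *: \sum_(i < n) phi (f t, (z1 i (f t), z2 i (f t)))) k l)%R).
  move=> n; have := mf measurableT [set w | N w = n].
  rewrite setTI; apply; apply: sub_sigma_algebra; exact: GN.
move=> n; move: k l; apply: meas_mxD.
  by move=> k l; apply: (measurableT_comp (mY k l)).
apply: meas_mxZ; first exact: measurable_cst.
by apply: meas_mx_sum => j; exact: meas_phi_hist.
Qed.

(** The size of the batch is determined by [G]. On each of its level sets the
    samples are added one by one; each is independent of what precedes it, and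
    is charged [b / N ^+ 2]. *)
Theorem batch_potential :
  \int[P]_w (pot a (batch_sum w))%:E <= \int[P]_w (pot (a + b w / (N w)%:R) (Y w))%:E.
Proof.
have midG := measurable_id_sub G_meas.
have tI : trivIset setT (fun n => [set w | N w = n]).
  apply/trivIsetP => i j _ _ /eqP ij; apply/seteqP; split => // w [/= Ni Nj].
  by case: ij; rewrite -Ni -Nj.
have cover : \bigcup_n [set w | N w = n] = setT.
  by apply/seteqP; split => // w _; exists (N w).
have mS : measurable_fun setT (fun w => pot a (batch_sum w)).
  by apply: mpot => //; apply: (measurable_batch_sum (f := id)).
have mN' : measurable_fun setT (fun w : Om => ((N w)%:R^-1)%R : R).
  exact: (@measurable_fun_countable _ _ _ _ _ N (fun n _ => (n%:R^-1)%R : R)).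
have mY0 : measurable_fun setT (fun w : Om => pot (a + b w / (N w)%:R) (Y w)).
  apply: mpot.
    apply: measurable_funD => //; apply: measurable_funM => //.
    exact: (measurableT_comp mb).
  by move=> k l; apply: (measurableT_comp (mY k l)).
rewrite -cover !ge0_integral_bigcup//;
  do ?[by rewrite cover; exact/measurable_EFinP|by move=> w _; rewrite lee_fin].
apply: lee_nneseries => [n _ _|n _].
  by apply: integral_ge0 => w _; rewrite lee_fin.
have [->|n0] := posnP n.
  rewrite (_ : [set w | N w = 0%N] = set0) ?integral_set0//.
  by apply/seteqP; split => // w /= Nw; have := N_gt0 w; rewrite Nw.
have indE (X X' : Om -> R) : (forall w, N w = n -> X w = X' w) ->
    \int[P]_(w in [set w | N w = n]) (X w)%:E = \int[P]_w (\1_[set w | N w = n] w * X' w)%:E.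
  move=> XX; rewrite integral_mkcond; apply: eq_integral => w _.
  rewrite patchE indicE; case: ifPn => [|_]; last by rewrite mul0r.
  by rewrite inE /= => /XX ->; rewrite mul1r.
rewrite (indE _ (fun w => pot (credit n n w) (part n n w))); last first.
  move=> w Nw; rewrite /credit subnn mul0r addr0; congr (pot _ _).
  by rewrite /batch_sum Nw.
rewrite (indE _ (fun w => pot (credit n 0 w) (part n 0 w))); first exact: potw_part.
move=> w Nw; rewrite /credit subn0 /part big_ord0 scaler0 addr0 Nw; congr (pot (_ + _) _).
have nn : (n%:R != 0 :> R)%R by rewrite pnatr_eq0 -lt0n.
by rewrite expr2; field.
Qed.

End Batch.

(** * Mean matrices *)

Section Moments.
Context {R : realType} {d : measure_display} {V : measurableType d}
  (nu : probability V R).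
Local Open Scope ereal_scope.

Definition has_mean {q r : nat} (A : V -> 'M[R]_(q, r)) (M : 'M[R]_(q, r)) :=
  forall i j, nu.-integrable setT (fun v => (A v i j)%:E) /\
    \int[nu]_v (A v i j)%:E = (M i j)%:E.

Section HasMean.
Context {q r : nat}.
Implicit Types (A B : V -> 'M[R]_(q, r)) (M : 'M[R]_(q, r)).

Lemma has_mean_meas A M : has_mean A M -> meas_mx A.
Proof.
by move=> hA i j; have [/integrableP[mA _] _] := hA i j; exact/measurable_EFinP.
Qed.

Lemma has_mean_cst M : has_mean (fun=> M) M.
Proof.
move=> i j; split; first exact: finite_measure_integrable_cst.
by rewrite integral_cst//= probability_setT mule1.
Qed.

Lemma has_meanD A B M M' : has_mean A M -> has_mean B M' ->
  has_mean (fun v => A v + B v)%R (M + M')%R.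
Proof.
move=> hA hB i j; have [iA eA] := hA i j; have [iB eB] := hB i j.
have E : (fun v => ((A v + B v) i j)%:E)%R = (fun v => (A v i j)%:E + (B v i j)%:E).
  by apply/funext => v; rewrite mxE.
rewrite E; split; first exact: integrableD.
by rewrite integralD// eA eB mxE.
Qed.

Lemma has_meanZ c A M : has_mean A M -> has_mean (fun v => c *: A v)%R (c *: M)%R.
Proof.
move=> hA i j; have [iA eA] := hA i j.
have E : (fun v => ((c *: A v) i j)%:E)%R = (fun v => c%:E * (A v i j)%:E).
  by apply/funext => v; rewrite mxE EFinM.
rewrite E; split; first exact: integrableZl.
by rewrite integralZl// eA mxE EFinM.
Qed.

Lemma has_meanB A B M M' : has_mean A M -> has_mean B M' ->
  has_mean (fun v => A v - B v)%R (M - M')%R.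
Proof.
move=> hA hB; have hN := has_meanD hA (has_meanZ (-1) hB).
have -> : (fun v => A v - B v)%R = (fun v => A v + -1 *: B v)%R.
  by apply/funext => v; rewrite scaleN1r.
by rewrite -(scaleN1r M').
Qed.

Lemma has_mean_centered A M : has_mean A M -> centered nu (fun v => A v - M)%R.
Proof.
move=> hA i j; have [iA eA] := has_meanB hA (has_mean_cst M) i j.
by split => //; rewrite eA subrr mxE.
Qed.

Lemma has_mean_fdot A M (y : 'M[R]_(q, r)) : has_mean A M ->
  nu.-integrable setT (fun v => (fdot y (A v))%:E) /\
  \int[nu]_v (fdot y (A v))%:E = (fdot y M)%:E.
Proof.
move=> hA; have [i0 e0] := centered_fdot (has_mean_centered hA) y.
have E : (fun v => (fdot y (A v))%:E) = (fun v => (fdot y (A v - M)%R)%:E + (fdot y M)%:E).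
  by apply/funext => v; rewrite -EFinD -fdotDr subrK.
have ic : nu.-integrable setT (cst (fdot y M)%:E) by exact: finite_measure_integrable_cst.
rewrite E; split; first exact: integrableD.
by rewrite integralD// e0 add0e integral_cst//= probability_setT mule1.
Qed.

(** Take the inner product of [A] with its own mean. *)
Lemma fnorm_mean_le A M (s : R) : has_mean A M -> (0 <= s)%R ->
  \int[nu]_v (fnorm (A v))%:E <= s%:E -> (fnorm M <= s)%R.
Proof.
move=> hA s0 As; have [->//|M0] := eqVneq (fnorm M) 0%R.
have M0' : (0 < fnorm M)%R by rewrite lt0r M0 fnorm_ge0.
have [iMA eMA] := has_mean_fdot M hA.
have mA := has_mean_meas hA.
rewrite -(ler_pM2l M0') -expr2 fnorm_sqr -lee_fin -eMA EFinM.
apply: (@le_trans _ _ (\int[nu]_v ((fnorm M)%:E * (fnorm (A v))%:E))); last first.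
  rewrite ge0_integralZl_EFin ?fnorm_ge0//.
  - by rewrite lee_wpmul2l// lee_fin fnorm_ge0.
  - by move=> v _; rewrite lee_fin fnorm_ge0.
  - by apply/measurable_EFinP; exact: measurable_fnorm.
apply: le_integral => //.
  apply/integrableP; split.
    apply/measurable_EFinP; apply: measurable_funM => //; exact: measurable_fnorm.
  rewrite (le_lt_trans _ (ltry (fnorm M * s)))//.
  under eq_integral => v _ do rewrite -EFinM abse_EFin ger0_norm ?mulr_ge0 ?fnorm_ge0//.
  under eq_integral => v _ do rewrite EFinM.
  rewrite ge0_integralZl_EFin ?fnorm_ge0//.
  - by rewrite EFinM lee_wpmul2l// lee_fin fnorm_ge0.
  - by move=> v _; rewrite lee_fin fnorm_ge0.
  - by apply/measurable_EFinP; exact: measurable_fnorm.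
by move=> v _; rewrite -EFinM lee_fin fdot_le.
Qed.

(** Subtracting the mean at most doubles a moment bound, by [fnorm_mean_le]. *)
Lemma center_moment3 A M (s : R) : has_mean A M -> (0 <= s)%R ->
  \int[nu]_v (fnorm (A v) ^+ 3)%:E <= (s ^+ 3)%:E ->
  \int[nu]_v (fnorm (A v - M)%R ^+ 3)%:E <= ((2 * s) ^+ 3)%:E.
Proof.
move=> hA s0 A3; have mA := has_mean_meas hA.
have mfA : measurable_fun setT (fun v => fnorm (A v)) by exact: measurable_fnorm.
have fA0 v : (0 <= fnorm (A v))%R by exact: fnorm_ge0.
have Ms := fnorm_mean_le hA s0 (moment1_of_moment3 mfA fA0 s0 A3).
have -> : ((2 * s) ^+ 3 = 4 * s ^+ 3 + 4 * s ^+ 3)%R by ring.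
apply: (@integral_le_affine _ _ _ nu _ (fun v => fnorm (A v) ^+ 3)%R) => //.
- apply: measurable_funX; apply: measurable_fnorm; apply: meas_mxD => //; exact: meas_mx_cst.
- by move=> v; rewrite exprn_ge0// fnorm_ge0.
- exact: measurable_funX.
- by move=> v; rewrite exprn_ge0.
move=> v; apply: (@le_trans _ _ ((fnorm (A v) + s) ^+ 3)%R).
  rewrite ler_pXn2r ?nnegrE ?fnorm_ge0 ?addr_ge0//.
  by rewrite (le_trans (ler_fnormB _ _))// lerD2l.
by rewrite addrC cubeD_le.
Qed.

Lemma center_moment2 A M (s : R) : has_mean A M -> (0 <= s)%R ->
  \int[nu]_v (fnorm (A v) ^+ 2)%:E <= (s ^+ 2)%:E ->
  \int[nu]_v (fnorm (A v - M)%R ^+ 2)%:E <= ((2 * s) ^+ 2)%:E.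
Proof.
move=> hA s0 A2; have mA := has_mean_meas hA.
have mfA : measurable_fun setT (fun v => fnorm (A v)) by exact: measurable_fnorm.
have fA0 v : (0 <= fnorm (A v))%R by exact: fnorm_ge0.
have Ms := fnorm_mean_le hA s0 (moment1_of_moment2 mfA fA0 s0 A2).
have -> : ((2 * s) ^+ 2 = 2 * s ^+ 2 + 2 * s ^+ 2)%R by ring.
apply: (@integral_le_affine _ _ _ nu _ (fun v => fnorm (A v) ^+ 2)%R) => //.
- apply: measurable_funX; apply: measurable_fnorm; apply: meas_mxD => //; exact: meas_mx_cst.
- by move=> v; rewrite exprn_ge0// fnorm_ge0.
- exact: measurable_funX.
- by move=> v; rewrite exprn_ge0.
move=> v; apply: (@le_trans _ _ ((fnorm (A v) + s) ^+ 2)%R).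
  rewrite ler_pXn2r ?nnegrE ?fnorm_ge0 ?addr_ge0//.
  by rewrite (le_trans (ler_fnormB _ _))// lerD2l.
by rewrite addrC squareD_le.
Qed.

End HasMean.

Lemma has_mean_tr {q r} (A : V -> 'M[R]_(q, r)) M :
  has_mean A M -> has_mean (fun v => (A v)^T)%R (M^T)%R.
Proof.
move=> hA i j; have [iA eA] := hA j i.
have E : (fun v => ((A v)^T i j)%:E)%R = (fun v => (A v j i)%:E).
  by apply/funext => v; rewrite mxE.
by rewrite E mxE.
Qed.

Lemma has_mean_mulmxr {q r s} (A : V -> 'M[R]_(q, r)) M (C : 'M[R]_(r, s)) :
  has_mean A M -> has_mean (fun v => A v *m C)%R (M *m C)%R.
Proof.
move=> hA i j.
have E : (fun v => ((A v *m C) i j)%:E)%R = (fun v => \sum_k ((C k j)%:E * (A v i k)%:E)).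
  by apply/funext => v; rewrite mxE -sumEFin; apply: eq_bigr => k _; rewrite mulrC.
have ik k : nu.-integrable setT (fun v => (C k j)%:E * (A v i k)%:E).
  exact: integrableZl (hA i k).1.
rewrite E; split; first exact: integrable_sum.
rewrite integral_sum// mxE -sumEFin; apply: eq_bigr => k _.
by rewrite integralZl ?(hA i k).2 1?mulrC// (hA i k).1.
Qed.

End Moments.

(** * Moments of one sample of the estimators *)

Section ProductMean.
Context {R : realType} {d : measure_display} {U : measurableType d}
  (Z : probability U R).
Local Open Scope ereal_scope.
Let ZZ : probability (U * U)%type R := Z \x Z.

Let measurable_prod1 (u v : U -> R) : measurable_fun setT u -> measurable_fun setT v ->
  measurable_fun setT (fun x : U * U => (u x.1 * v x.2)%R%:E).
Proof.
move=> mu mv; apply/measurable_EFinP; apply: measurable_funM.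
  exact: (measurableT_comp mu measurable_fst).
exact: (measurableT_comp mv measurable_snd).
Qed.

Lemma integral_prod_ge0 (u v : U -> R) (a b : R) :
  measurable_fun setT u -> measurable_fun setT v ->
  (forall s, (0 <= u s)%R) -> (forall s, (0 <= v s)%R) -> (0 <= b)%R ->
  \int[Z]_s (u s)%:E <= a%:E -> \int[Z]_s (v s)%:E <= b%:E ->
  \int[ZZ]_x (u x.1 * v x.2)%:E <= (a * b)%:E.
Proof.
move=> mu mv u0 v0 b0 ua vb.
have mp := measurable_prod1 mu mv.
have p0 (x : U * U) : 0 <= (u x.1 * v x.2)%:E by rewrite lee_fin mulr_ge0.
have := fubini_tonelli1 (m1 := Z) (m2 := Z) _ mp p0.
rewrite /ZZ => ->; rewrite /fubini_F /=.
have E x : \int[Z]_y (u x * v y)%:E = (u x)%:E * \int[Z]_y (v y)%:E.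
  under eq_integral do rewrite EFinM.
  rewrite ge0_integralZl_EFin//; last exact/measurable_EFinP.
  by move=> y _; rewrite lee_fin.
under eq_integral do rewrite E.
have v_fin : \int[Z]_y (v y)%:E \is a fin_num.
  rewrite ge0_fin_numE; first exact: le_lt_trans vb (ltry _).
  by apply: integral_ge0 => y _; rewrite lee_fin.
rewrite -(fineK v_fin); set w := fine _.
have w0 : (0 <= w)%R by rewrite fine_ge0// integral_ge0// => y _; rewrite lee_fin.
have wb : (w <= b)%R by rewrite -lee_fin fineK.
under eq_integral do rewrite muleC.
rewrite ge0_integralZl_EFin//; last 2 first.
- by move=> y _; rewrite lee_fin.
- exact/measurable_EFinP.
by rewrite mulrC EFinM lee_pmul//; apply: integral_ge0 => y _; rewrite lee_fin.
Qed.

Lemma integral_prod (u v : U -> R) (a b : R) :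
  Z.-integrable setT (EFin \o u) -> \int[Z]_s (u s)%:E = a%:E ->
  Z.-integrable setT (EFin \o v) -> \int[Z]_s (v s)%:E = b%:E ->
  ZZ.-integrable setT (fun x => (u x.1 * v x.2)%:E) /\
  \int[ZZ]_x (u x.1 * v x.2)%:E = (a * b)%:E.
Proof.
move=> iu ea iv eb.
have mu : measurable_fun setT u by apply/measurable_EFinP; case/integrableP : iu.
have mv : measurable_fun setT v by apply/measurable_EFinP; case/integrableP : iv.
have mp := measurable_prod1 mu mv.
have bound w : Z.-integrable setT (EFin \o w) ->
    exists c, (0 <= c)%R /\ \int[Z]_s (`|w s|%R)%:E <= c%:E.
  case/integrableP => mw iw; exists (fine (\int[Z]_s `|(w s)%:E|)).
  by split; [rewrite fine_ge0// integral_ge0|rewrite fineK// ge0_fin_numE// integral_ge0].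
have ip : ZZ.-integrable setT (fun x => (u x.1 * v x.2)%:E).
  have [cu [cu0 hu]] := bound _ iu; have [cv [cv0 hv]] := bound _ iv.
  apply/integrableP; split => //.
  apply: (@le_lt_trans _ _ (cu * cv)%:E); last exact: ltry.
  have := @integral_prod_ge0 (fun s => `|u s|%R) (fun s => `|v s|%R) cu cv.
  move=> H; under eq_integral => x _ do rewrite abse_EFin normrM.
  apply: H => //; exact: measurableT_comp.
split => //.
have := @integral12_prod_meas1 _ _ _ _ _ Z Z _ ip.
rewrite /ZZ => <-; rewrite /fubini_F /=.
have E x : \int[Z]_y (u x * v y)%:E = b%:E * (u x)%:E.
  under eq_integral do rewrite EFinM.
  by rewrite integralZl// eb muleC.
under eq_integral do rewrite E.
by rewrite integralZl// ea muleC EFinM.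
Qed.

Lemma has_mean_prod {q r s} (K : U -> 'M[R]_(q, r)) (B : U -> 'M[R]_(r, s)) EK EB :
  has_mean Z K EK -> has_mean Z B EB ->
  has_mean ZZ (fun x => K x.1 *m B x.2)%R (EK *m EB)%R.
Proof.
move=> hK hB i j.
have E : (fun x : U * U => ((K x.1 *m B x.2) i j)%:E)%R =
    (fun x => \sum_k ((K x.1 i k * B x.2 k j)%R)%:E).
  by apply/funext => x; rewrite mxE -sumEFin.
have ik k := integral_prod (hK i k).1 (hK i k).2 (hB k j).1 (hB k j).2.
have ik1 k := (ik k).1.
rewrite E; split; first exact: integrable_sum.
rewrite integral_sum// mxE -sumEFin.
by apply: eq_bigr => k _; rewrite (ik k).2.
Qed.

Lemma has_mean_fst {q r} (A : U -> 'M[R]_(q, r)) M : has_mean Z A M ->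
  has_mean ZZ (fun x => A x.1) M.
Proof.
move=> hA; have := has_mean_prod hA (has_mean_cst Z 1%:M%R).
by under eq_fun do rewrite mulmx1; rewrite mulmx1.
Qed.

Lemma integral_fst_le (u : U -> R) (a : R) :
  measurable_fun setT u -> (forall s, (0 <= u s)%R) ->
  \int[Z]_s (u s)%:E <= a%:E -> \int[ZZ]_x (u x.1)%:E <= a%:E.
Proof.
move=> mu u0 ua; have := @integral_prod_ge0 u (cst 1%R) a 1 mu.
have -> : (fun x : U * U => (u x.1)%:E) = fun x => (u x.1 * cst 1 x.2)%R%:E.
  by apply/funext => x; rewrite mulr1.
rewrite mulr1; apply => //.
by have := integral_cst Z measurableT 1%:E; rewrite /= probability_setT mule1 => ->.
Qed.

Let centeredZ {q r : nat} (D : U * U -> 'M[R]_(q, r)) (c : R) :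
  centered ZZ D -> centered ZZ (fun v => c *: D v)%R.
Proof.
move=> cD; have hD : has_mean ZZ D 0%R.
  by move=> i j; have [h1 h2] := cD i j; split; rewrite ?mxE.
have := has_mean_centered (has_meanZ c hD).
by rewrite scaler0; under eq_fun do rewrite subr0.
Qed.

(** The two potentials for which a sample is charged at a price independent of
    the point reached are the square of the norm and the cube of [augnorm]. *)
Lemma pot_square_step {q r : nat} (D : U * U -> 'M[R]_(q, r)) (b s : R) (N : nat) y :
  centered ZZ D -> \int[ZZ]_v (fnorm (D v) ^+ 2)%:E <= b%:E -> (0 <= s)%R -> (0 < N)%N ->
  \int[Z \x Z]_v (fnorm (y + N%:R^-1 *: D v) ^+ 2 + s)%:E
    <= (fnorm y ^+ 2 + (s + b / N%:R ^+ 2))%:E.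
Proof.
move=> cD Db s0 N0; apply: (@square_step _ _ _ ZZ) => //; first exact: centeredZ.
have mD : measurable_fun setT (fun v => fnorm (D v) ^+ 2)%R.
  by apply: measurable_funX; apply: measurable_fnorm; exact: centered_meas cD.
under eq_integral do rewrite fnormZ exprMn EFinM.
rewrite ge0_integralZl_EFin ?sqr_ge0//.
- rewrite mulrC -exprVn ger0_norm ?invr_ge0// [leRHS]EFinM.
  by rewrite lee_wpmul2l// lee_fin sqr_ge0.
- by move=> v _; rewrite lee_fin sqr_ge0.
- exact/measurable_EFinP.
Qed.

Lemma pot_cube_step {q r : nat} (D : U * U -> 'M[R]_(q, r)) (dl s : R) (N : nat) y :
  centered ZZ D -> (0 <= dl)%R -> \int[ZZ]_v (fnorm (D v) ^+ 3)%:E <= (dl ^+ 3)%:E ->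
  (0 <= s)%R -> (0 < N)%N ->
  \int[Z \x Z]_v (augnorm s (y + N%:R^-1 *: D v) ^+ 3)%:E
    <= (augnorm (s + 3 * dl ^+ 2 / N%:R ^+ 2) y ^+ 3)%:E.
Proof.
move=> cD dl0 Db s0 N0.
have -> : (3 * dl ^+ 2 / N%:R ^+ 2 = 3 * (N%:R^-1 * dl) ^+ 2)%R.
  by rewrite exprMn exprVn; ring.
apply: (@cube_step _ _ _ ZZ) => //; first exact: centeredZ.
  by rewrite mulr_ge0 ?invr_ge0.
have mD : measurable_fun setT (fun v => fnorm (D v) ^+ 3)%R.
  by apply: measurable_funX; apply: measurable_fnorm; exact: centered_meas cD.
under eq_integral do rewrite fnormZ exprMn EFinM.
rewrite ge0_integralZl_EFin ?exprn_ge0//.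
- rewrite exprMn ger0_norm ?invr_ge0// [leRHS]EFinM.
  by rewrite lee_wpmul2l// lee_fin exprn_ge0 ?invr_ge0.
- by move=> v _; rewrite lee_fin exprn_ge0 ?fnorm_ge0.
- exact/measurable_EFinP.
Qed.

End ProductMean.

Lemma precond_sub {R : realType} {p q : nat} (b : R) (H1 H2 Q : 'M[R]_p) (B1 B2 : 'M[R]_(p, q)) :
  (1%:M + b *: (H1 *m Q)) *m B1 - (1%:M + b *: (H2 *m Q)) *m B2 =
  (1%:M + b *: (H1 *m Q)) *m (B1 - B2) + b *: ((H1 - H2) *m (Q *m B2)).
Proof.
rewrite mulmxBr !mulmxDl !mul1mx mulNmx -!scalemxAl -!mulmxA.
move: (H1 *m (Q *m B1)) (H1 *m (Q *m B2)) (H2 *m (Q *m B2)) => X1 X2 X3.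
by apply/matrixP => i j; rewrite !mxE; ring.
Qed.

Section Estimators.
Context {R : realType} {n m : nat} {d : measure_display} {U : measurableType d}
  (Z : probability U R) (mu L rho sigma1 sigma2 : R)
  (f : 'cV[R]_(n + m) -> R) (F : 'cV[R]_(n + m) -> U -> R).
Hypothesis fA : deterministic_assumptions mu L rho f.
Hypothesis sA : stochastic_assumptions Z L rho sigma1 sigma2 f F.
Variable beta : R.
Hypothesis beta_gt : mu^-1 < beta.
Local Open Scope ereal_scope.
Let ZZ : probability (U * U)%type R := Z \x Z.
Local Notation P := (projP : 'M[R]_(n + m)).
Local Notation gF z := (fun s => grad (F^~ s) z).
Local Notation HF z := (fun s => hess (F^~ s) z).
Implicit Types (z : 'cV[R]_(n + m)).
Let b0 : (0 <= beta)%R. Proof. exact: ltW (beta_gt0 fA beta_gt). Qed.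
Let L0 : (0 <= L)%R. Proof. exact: ltW (L_gt0 fA). Qed.
Let rho0 : (0 <= rho)%R. Proof. exact: ltW (rho_gt0 fA). Qed.

Let meas_gF z : meas_mx (gF z).
Proof.
apply: (meas_grad (F_measurable sA) (F_diff sA) (z := fun=> z) (s := id)).
  exact: meas_mx_cst.
exact: measurable_id.
Qed.

Let meas_HF z : meas_mx (HF z).
Proof.
apply: (meas_hess (F_measurable sA) (F_diff sA) (z := fun=> z) (s := id)).
  exact: meas_mx_cst.
exact: measurable_id.
Qed.

Let moment_ge0 (X : U -> R) (s : R) : (forall u, (0 <= X u)%R) ->
  \int[Z]_u (X u)%:E <= (s ^+ 3)%:E -> (0 <= s)%R.
Proof.
move=> X0 Xs; have : (0 <= s ^+ 3)%R.
  by rewrite -lee_fin (le_trans _ Xs)// integral_ge0// => u _; rewrite lee_fin.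
by rewrite exprn_odd_ge0.
Qed.

Lemma gradF_moment3 z :
  \int[Z]_s (fnorm (gF z s - grad f z)%R ^+ 3)%:E <= (sigma1 ^+ 3)%:E.
Proof. by have := gradF_moment sA z; rewrite unlock. Qed.

Lemma hessF_moment3 z : \int[Z]_s (fnorm (HF z s) ^+ 3)%:E <= (sigma2 ^+ 3)%:E.
Proof. by have := hessF_moment sA z; rewrite unlock. Qed.

Lemma gradF_lipschitz3 z1 z2 : \int[Z]_s (fnorm (gF z1 s - gF z2 s)%R ^+ 3)%:E
  <= ((L * fnorm (z1 - z2)) ^+ 3)%:E.
Proof. by have := gradF_lipschitz sA z1 z2; rewrite unlock exprMn. Qed.

Lemma hessF_lipschitz3 z1 z2 : \int[Z]_s (fnorm (HF z1 s - HF z2 s)%R ^+ 3)%:E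
  <= ((rho * fnorm (z1 - z2)) ^+ 3)%:E.
Proof. by have := hessF_lipschitz sA z1 z2; rewrite unlock exprMn. Qed.

Lemma sigma1_ge0 : (0 <= sigma1)%R.
Proof. by apply: moment_ge0 (gradF_moment3 0) => u; rewrite exprn_ge0// fnorm_ge0. Qed.

Lemma sigma2_ge0 : (0 <= sigma2)%R.
Proof. by apply: moment_ge0 (hessF_moment3 0) => u; rewrite exprn_ge0// fnorm_ge0. Qed.

(** The bounds on third moments are what makes the entries integrable. *)
Let has_mean_of_moment {q r} (A : U -> 'M[R]_(q, r)) (C M : 'M[R]_(q, r)) (s : R) :
  meas_mx A -> (0 <= s)%R -> \int[Z]_u (fnorm (A u - C)%R ^+ 3)%:E <= (s ^+ 3)%:E ->
  (forall i j, \int[Z]_u (A u i j)%:E = (M i j)%:E) -> has_mean Z A M.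
Proof.
move=> mA s0 A3 AM i j; split => //.
have mD : meas_mx (fun u => A u - C)%R by apply: meas_mxB => //; exact: meas_mx_cst.
have mDn : measurable_fun setT (fun u => fnorm (A u - C)%R) by exact: measurable_fnorm.
have A1 := moment1_of_moment3 mDn (fun u => fnorm_ge0 _) s0 A3.
apply/integrableP; split; first exact/measurable_EFinP.
apply: (@le_lt_trans _ _ (fnorm C + 1 * s)%:E); last exact: ltry.
under eq_integral do rewrite abse_EFin.
apply: (@integral_le_affine _ _ _ Z _ (fun u => fnorm (A u - C)%R)) => //.
- exact: measurableT_comp.
- by move=> u; exact: fnorm_ge0.
by move=> u; rewrite mul1r (le_trans (entry_le_fnorm _ _ _))// ler_distfnorm.
Qed.

Lemma has_mean_gF z : has_mean Z (gF z) (grad f z).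
Proof.
apply: (has_mean_of_moment _ sigma1_ge0 (gradF_moment3 z)) => // i j.
by rewrite (ord1 j); have := gradF_mean sA z i; rewrite unlock.
Qed.

Lemma has_mean_HF z : has_mean Z (HF z) (hess f z).
Proof.
apply: (@has_mean_of_moment _ _ _ 0%R _ _ _ sigma2_ge0) => //.
  by under eq_integral do rewrite subr0; exact: hessF_moment3.
by move=> i j; have := hessF_mean sA z i j; rewrite unlock.
Qed.

Lemma has_mean_precond z :
  has_mean Z (fun s => precond beta F s z) (1%:M + beta *: (hess f z *m P))%R.
Proof.
apply: has_meanD; first exact: has_mean_cst.
by apply: has_meanZ; apply: has_mean_mulmxr; exact: has_mean_HF.
Qed.

Let preS z s := (1 + beta * fnorm (HF z s))%R.

Let preS_ge0 z s : (0 <= preS z s)%R.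
Proof. by rewrite addr_ge0// mulr_ge0// fnorm_ge0. Qed.

Let meas_preS z : measurable_fun setT (preS z).
Proof.
apply: measurable_funD => //; apply: measurable_funM => //; exact: measurable_fnorm.
Qed.

(** The operator norm of the preconditioner of a sample. *)
Lemma fnorm_precond q z s (B : 'M[R]_(n + m, q)) :
  (fnorm (precond beta F s z *m B) <= preS z s * fnorm B)%R.
Proof.
rewrite /precond mulmxDl mul1mx -scalemxAl -mulmxA mulrDl mul1r.
rewrite (le_trans (ler_fnormD _ _))// lerD2l fnormZ ger0_norm// -mulrA ler_wpM2l//.
rewrite (le_trans (fnorm_mulmx _ _))// ler_wpM2l ?fnorm_ge0//; exact: fnorm_projP_le.
Qed.

Lemma preS_moment3 z : \int[Z]_s (preS z s ^+ 3)%:E <= (4 + 4 * (beta * sigma2) ^+ 3)%:E.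
Proof.
rewrite exprMn mulrA.
apply: (@integral_le_affine _ _ _ Z (fun s => preS z s ^+ 3)%R (fun s => fnorm (HF z s) ^+ 3)%R).
- exact: measurable_funX.
- by move=> s; rewrite exprn_ge0.
- by apply: measurable_funX; exact: measurable_fnorm.
- by move=> s; rewrite exprn_ge0// fnorm_ge0.
- exact: hessF_moment3.
- by rewrite mulr_ge0// exprn_ge0.
move=> s; rewrite -mulrA -exprMn /preS.
by have := cubeD_le ler01 (mulr_ge0 b0 (fnorm_ge0 (HF z s))); rewrite expr1n mulr1.
Qed.

Lemma preS_moment2 z : \int[Z]_s (preS z s ^+ 2)%:E <= (2 + 2 * (beta * sigma2) ^+ 2)%:E.
Proof.
rewrite exprMn mulrA.
apply: (@integral_le_affine _ _ _ Z (fun s => preS z s ^+ 2)%R (fun s => fnorm (HF z s) ^+ 2)%R).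
- exact: measurable_funX.
- by move=> s; rewrite exprn_ge0.
- by apply: measurable_funX; exact: measurable_fnorm.
- by move=> s; rewrite exprn_ge0// fnorm_ge0.
- apply: moment2_of_moment3; [exact: measurable_fnorm| |exact: sigma2_ge0|exact: hessF_moment3].
  by move=> s; exact: fnorm_ge0.
- by rewrite mulr_ge0// exprn_ge0.
move=> s; rewrite -mulrA -exprMn /preS.
by have := squareD_le 1 (beta * fnorm (HF z s)); rewrite expr1n mulr1.
Qed.

Local Notation g := (grad f).
Local Notation h := (h_ beta f).
Local Notation a z := (enorm (grad_y f z)).
Local Notation Hb := (Hbar f beta).
Local Notation c3 := (cst_c3 L sigma2 beta).

(** The estimators average functions of two independent samples, hence of a
    sample of [Z \x Z]. *)
Definition sample_g z (v : U * U) : 'cV[R]_(n + m) :=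
  precond beta F v.1 z *m grad (F^~ v.2) z.

Definition symm (A : 'M[R]_(n + m)) : 'M[R]_(n + m) := 2^-1 *: (A + A^T).

Definition sample_H z (v : U * U) : 'M[R]_(n + m) :=
  symm (precond beta F v.1 z *m hess (F^~ v.2) z).

Lemma mean_sample_g z : has_mean ZZ (sample_g z) (grad h z).
Proof.
by rewrite (grad_h fA); exact: (has_mean_prod (has_mean_precond z) (has_mean_gF z)).
Qed.

Lemma mean_sample_H z : has_mean ZZ (sample_H z) (Hb z).
Proof.
have -> : Hb z = (2^-1 *: (Hb z + (Hb z)^T))%R.
  by rewrite (Hbar_sym fA); move: (Hb z) => M; apply/matrixP => i j; rewrite !mxE; lra.
have hp : has_mean ZZ (fun v => precond beta F v.1 z *m hess (F^~ v.2) z)%R (Hb z).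
  exact: (has_mean_prod (has_mean_precond z) (has_mean_HF z)).
by apply: has_meanZ; apply: has_meanD => //; exact: has_mean_tr.
Qed.

Lemma fnorm_symm A : (fnorm (symm A) <= fnorm A)%R.
Proof.
rewrite fnormZ ger0_norm ?invr_ge0// (le_trans (ler_wpM2l _ (ler_fnormD _ _)))//.
by rewrite fnorm_tr; lra.
Qed.

Let c3_ge1 : (1 + beta * sigma2 <= c3)%R.
Proof. by rewrite /cst_c3 mulrDr lerD2l lerDr mulr_ge0. Qed.

Let bs0 : (0 <= beta * sigma2)%R. Proof. by rewrite mulr_ge0// sigma2_ge0. Qed.

Let c30 : (0 <= c3)%R.
Proof. by apply: le_trans c3_ge1; rewrite addr_ge0. Qed.

Let pow_le (x y : R) k : (0 <= x)%R -> (x <= y)%R -> (x ^+ k <= y ^+ k)%R.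
Proof. by move=> x0 xy; apply: lerXn2r => //; rewrite nnegrE// (le_trans x0). Qed.

Let mHn z k : measurable_fun setT (fun s => fnorm (HF z s) ^+ k)%R.
Proof. by apply: measurable_funX; exact: measurable_fnorm. Qed.

Let Hn_ge0 z k s : (0 <= fnorm (HF z s) ^+ k)%R.
Proof. by rewrite exprn_ge0// fnorm_ge0. Qed.

(** The two factors use independent samples, so that their third moments
    multiply. *)
Lemma sample_H_moment z :
  \int[ZZ]_v (fnorm (sample_H z v - Hb z)%R ^+ 3)%:E <= ((4 * (c3 * sigma2)) ^+ 3)%:E.
Proof.
have -> : (4 * (c3 * sigma2) = 2 * (2 * (c3 * sigma2)))%R by ring.
apply: center_moment3 (mean_sample_H z) _ _; first by rewrite !mulr_ge0// sigma2_ge0.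
have mS := has_mean_meas (mean_sample_H z).
have := integral_prod_ge0 (measurable_funX 3 (meas_preS z)) (mHn z 3) _ _ _
  (preS_moment3 z) (hessF_moment3 z).
move=> /(_ (fun s => exprn_ge0 3 (preS_ge0 z s)) (fun s => Hn_ge0 z 3 s)
  (exprn_ge0 3 sigma2_ge0)) H.
have pointwise v : (fnorm (sample_H z v) ^+ 3 <= preS z v.1 ^+ 3 * fnorm (HF z v.2) ^+ 3)%R.
  rewrite -exprMn pow_le ?fnorm_ge0// (le_trans (fnorm_symm _))//.
  exact: fnorm_precond.
have mR : measurable_fun setT (fun v : U * U => preS z v.1 ^+ 3 * fnorm (HF z v.2) ^+ 3)%R.
  apply: measurable_funM.
    exact: (measurableT_comp (measurable_funX 3 (meas_preS z)) measurable_fst).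
  exact: (measurableT_comp (mHn z 3) measurable_snd).
apply: (@le_trans _ _ ((4 + 4 * (beta * sigma2) ^+ 3) * sigma2 ^+ 3)%:E).
  apply: le_trans H; apply: ge0_le_integral => //.
  - by move=> v _; rewrite lee_fin exprn_ge0// fnorm_ge0.
  - by apply/measurable_EFinP; apply: measurable_funX; exact: measurable_fnorm.
  - exact/measurable_EFinP.
  - by move=> v _; rewrite lee_fin.
have -> : ((2 * (c3 * sigma2)) ^+ 3 = (2 * c3) ^+ 3 * sigma2 ^+ 3)%R by ring.
rewrite lee_fin ler_wpM2r ?exprn_ge0 ?sigma2_ge0//.
have := pow_le 3 (addr_ge0 ler01 bs0) c3_ge1; have := exprn_ge0 3 c30.
move: (beta * sigma2)%R bs0 => x x0; rewrite exprMn.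
have -> : ((1 + x) ^+ 3 = 1 + 3 * x + 3 * x ^+ 2 + x ^+ 3)%R by ring.
by have := sqr_ge0 x => *; lra.
Qed.

Let precond_incr q z1 z2 (v : U * U) (B1 B2 : 'M[R]_(n + m, q)) :
  (fnorm (precond beta F v.1 z1 *m B1 - precond beta F v.1 z2 *m B2) <=
   preS z1 v.1 * fnorm (B1 - B2) + beta * (fnorm (HF z1 v.1 - HF z2 v.1) * fnorm (P *m B2)))%R.
Proof.
rewrite precond_sub (le_trans (ler_fnormD _ _))// lerD ?fnorm_precond//.
by rewrite fnormZ ger0_norm// ler_wpM2l// fnorm_mulmx.
Qed.

Let cubeM (x y b u w : R) :
  (4 * (x * y) ^+ 3 + 4 * (b * (u * w)) ^+ 3
    <= 4 * (x ^+ 3 * y ^+ 3) + 4 * b ^+ 3 * (u ^+ 3 * w ^+ 3))%R.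
Proof. by rewrite le_eqVlt; apply/orP; left; apply/eqP; ring. Qed.

Let meas_dg z1 z2 k : measurable_fun setT (fun s => fnorm (gF z1 s - gF z2 s)%R ^+ k)%R.
Proof. by apply: measurable_funX; apply: measurable_fnorm; exact: meas_mxB. Qed.

Let meas_dH z1 z2 k : measurable_fun setT (fun s => fnorm (HF z1 s - HF z2 s)%R ^+ k)%R.
Proof. by apply: measurable_funX; apply: measurable_fnorm; exact: meas_mxB. Qed.

Let fpow_ge0 q r (A : U -> 'M[R]_(q, r)) k s : (0 <= fnorm (A s) ^+ k)%R.
Proof. by rewrite exprn_ge0// fnorm_ge0. Qed.

Let meas_prod (u v : U -> R) : measurable_fun setT u -> measurable_fun setT v ->
  measurable_fun setT (fun x : U * U => u x.1 * v x.2)%R.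
Proof.
move=> mu' mv; apply: measurable_funM.
  exact: (measurableT_comp mu' measurable_fst).
exact: (measurableT_comp mv measurable_snd).
Qed.

Let symm_sub (A B : 'M[R]_(n + m)) : (symm A - symm B = symm (A - B))%R.
Proof. by apply/matrixP => i j; rewrite !mxE; ring. Qed.

Lemma sample_H_increment_moment z1 z2 :
  \int[ZZ]_v (fnorm (sample_H z1 v - sample_H z2 v - (Hb z1 - Hb z2))%R ^+ 3)%:E
    <= ((6 * (c3 * rho * fnorm (z1 - z2))) ^+ 3)%:E.
Proof.
set x := fnorm (z1 - z2); have x0 : (0 <= x)%R by exact: fnorm_ge0.
have -> : (6 * (c3 * rho * x) = 2 * (3 * (c3 * rho * x)))%R by ring.
apply: center_moment3 (has_meanB (mean_sample_H z1) (mean_sample_H z2)) _ _.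
  by rewrite !mulr_ge0.
pose N1 (v : U * U) := (preS z1 v.1 ^+ 3 * fnorm (HF z1 v.2 - HF z2 v.2) ^+ 3)%R.
pose N2 (v : U * U) := (fnorm (HF z1 v.1 - HF z2 v.1) ^+ 3 * fnorm (HF z2 v.2) ^+ 3)%R.
have rx0 : (0 <= rho * x)%R by rewrite mulr_ge0.
have h1 : \int[ZZ]_v (N1 v)%:E <= ((4 + 4 * (beta * sigma2) ^+ 3) * (rho * x) ^+ 3)%:E.
  apply: (integral_prod_ge0 (measurable_funX 3 (meas_preS z1)) (meas_dH z1 z2 3)) => //.
  - by move=> s; rewrite exprn_ge0.
  - by move=> s; rewrite exprn_ge0// fnorm_ge0.
  - by rewrite exprn_ge0.
  - exact: preS_moment3.
  - exact: hessF_lipschitz3.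
have h2 : \int[ZZ]_v (N2 v)%:E <= ((rho * x) ^+ 3 * sigma2 ^+ 3)%:E.
  apply: (integral_prod_ge0 (meas_dH z1 z2 3) (mHn z2 3)) => //.
  - by move=> s; rewrite exprn_ge0// fnorm_ge0.
  - by rewrite exprn_ge0// sigma2_ge0.
  - exact: hessF_lipschitz3.
  - exact: hessF_moment3.
have b3 : (0 <= beta ^+ 3)%R by rewrite exprn_ge0.
apply: (le_trans (@integral_le_lin2 _ _ _ ZZ _ N1 N2 4 (4 * beta ^+ 3) _ _
    _ _ _ _ _ _ _ _ h1 h2 _)).
- apply: measurable_funX; apply: measurable_fnorm; apply: meas_mxB.
    exact: has_mean_meas (mean_sample_H z1).
  exact: has_mean_meas (mean_sample_H z2).
- by move=> v; rewrite exprn_ge0// fnorm_ge0.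
- exact: meas_prod (measurable_funX 3 (meas_preS z1)) (meas_dH z1 z2 3).
- by move=> v; rewrite mulr_ge0// exprn_ge0// ?fnorm_ge0.
- by [].
- exact: meas_prod (meas_dH z1 z2 3) (mHn z2 3).
- by move=> v; rewrite mulr_ge0// exprn_ge0// ?fnorm_ge0.
- by rewrite mulr_ge0.
- move=> v; rewrite symm_sub.
  apply: (@le_trans _ _ ((preS z1 v.1 * fnorm (HF z1 v.2 - HF z2 v.2)
      + beta * (fnorm (HF z1 v.1 - HF z2 v.1) * fnorm (HF z2 v.2))) ^+ 3)%R).
    rewrite pow_le ?fnorm_ge0// (le_trans (fnorm_symm _))// (le_trans (precond_incr _ _ _ _ _))//.
    by rewrite lerD2l ler_wpM2l// ler_wpM2l ?fnorm_ge0// fnorm_projP_le.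
  apply: le_trans (cubeD_le _ _) (cubeM _ _ _ _ _); rewrite !mulr_ge0 ?fnorm_ge0//.
rewrite lee_fin.
have -> : (4 * ((4 + 4 * (beta * sigma2) ^+ 3) * (rho * x) ^+ 3) +
    4 * beta ^+ 3 * ((rho * x) ^+ 3 * sigma2 ^+ 3) =
    (16 + 20 * (beta * sigma2) ^+ 3) * (rho * x) ^+ 3)%R by rewrite !exprMn; ring.
have -> : ((3 * (c3 * rho * x)) ^+ 3 = (27 * c3 ^+ 3) * (rho * x) ^+ 3)%R by ring.
rewrite ler_wpM2r ?exprn_ge0//.
have := pow_le 3 (addr_ge0 ler01 bs0) c3_ge1.
move: (c3 ^+ 3)%R => C3.
move: (beta * sigma2)%R bs0 => y y0.
have -> : ((1 + y) ^+ 3 = 1 + 3 * y + 3 * y ^+ 2 + y ^+ 3)%R by ring.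
by have := sqr_ge0 y; have := exprn_ge0 3 y0 => *; lra.
Qed.

(** The noise is that of the gradient, multiplied by the preconditioner, plus that
    of the Hessian applied to [P *m grad f z]; the latter is proportional to
    [a z]. *)
Lemma sample_g_moment z :
  \int[ZZ]_v (fnorm (sample_g z v - grad h z)%R ^+ 2)%:E
    <= (8 * ((1 + beta * sigma2) ^+ 2 * sigma1 ^+ 2 + beta ^+ 2 * sigma2 ^+ 2 * a z ^+ 2))%:E.
Proof.
pose N1 (v : U * U) := (preS z v.1 ^+ 2 * fnorm (gF z v.2 - g z) ^+ 2)%R.
pose N2 (v : U * U) := (fnorm (HF z v.1 - hess f z) ^+ 2)%R.
have mdg : measurable_fun setT (fun s => fnorm (gF z s - g z)%R).
  by apply: measurable_fnorm; apply: meas_mxB => //; exact: meas_mx_cst.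
have mdH : measurable_fun setT (fun s => fnorm (HF z s - hess f z)%R).
  by apply: measurable_fnorm; apply: meas_mxB => //; exact: meas_mx_cst.
have h1 : \int[ZZ]_v (N1 v)%:E <= ((2 + 2 * (beta * sigma2) ^+ 2) * sigma1 ^+ 2)%:E.
  apply: (integral_prod_ge0 (measurable_funX 2 (meas_preS z)) (measurable_funX 2 mdg)) => //.
  - by move=> s; rewrite exprn_ge0.
  - by move=> s; rewrite exprn_ge0// fnorm_ge0.
  - by rewrite exprn_ge0// sigma1_ge0.
  - exact: preS_moment2.
  - apply: moment2_of_moment3 => //; [by move=> s; exact: fnorm_ge0|exact: sigma1_ge0|].
    exact: gradF_moment3.
have h2 : \int[ZZ]_v (N2 v)%:E <= ((2 * sigma2) ^+ 2)%:E.
  apply: (@integral_fst_le _ _ _ Z (fun s => fnorm (HF z s - hess f z)%R ^+ 2)%R).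
  - exact: measurable_funX.
  - by move=> s; rewrite exprn_ge0// fnorm_ge0.
  - apply: moment2_of_moment3 => //; first by move=> s; exact: fnorm_ge0.
      by rewrite mulr_ge0// sigma2_ge0.
    exact: center_moment3 (has_mean_HF z) sigma2_ge0 (hessF_moment3 z).
have a0 : (0 <= a z)%R by exact: fnorm_ge0.
apply: (le_trans (@integral_le_lin2 _ _ _ ZZ _ N1 N2 2 (2 * (beta * a z) ^+ 2) _ _
    _ _ _ _ _ _ _ _ h1 h2 _)).
- apply: measurable_funX; apply: measurable_fnorm; apply: meas_mxB.
    exact: has_mean_meas (mean_sample_g z).
  exact: meas_mx_cst.
- by move=> v; rewrite exprn_ge0// fnorm_ge0.
- exact: meas_prod (measurable_funX 2 (meas_preS z)) (measurable_funX 2 mdg).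
- by move=> v; rewrite mulr_ge0// exprn_ge0// ?fnorm_ge0.
- by [].
- exact: (measurableT_comp (measurable_funX 2 mdH) measurable_fst).
- by move=> v; rewrite exprn_ge0// ?fnorm_ge0.
- by rewrite mulr_ge0// exprn_ge0// mulr_ge0.
- move=> v; rewrite (grad_h fA).
  apply: (@le_trans _ _ ((preS z v.1 * fnorm (gF z v.2 - g z)
      + beta * (fnorm (HF z v.1 - hess f z) * a z)) ^+ 2)%R).
    rewrite pow_le ?fnorm_ge0// [X in (fnorm X <= _)%R]precond_sub.
    rewrite (le_trans (ler_fnormD _ _))// lerD ?fnorm_precond//.
    by rewrite fnormZ ger0_norm// ler_wpM2l// (le_trans (fnorm_mulmx _ _))// fnorm_projP.
  rewrite (le_trans (squareD_le _ _))// lerD ?exprMn// le_eqVlt; apply/orP; left.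
  by apply/eqP; rewrite /N2; ring.
rewrite lee_fin.
have := sqr_ge0 sigma1; have := mulr_ge0 (sqr_ge0 (beta * sigma2)) (sqr_ge0 sigma1).
have := mulr_ge0 bs0 (sqr_ge0 sigma1).
have -> : (2 * ((2 + 2 * (beta * sigma2) ^+ 2) * sigma1 ^+ 2) + 2 * (beta * a z) ^+ 2 * (2 * sigma2) ^+ 2
  = 4 * sigma1 ^+ 2 + 4 * ((beta * sigma2) ^+ 2 * sigma1 ^+ 2) + 8 * (beta * sigma2 * a z) ^+ 2)%R by ring.
have -> : (8 * ((1 + beta * sigma2) ^+ 2 * sigma1 ^+ 2 + beta ^+ 2 * sigma2 ^+ 2 * a z ^+ 2)
  = 8 * sigma1 ^+ 2 + 16 * (beta * sigma2 * sigma1 ^+ 2) + 8 * ((beta * sigma2) ^+ 2 * sigma1 ^+ 2)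
    + 8 * (beta * sigma2 * a z) ^+ 2)%R by ring.
by move=> *; lra.
Qed.

Lemma sample_g_increment_moment z1 z2 :
  \int[ZZ]_v (fnorm (sample_g z1 v - sample_g z2 v - (grad h z1 - grad h z2))%R ^+ 2)%:E
    <= (16 * fnorm (z1 - z2) ^+ 2 * (L ^+ 2 * (1 + beta * sigma2) ^+ 2
         + beta ^+ 2 * rho ^+ 2 * (sigma1 ^+ 2 + a z2 ^+ 2)))%:E.
Proof.
set x := fnorm (z1 - z2); have x0 : (0 <= x)%R by exact: fnorm_ge0.
set k2 := (X in (_ * _ * X)%R).
have k20 : (0 <= k2)%R.
  rewrite addr_ge0//; first exact: mulr_ge0 (sqr_ge0 _) (sqr_ge0 _).
  exact: mulr_ge0 (mulr_ge0 (sqr_ge0 _) (sqr_ge0 _)) (addr_ge0 (sqr_ge0 _) (sqr_ge0 _)).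
have s2 : (Num.sqrt k2 ^+ 2 = k2)%R by rewrite sqr_sqrtr.
have -> : (16 * x ^+ 2 * k2 = (2 * (2 * x * Num.sqrt k2)) ^+ 2)%R.
  by rewrite -{1}s2; move: (Num.sqrt k2) => r; ring.
apply: center_moment2 (has_meanB (mean_sample_g z1) (mean_sample_g z2)) _ _.
  by rewrite !mulr_ge0 ?sqrtr_ge0.
pose N1 (v : U * U) := (preS z1 v.1 ^+ 2 * fnorm (gF z1 v.2 - gF z2 v.2) ^+ 2)%R.
pose N2 (v : U * U) := (fnorm (HF z1 v.1 - HF z2 v.1) ^+ 2 * fnorm (P *m gF z2 v.2) ^+ 2)%R.
have rx0 : (0 <= rho * x)%R by rewrite mulr_ge0.
have mPg : measurable_fun setT (fun s => fnorm (P *m gF z2 s)%R).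
  by apply: measurable_fnorm; apply: meas_mxM => //; exact: meas_mx_cst.
have mdg : measurable_fun setT (fun s => fnorm (gF z2 s - g z2)%R).
  by apply: measurable_fnorm; apply: meas_mxB => //; exact: meas_mx_cst.
have h1 : \int[ZZ]_v (N1 v)%:E <= ((2 + 2 * (beta * sigma2) ^+ 2) * (L * x) ^+ 2)%:E.
  apply: (integral_prod_ge0 (measurable_funX 2 (meas_preS z1)) (meas_dg z1 z2 2)) => //.
  - by move=> s; rewrite exprn_ge0.
  - by move=> s; rewrite exprn_ge0// fnorm_ge0.
  - by rewrite exprn_ge0// mulr_ge0.
  - exact: preS_moment2.
  - apply: moment2_of_moment3; [|by move=> s; exact: fnorm_ge0|by rewrite mulr_ge0|exact: gradF_lipschitz3].
    by apply: measurable_fnorm; exact: meas_mxB.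
have hP : \int[Z]_s (fnorm (P *m gF z2 s)%R ^+ 2)%:E <= (2 * a z2 ^+ 2 + 2 * sigma1 ^+ 2)%:E.
  apply: (@integral_le_affine _ _ _ Z (fun s => fnorm (P *m gF z2 s)%R ^+ 2)%R (fun s => fnorm (gF z2 s - g z2)%R ^+ 2)%R) => //.
  - exact: measurable_funX.
  - by move=> s; rewrite exprn_ge0// fnorm_ge0.
  - exact: measurable_funX.
  - by move=> s; rewrite exprn_ge0// fnorm_ge0.
  - apply: moment2_of_moment3 => //; [by move=> s; exact: fnorm_ge0|exact: sigma1_ge0|].
    exact: gradF_moment3.
  move=> s; rewrite (le_trans _ (squareD_le _ _))// pow_le ?fnorm_ge0//.
  rewrite fnorm_grad_y (le_trans (ler_distfnorm _ (P *m g z2)))// lerD2l -mulmxBr.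
  exact: fnorm_projP_le.
have h2 : \int[ZZ]_v (N2 v)%:E <= ((rho * x) ^+ 2 * (2 * a z2 ^+ 2 + 2 * sigma1 ^+ 2))%:E.
  apply: (integral_prod_ge0 (meas_dH z1 z2 2) (measurable_funX 2 mPg)) => //.
  - by move=> s; rewrite exprn_ge0// fnorm_ge0.
  - by move=> s; rewrite exprn_ge0// fnorm_ge0.
  - by rewrite addr_ge0// mulr_ge0// sqr_ge0.
  - apply: moment2_of_moment3 => //; [|by move=> s; exact: fnorm_ge0|exact: hessF_lipschitz3].
    by apply: measurable_fnorm; exact: meas_mxB.
apply: (le_trans (@integral_le_lin2 _ _ _ ZZ _ N1 N2 2 (2 * beta ^+ 2) _ _
    _ _ _ _ _ _ _ _ h1 h2 _)).
- apply: measurable_funX; apply: measurable_fnorm; apply: meas_mxB.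
    exact: has_mean_meas (mean_sample_g z1).
  exact: has_mean_meas (mean_sample_g z2).
- by move=> v; rewrite exprn_ge0// fnorm_ge0.
- exact: meas_prod (measurable_funX 2 (meas_preS z1)) (meas_dg z1 z2 2).
- by move=> v; rewrite mulr_ge0// exprn_ge0// ?fnorm_ge0.
- by [].
- exact: meas_prod (meas_dH z1 z2 2) (measurable_funX 2 mPg).
- by move=> v; rewrite mulr_ge0// exprn_ge0// ?fnorm_ge0.
- by rewrite mulr_ge0// exprn_ge0.
- move=> v; apply: (@le_trans _ _ ((preS z1 v.1 * fnorm (gF z1 v.2 - gF z2 v.2)
      + beta * (fnorm (HF z1 v.1 - HF z2 v.1) * fnorm (P *m gF z2 v.2))) ^+ 2)%R).
    by rewrite pow_le ?fnorm_ge0//; exact: precond_incr.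
  rewrite (le_trans (squareD_le _ _))// lerD ?exprMn// le_eqVlt; apply/orP; left.
  by apply/eqP; rewrite /N2; ring.
rewrite lee_fin.
have -> : ((2 * x * Num.sqrt k2) ^+ 2 = 4 * x ^+ 2 * k2)%R.
  by rewrite -{2}s2; move: (Num.sqrt k2) => r; ring.
have -> : (2 * ((2 + 2 * (beta * sigma2) ^+ 2) * (L * x) ^+ 2)
    + 2 * beta ^+ 2 * ((rho * x) ^+ 2 * (2 * a z2 ^+ 2 + 2 * sigma1 ^+ 2)) =
  4 * x ^+ 2 * (L ^+ 2 * (1 + (beta * sigma2) ^+ 2)
    + beta ^+ 2 * rho ^+ 2 * (sigma1 ^+ 2 + a z2 ^+ 2)))%R by ring.
rewrite ler_wpM2l ?mulr_ge0 ?exprn_ge0// /k2 lerD2r ler_wpM2l ?sqr_ge0//.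
by move: (beta * sigma2)%R bs0 => y y0; lra.
Qed.

Lemma mean_grad_y z : has_mean ZZ (fun v => grad_y (F^~ v.1) z) (grad_y f z).
Proof.
have := has_mean_fst (has_mean_gF z) => hg i j; have [h1 h2] := hg (rshift n i) j.
have E (phi : 'cV[R]_(n + m) -> R) : grad_y phi z i j = grad phi z (rshift n i) j.
  by rewrite /grad_y mxE.
by split; [under eq_fun do rewrite E|under eq_integral do rewrite E; rewrite E].
Qed.

Lemma grad_y_moment z :
  \int[ZZ]_v (fnorm (grad_y (F^~ v.1) z - grad_y f z)%R ^+ 3)%:E <= (sigma1 ^+ 3)%:E.
Proof.
have mdg : measurable_fun setT (fun s => fnorm (gF z s - g z)%R ^+ 3)%R.
  by apply: measurable_funX; apply: measurable_fnorm; apply: meas_mxB => //; exact: meas_mx_cst.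
apply: (le_trans _ (integral_fst_le mdg (fun s => fpow_ge0 (fun s => gF z s - g z)%R 3 s) (gradF_moment3 z))).
apply: ge0_le_integral => //.
- by move=> v _; rewrite lee_fin exprn_ge0// fnorm_ge0.
- apply/measurable_EFinP; apply: measurable_funX; apply: measurable_fnorm.
  apply: meas_mxB; [exact: has_mean_meas (mean_grad_y z)|exact: meas_mx_cst].
- apply/measurable_EFinP; exact: (measurableT_comp mdg measurable_fst).
move=> v _; rewrite lee_fin pow_le ?fnorm_ge0// -linearB -fnorm_projP.
exact: fnorm_projP_le.
Qed.

End Estimators.

(** * Errors of the estimators along a run *)

(** Measurability for the past is kept in the future. *)
Lemma measurable_sub_sigma {d d' : measure_display} {Om : measurableType d}
    {Y : measurableType d'} (G G' : set (set Om)) (f : Om -> Y) : G `<=` <<s G' >> ->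
  measurable_fun setT (f : g_sigma_algebraType G -> Y) ->
  measurable_fun setT (f : g_sigma_algebraType G' -> Y).
Proof.
move=> GG mf _ B mB; have := mf measurableT B mB.
by apply: (smallest_sub _ _) => //; exact: smallest_sigma_algebra.
Qed.

Lemma avg_sub {R : realType} {q r : nat} (N : nat) (A : nat -> 'M[R]_(q, r)) M : (0 < N)%N ->
  N%:R^-1 *: (\sum_(i < N) A i) - M = N%:R^-1 *: \sum_(i < N) (A i - M).
Proof.
move=> N0; rewrite sumrB scalerBr; congr (_ - _).
by rewrite sumr_const card_ord -(scaler_nat _ M) scalerA mulVf ?scale1r// pnatr_eq0 -lt0n.
Qed.

(** Unfolds the recursion of a cycle: the noise of an iteration becomes a constant
    [v1] to be borne by the potential of the preceding one, and so on back to
    the start of the cycle. *)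
Lemma cycle_bound {R : realType} (I : nat -> R -> \bar R) (B : R -> \bar R) (S K : nat)
    (v0 v1 : R) : (0 < S)%N -> 0 <= v1 ->
  (forall k (s : R), (k < K)%N -> 0 <= s -> (S %| k)%N -> (I k s <= B (s + v0)%R)%E) ->
  (forall k (s : R), (k < K)%N -> 0 <= s -> ~~ (S %| k)%N -> (I k s <= I k.-1 (s + v1)%R)%E) ->
  forall k (s : R), (k < K)%N -> 0 <= s -> (I k s <= B (s + (k %% S)%:R * v1 + v0)%R)%E.
Proof.
move=> S0 v10 start carry k; elim: k => [|k IH] s kK s0.
  by rewrite mod0n mul0r addr0 start// dvdn0.
have [Sk|Sk] := boolP (S %| k.+1)%N.
  by rewrite (eqP Sk) mul0r addr0 start.
rewrite modnS (negbTE Sk) -natr1 mulrDl mul1r (addrC _ v1) addrA.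
exact: le_trans (carry k.+1 s kK s0 Sk) (IH _ (ltnW kK) (addr_ge0 s0 v10)).
Qed.

Lemma augnorm_le {R : realType} {q r : nat} (s s' : R) (y : 'M[R]_(q, r)) :
  s <= s' -> augnorm s y <= augnorm s' y.
Proof. by move=> ss; rewrite /augnorm ler_wsqrtr// lerD2l. Qed.

Section Run.
Context {R : realType} {n m : nat} {d : measure_display} {U : measurableType d}
  (Z : probability U R) (mu L rho sigma1 sigma2 : R)
  (f : 'cV[R]_(n + m) -> R) (F : 'cV[R]_(n + m) -> U -> R).
Hypothesis fA : deterministic_assumptions mu L rho f.
Hypothesis sA : stochastic_assumptions Z L rho sigma1 sigma2 f F.
Variables (beta Delta0 eps : R) (z0 : 'cV[R]_(n + m)) (Sg Sh T : nat).
Hypothesis beta_gt : mu^-1 < beta.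
Hypothesis Delta0_gt0 : 0 < Delta0.
Hypothesis eps_gt0 : 0 < eps.
Hypothesis Sg_gt0 : (0 < Sg)%N.
Hypothesis Sh_gt0 : (0 < Sh)%N.
Context {d' : measure_display} {Om : measurableType d'} (P : probability Om R)
  (X : process R n m U Om).
Hypothesis run : sacqrn_run Z F mu L rho sigma1 sigma2 beta Delta0 eps z0 Sg Sh T P X.

Local Notation zk k := (iterate X k).
Local Notation OmG k := (g_sigma_algebraType (past X k)).
Local Notation h := (h_ beta f).
Local Notation Hb := (Hbar f beta).
Local Notation a z := (enorm (grad_y f z)).
Local Notation c := (cst_c L rho beta).
Local Notation smp := (sample X).

Lemma past_le j k : (j <= k)%N -> past X j `<=` past X k.
Proof.
move=> /subnK <-; elim: (k - j)%N => // i IH.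
by rewrite addSn; apply: (subset_trans IH); exact: (past_incr run).
Qed.

Let past_leS j k : (j <= k)%N -> past X j `<=` <<s past X k >>.
Proof. by move=> jk A Aj; apply: sub_sigma_algebra; exact: past_le Aj. Qed.

Let past_meas k : past X k `<=` measurable.
Proof. exact: (past_measurable run). Qed.

Let measurable_past_Om d2 (Y : measurableType d2) k (g : Om -> Y) :
  measurable_fun setT (g : OmG k -> Y) -> measurable_fun setT g.
Proof.
by move=> mg; exact: (measurableT_comp mg (measurable_id_sub (@past_meas k))).
Qed.

Lemma measurable_sample k b i : (k < T)%N ->
  measurable_fun setT (smp k b i : OmG k.+1 -> U).
Proof.
move=> kT _ B mB; rewrite setTI; apply: sub_sigma_algebra.
exact: (sample_adapted run).
Qed.

Let measurable_sample_Om k b i : (k < T)%N -> measurable_fun setT (smp k b i).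
Proof. by move=> kT; apply: measurable_past_Om; exact: measurable_sample. Qed.

Lemma adapted_step k : (k < T)%N -> meas_mx (step X k : OmG k.+1 -> _).
Proof.
move=> kT i j _ B mB; rewrite setTI (ord1 j); apply: sub_sigma_algebra.
exact: (step_adapted run).
Qed.

Lemma adapted_iterate k : (k <= T)%N -> meas_mx (zk k : OmG k -> _).
Proof.
elim: k => [_|k IH kT].
  have -> : zk 0 = fun=> z0 by apply/funext => w; exact: (iterate0 run).
  exact: meas_mx_cst.
have -> : zk k.+1 = fun w => zk k w + step X k w.
  by apply/funext => w; exact: (iterateS run).
apply: meas_mxD; last exact: adapted_step.
by move=> i j; apply: measurable_sub_sigma (IH (ltnW kT) i j); exact: past_leS.
Qed.

Let adapted_prev k : (k <= T)%N -> meas_mx (zk k.-1 : OmG k -> _).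
Proof.
move=> kT i j; apply: measurable_sub_sigma (adapted_iterate (leq_trans (leq_pred _) kT) i j).
by apply: past_leS; exact: leq_pred.
Qed.

Let fresh_all k M (A : batch -> nat -> set U) E : (k < T)%N ->
  (forall b i, measurable (A b i)) -> past X k E ->
  P (E `&` [set w | forall b i, (i < M)%N -> A b i (smp k b i w)])
  = (P E * (\prod_(b <- batches) \prod_(i < M) fine (Z (A b i)))%:E)%E.
Proof.
move=> kT mA EE.
have mE : measurable E by exact: (past_measurable run) EE.
have mI : measurable (E `&` [set w | forall b i, (i < M)%N -> A b i (smp k b i w)]).
  apply: measurableI => //.
  have mb b : measurable [set w | forall i, (i < M)%N -> A b i (smp k b i w)].
    have -> : [set w | forall i, (i < M)%N -> A b i (smp k b i w)] =
       \bigcap_(i in `I_M) (smp k b i @^-1` A b i) by [].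
    apply: bigcap_measurableType => i _; rewrite -[X in measurable X]setTI.
    exact: measurable_sample_Om.
  have -> : [set w | forall b i, (i < M)%N -> A b i (smp k b i w)] =
     \bigcap_(l in `I_5) [set w | forall i, (i < M)%N ->
       A (nth Bg1 batches l) i (smp k (nth Bg1 batches l) i w)].
    apply/seteqP; split => w; first by move=> hw l _ i; exact: hw.
    by move=> hw []; [exact: hw 0%N _|exact: hw 1%N _|exact: hw 2%N _|exact: hw 3%N _|exact: hw 4%N _].
  by apply: bigcap_measurableType => l _; exact: mb.
have := sample_fresh run M kT mA EE.
by move=> eq; rewrite -[LHS]fineK ?fin_num_measure// eq EFinM fineK// fin_num_measure.
Qed.

Let prod_setT M : \prod_(i < M) fine (Z setT) = 1.
Proof. by rewrite big1// => i _; rewrite probability_setT. Qed.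

Definition fresh_pair k b1 b2 := forall M (A1 A2 : nat -> set U) E,
  (forall i, measurable (A1 i)) -> (forall i, measurable (A2 i)) -> past X k E ->
  P (E `&` cylinder (smp k b1) (smp k b2) A1 A2 M)
  = (P E * (\prod_(i < M) (fine (Z (A1 i)) * fine (Z (A2 i))))%:E)%E.

Lemma fresh_g k : (k < T)%N -> fresh_pair k Bg1 Bg2.
Proof.
move=> kT M A1 A2 E m1 m2 EE.
pose A b := match b with Bg1 => A1 | Bg2 => A2 | _ => fun=> setT end.
have mA b i : measurable (A b i) by case: b => /=; do ?[exact: m1|exact: m2|exact: measurableT].
have := fresh_all M kT mA EE.
rewrite !big_cons big_nil /= !prod_setT !mulr1 -big_split/= => <-.
congr (P (_ `&` _)); apply/seteqP; split => w hw.
  by case=> i iM //=; have [] := hw i iM.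
by move=> i iM; split; [exact: (hw Bg1)|exact: (hw Bg2)].
Qed.

Lemma fresh_h k : (k < T)%N -> fresh_pair k Bh1 Bh2.
Proof.
move=> kT M A1 A2 E m1 m2 EE.
pose A b := match b with Bh1 => A1 | Bh2 => A2 | _ => fun=> setT end.
have mA b i : measurable (A b i) by case: b => /=; do ?[exact: m1|exact: m2|exact: measurableT].
have := fresh_all M kT mA EE.
rewrite !big_cons big_nil /= !prod_setT !mulr1 !mul1r -big_split/= => <-.
congr (P (_ `&` _)); apply/seteqP; split => w hw.
  by case=> i iM //=; have [] := hw i iM.
by move=> i iM; split; [exact: (hw Bh1)|exact: (hw Bh2)].
Qed.

(** The batch [Bgy] is paired with an arbitrary other one, to be treated like the
    estimators that use two batches. *)
Lemma fresh_y k : (k < T)%N -> fresh_pair k Bgy Bg1.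
Proof.
move=> kT M A1 A2 E m1 m2 EE.
pose A b := match b with Bgy => A1 | Bg1 => A2 | _ => fun=> setT end.
have mA b i : measurable (A b i) by case: b => /=; do ?[exact: m1|exact: m2|exact: measurableT].
have := fresh_all M kT mA EE.
rewrite !big_cons big_nil /= !prod_setT !mulr1 !mul1r mulrC -big_split/= => <-.
congr (P (_ `&` _)); apply/seteqP; split => w hw.
  by case=> i iM //=; have [] := hw i iM.
by move=> i iM; split; [exact: (hw Bgy)|exact: (hw Bg1)].
Qed.

Lemma meas_sample_g d2 (V : measurableType d2) (z : V -> 'cV[R]_(n + m)) (v1 v2 : V -> U) :
  meas_mx z -> measurable_fun setT v1 -> measurable_fun setT v2 ->
  meas_mx (fun t => sample_g F beta (z t) (v1 t, v2 t)).
Proof.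
move=> mz m1 m2; apply: meas_mxM.
  apply: meas_mxD; first exact: meas_mx_cst.
  apply: meas_mxZ; first exact: measurable_cst.
  apply: meas_mxM; last exact: meas_mx_cst.
  exact: (meas_hess (F_measurable sA) (F_diff sA)).
exact: (meas_grad (F_measurable sA) (F_diff sA)).
Qed.

Lemma meas_sample_H d2 (V : measurableType d2) (z : V -> 'cV[R]_(n + m)) (v1 v2 : V -> U) :
  meas_mx z -> measurable_fun setT v1 -> measurable_fun setT v2 ->
  meas_mx (fun t => sample_H F beta (z t) (v1 t, v2 t)).
Proof.
move=> mz m1 m2; apply: meas_mxZ; first exact: measurable_cst.
set A := fun t => precond beta F (v1 t) (z t) *m hess (F^~ (v2 t)) (z t).
have mA : meas_mx A.
  apply: meas_mxM; last exact: (meas_hess (F_measurable sA) (F_diff sA)).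
  apply: meas_mxD; first exact: meas_mx_cst.
  apply: meas_mxZ; first exact: measurable_cst.
  apply: meas_mxM; last exact: meas_mx_cst.
  exact: (meas_hess (F_measurable sA) (F_diff sA)).
by apply: meas_mxD => //; exact: (meas_mx_tr mA).
Qed.

Definition err_g k (w : Om) : 'cV[R]_(n + m) := iter_g X k w - grad h (zk k w).
Definition err_H k (w : Om) : 'M[R]_(n + m) := iter_H X k w - Hb (zk k w).
Definition err_y k (w : Om) : 'cV[R]_m := iter_gy X k w - grad_y f (zk k w).

(** The noise that one sample adds, as a function of the past and of the sample. *)
Definition sample_err_g k (x : OmG k * (U * U)) : 'cV[R]_(n + m) :=
  if (Sg %| k)%N then sample_g F beta (zk k x.1) x.2 - grad h (zk k x.1)
  else sample_g F beta (zk k x.1) x.2 - sample_g F beta (zk k.-1 x.1) x.2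
    - (grad h (zk k x.1) - grad h (zk k.-1 x.1)).

Definition sample_err_H k (x : OmG k * (U * U)) : 'M[R]_(n + m) :=
  if (Sh %| k)%N then sample_H F beta (zk k x.1) x.2 - Hb (zk k x.1)
  else sample_H F beta (zk k x.1) x.2 - sample_H F beta (zk k.-1 x.1) x.2
    - (Hb (zk k x.1) - Hb (zk k.-1 x.1)).

Definition sample_err_y k (x : OmG k * (U * U)) : 'cV[R]_m :=
  grad_y (F^~ x.2.1) (zk k x.1) - grad_y f (zk k x.1).

(** At the start of a cycle nothing is inherited. *)
Definition carry {q r} (S : nat) (e : nat -> Om -> 'M[R]_(q, r)) k w :=
  if (S %| k)%N then 0 else e k.-1 w.

Lemma Q_estE N b1 b2 z : Q_est beta F N b1 b2 z =
  N%:R^-1 *: \sum_(i < N) sample_g F beta z (b1 i, b2 i).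
Proof. by []. Qed.

Lemma W_estE N b1 b2 z : W_est beta F N b1 b2 z =
  N%:R^-1 *: \sum_(i < N) sample_H F beta z (b1 i, b2 i).
Proof.
rewrite /W_est /sample_H /symm -scaler_sumr scalerA mulrC -scalerA.
by congr (_ *: _); rewrite linearZ/= -scalerDr linear_sum/= -big_split.
Qed.

Let regroup q r (A1 A2 A3 A4 A5 : 'M[R]_(q, r)) :
  A1 - A2 + A3 - A4 = A3 - A5 + (A1 - A2 - (A4 - A5)).
Proof. by apply/matrixP => i j; rewrite !mxE; ring. Qed.

(** Given the past, the recursive estimate is unbiased up to the error inherited
    from the previous iteration, and the rest is an average of centered noise. *)
Lemma err_gE k w : (k < T)%N -> err_g k w = batch_sum (smp k Bg1) (smp k Bg2)
  (size_g X k) (carry Sg err_g k : OmG k -> _) (@sample_err_g k) w.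
Proof.
move=> kT; have [N0 _ _] := size_gt0 run w kT.
rewrite /err_g (iter_gE run w kT) /batch_sum /carry /sample_err_g.
pose s z i := sample_g F beta z (smp k Bg1 i w, smp k Bg2 i w).
have E z : Q_est beta F (size_g X k w) (fun i => smp k Bg1 i w) (fun i => smp k Bg2 i w) z =
  (size_g X k w)%:R^-1 *: \sum_(i < size_g X k w) s z i := Q_estE _ _ _ _.
rewrite !E; case: ifP => _; first by rewrite add0r; exact: (avg_sub (s (zk k w)) _ N0).
have <- := avg_sub (fun i => s (zk k w) i - s (zk k.-1 w) i) (grad h (zk k w) - grad h (zk k.-1 w)) N0.
rewrite sumrB scalerBr.
exact: regroup.
Qed.

Lemma err_HE k w : (k < T)%N -> err_H k w = batch_sum (smp k Bh1) (smp k Bh2)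
  (size_h X k) (carry Sh err_H k : OmG k -> _) (@sample_err_H k) w.
Proof.
move=> kT; have [_ N0 _] := size_gt0 run w kT.
rewrite /err_H (iter_HE run w kT) /batch_sum /carry /sample_err_H.
pose s z i := sample_H F beta z (smp k Bh1 i w, smp k Bh2 i w).
have E z : W_est beta F (size_h X k w) (fun i => smp k Bh1 i w) (fun i => smp k Bh2 i w) z =
  (size_h X k w)%:R^-1 *: \sum_(i < size_h X k w) s z i := W_estE _ _ _ _.
rewrite !E; case: ifP => _; first by rewrite add0r; exact: (avg_sub (s (zk k w)) _ N0).
have <- := avg_sub (fun i => s (zk k w) i - s (zk k.-1 w) i) (Hb (zk k w) - Hb (zk k.-1 w)) N0.
rewrite sumrB scalerBr.
exact: regroup.
Qed.

Lemma err_yE k w : (k < T)%N -> err_y k w = batch_sum (smp k Bgy) (smp k Bg1)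
  (size_gy X k) ((fun=> 0) : OmG k -> _) (@sample_err_y k) w.
Proof.
move=> kT; have [_ _ N0] := size_gt0 run w kT.
rewrite /err_y (iter_gyE run w kT) /batch_sum add0r /sample_err_y.
exact: (avg_sub (fun i => grad_y (F^~ (smp k Bgy i w)) (zk k w)) _ N0).
Qed.

Lemma meas_carry q r S (e : nat -> Om -> 'M[R]_(q, r)) k :
  (forall j, (j < k)%N -> meas_mx (e j : OmG j.+1 -> _)) ->
  meas_mx (carry S e k : OmG k -> _).
Proof.
move=> me; rewrite /carry; have [Sk|Sk] := boolP (S %| k)%N; first exact: meas_mx_cst.
by case: k Sk me => [|k] Sk me; [rewrite dvdn0 in Sk|exact: me].
Qed.

Let iterate_fst k : (k <= T)%N ->
  meas_mx (fun x : (OmG k * (U * U))%type => zk k x.1).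
Proof. by move=> kT i j; exact: (measurableT_comp (adapted_iterate kT i j) measurable_fst). Qed.

Let prev_fst k : (k <= T)%N ->
  meas_mx (fun x : (OmG k * (U * U))%type => zk k.-1 x.1).
Proof. by move=> kT i j; exact: (measurableT_comp (adapted_prev kT i j) measurable_fst). Qed.

Let m21 k : measurable_fun setT (fun x : (OmG k * (U * U))%type => x.2.1).
Proof. exact: (measurableT_comp measurable_fst measurable_snd). Qed.

Let m22 k : measurable_fun setT (fun x : (OmG k * (U * U))%type => x.2.2).
Proof. exact: (measurableT_comp measurable_snd measurable_snd). Qed.

Let sample_gP k (x : (OmG k * (U * U))%type) z :
  sample_g F beta z x.2 = sample_g F beta z (x.2.1, x.2.2).
Proof. by case: x => w []. Qed.

Let sample_HP k (x : (OmG k * (U * U))%type) z :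
  sample_H F beta z x.2 = sample_H F beta z (x.2.1, x.2.2).
Proof. by case: x => w []. Qed.

Lemma meas_sample_err_g k : (k <= T)%N -> meas_mx (@sample_err_g k).
Proof.
move=> kT; have cg := meas_mx_continuous (cont_grad_h fA (beta := beta)).
rewrite /sample_err_g; have [_|_] := boolP (Sg %| k)%N.
  under eq_fun do rewrite sample_gP.
  apply: meas_mxB; first exact: meas_sample_g (iterate_fst kT) (@m21 k) (@m22 k).
  exact: cg (iterate_fst kT).
under eq_fun do rewrite !sample_gP.
apply: meas_mxB; apply: meas_mxB.
- exact: meas_sample_g (iterate_fst kT) (@m21 k) (@m22 k).
- exact: meas_sample_g (prev_fst kT) (@m21 k) (@m22 k).
- exact: cg (iterate_fst kT).
- exact: cg (prev_fst kT).
Qed.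

Lemma meas_sample_err_H k : (k <= T)%N -> meas_mx (@sample_err_H k).
Proof.
move=> kT; have cg := meas_mx_continuous (cont_Hbar fA (beta := beta)).
rewrite /sample_err_H; have [_|_] := boolP (Sh %| k)%N.
  under eq_fun do rewrite sample_HP.
  apply: meas_mxB; first exact: meas_sample_H (iterate_fst kT) (@m21 k) (@m22 k).
  exact: cg (iterate_fst kT).
under eq_fun do rewrite !sample_HP.
apply: meas_mxB; apply: meas_mxB.
- exact: meas_sample_H (iterate_fst kT) (@m21 k) (@m22 k).
- exact: meas_sample_H (prev_fst kT) (@m21 k) (@m22 k).
- exact: cg (iterate_fst kT).
- exact: cg (prev_fst kT).
Qed.

Lemma meas_sample_err_y k : (k <= T)%N -> meas_mx (@sample_err_y k).
Proof.
move=> kT; apply: meas_mxB.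
  have mg := meas_grad (F_measurable sA) (F_diff sA) (iterate_fst kT) (@m21 k).
  by move=> i j; under eq_fun do rewrite mxE; exact: mg.
have mg := meas_mx_continuous (cont_g fA) (iterate_fst kT).
by move=> i j; under eq_fun do rewrite mxE; exact: mg.
Qed.

Let id_past k : measurable_fun setT (id : OmG k.+1 -> OmG k).
Proof. by apply: (measurable_sub_sigma (past_leS (leqnSn k))); exact: measurable_id. Qed.

Lemma meas_err_g k : (k < T)%N -> meas_mx (err_g k : OmG k.+1 -> _).
Proof.
elim/ltn_ind: k => k IH kT.
have -> : err_g k = batch_sum (smp k Bg1) (smp k Bg2)
  (size_g X k) (carry Sg err_g k : OmG k -> _) (@sample_err_g k).
  by apply/funext => w; exact: err_gE.
apply: (measurable_batch_sum _ _ _ (f := id)) => //.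
- by move=> l; exact: (size_g_past run).
- by apply: meas_carry => j jk; apply: IH => //; exact: ltn_trans kT.
- exact: meas_sample_err_g (ltnW kT).
- by move=> i; exact: measurable_sample.
- by move=> i; exact: measurable_sample.
Qed.

Lemma meas_err_H k : (k < T)%N -> meas_mx (err_H k : OmG k.+1 -> _).
Proof.
elim/ltn_ind: k => k IH kT.
have -> : err_H k = batch_sum (smp k Bh1) (smp k Bh2)
  (size_h X k) (carry Sh err_H k : OmG k -> _) (@sample_err_H k).
  by apply/funext => w; exact: err_HE.
apply: (measurable_batch_sum _ _ _ (f := id)) => //.
- by move=> l; exact: (size_h_past run).
- by apply: meas_carry => j jk; apply: IH => //; exact: ltn_trans kT.
- exact: meas_sample_err_H (ltnW kT).
- by move=> i; exact: measurable_sample.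
- by move=> i; exact: measurable_sample.
Qed.

Lemma meas_err_y k : (k < T)%N -> meas_mx (err_y k : OmG k.+1 -> _).
Proof.
move=> kT; have -> : err_y k = batch_sum (smp k Bgy) (smp k Bg1)
  (size_gy X k) ((fun=> 0) : OmG k -> _) (@sample_err_y k).
  by apply/funext => w; exact: err_yE.
apply: (measurable_batch_sum _ _ _ (f := id)) => //.
- by move=> l; exact: (size_gy_past run).
- exact: meas_sample_err_y (ltnW kT).
- by move=> i; exact: measurable_sample.
- by move=> i; exact: measurable_sample.
Qed.

Local Notation c3 := (cst_c3 L sigma2 beta).
Local Notation Rd := (R_Delta mu beta Delta0).
Let c_gt0 : 0 < c := cst_c_gt0 fA beta_gt.
Let beta0 : 0 <= beta := ltW (beta_gt0 fA beta_gt).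
Let L0 : 0 <= L := ltW (L_gt0 fA).
Let rho0 : 0 <= rho := ltW (rho_gt0 fA).
Let s10 : 0 <= sigma1 := sigma1_ge0 sA.
Let s20 : 0 <= sigma2 := sigma2_ge0 sA.
Let c30 : 0 <= c3.
Proof. by rewrite /cst_c3 addr_ge0// mulr_ge0// addr_ge0. Qed.

Lemma step_iterate k w : (0 < k < T)%N -> zk k w - zk k.-1 w = step X k.-1 w.
Proof.
case: k => // k /andP[_ kT] /=.
by rewrite (iterateS run)// ?(ltnW kT)// addrC addKr.
Qed.

(** The price of one sample in [batch_potential]; divided by the size of the
    batch, the price of the iteration. *)
Definition credit_H k (w : Om) : R :=
  if (Sh %| k)%N then 3 * (4 * (c3 * sigma2)) ^+ 2
  else 3 * (6 * (c3 * rho * fnorm (zk k w - zk k.-1 w))) ^+ 2.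

Definition credit_g k (w : Om) : R :=
  if (Sg %| k)%N then
    8 * ((1 + beta * sigma2) ^+ 2 * sigma1 ^+ 2 + beta ^+ 2 * sigma2 ^+ 2 * a (zk k w) ^+ 2)
  else 16 * fnorm (zk k w - zk k.-1 w) ^+ 2 * (L ^+ 2 * (1 + beta * sigma2) ^+ 2
         + beta ^+ 2 * rho ^+ 2 * (sigma1 ^+ 2 + a (zk k.-1 w) ^+ 2)).

Let credit_H_ge0 k w : 0 <= credit_H k w.
Proof. by rewrite /credit_H; case: ifP => _; rewrite mulr_ge0// sqr_ge0. Qed.

Let credit_g_ge0 k w : 0 <= credit_g k w.
Proof.
rewrite /credit_g; case: ifP => _.
  rewrite mulr_ge0// addr_ge0//; first exact: mulr_ge0 (sqr_ge0 _) (sqr_ge0 _).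
  exact: mulr_ge0 (mulr_ge0 (sqr_ge0 _) (sqr_ge0 _)) (sqr_ge0 _).
apply: mulr_ge0; first by rewrite mulr_ge0// sqr_ge0.
apply: addr_ge0; first exact: mulr_ge0 (sqr_ge0 _) (sqr_ge0 _).
exact: mulr_ge0 (mulr_ge0 (sqr_ge0 _) (sqr_ge0 _)) (addr_ge0 (sqr_ge0 _) (sqr_ge0 _)).
Qed.

Let meas_inc k : (k <= T)%N ->
  measurable_fun setT (fun w : OmG k => fnorm (zk k w - zk k.-1 w)).
Proof.
by move=> kT; apply: measurable_fnorm; apply: meas_mxB; [exact: adapted_iterate|exact: adapted_prev].
Qed.

Let meas_a d2 (V : measurableType d2) (z : V -> 'cV[R]_(n + m)) : meas_mx z ->
  measurable_fun setT (fun w => a (z w)).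
Proof. by move=> mz; exact: (measurable_continuous (continuous_grad_y fA) mz). Qed.

Let meas_credit_H k : (k <= T)%N -> measurable_fun setT (credit_H k : OmG k -> R).
Proof.
move=> kT; rewrite /credit_H; have [_|_] := boolP (Sh %| k)%N; first exact: measurable_cst.
apply: measurable_funM => //; apply: measurable_funX; apply: measurable_funM => //.
by apply: measurable_funM => //; exact: meas_inc.
Qed.

Let meas_credit_g k : (k <= T)%N -> measurable_fun setT (credit_g k : OmG k -> R).
Proof.
move=> kT; rewrite /credit_g; have [_|_] := boolP (Sg %| k)%N.
  apply: measurable_funM => //; apply: measurable_funD => //; apply: measurable_funM => //.
  by apply: measurable_funX; apply: meas_a; exact: adapted_iterate.
apply: measurable_funM => //.
  by apply: measurable_funM => //; apply: measurable_funX; exact: meas_inc.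
apply: measurable_funD => //; apply: measurable_funM => //; apply: measurable_funD => //.
by apply: measurable_funX; apply: meas_a; exact: adapted_prev.
Qed.

Let meas_prev_err_g k : (k < T)%N -> meas_mx (carry Sg err_g k : OmG k -> _).
Proof. by move=> kT; apply: meas_carry => j jk; apply: meas_err_g; exact: ltn_trans kT. Qed.

Let meas_prev_err_H k : (k < T)%N -> meas_mx (carry Sh err_H k : OmG k -> _).
Proof. by move=> kT; apply: meas_carry => j jk; apply: meas_err_H; exact: ltn_trans kT. Qed.

Let meas_pot2 q r d0 (V : measurableType d0) (s : V -> R) (y : V -> 'M[R]_(q, r)) :
  measurable_fun setT s -> meas_mx y -> measurable_fun setT (fun t => fnorm (y t) ^+ 2 + s t).
Proof.
by move=> ms my; apply: measurable_funD => //; apply: measurable_funX; exact: measurable_fnorm.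
Qed.

Let meas_pot3 q r d0 (V : measurableType d0) (s : V -> R) (y : V -> 'M[R]_(q, r)) :
  measurable_fun setT s -> meas_mx y -> measurable_fun setT (fun t => augnorm (s t) (y t) ^+ 3).
Proof. by move=> ms my; apply: measurable_funX; exact: measurable_augnorm. Qed.

Let ge0_pot3 q r (s : R) (y : 'M[R]_(q, r)) : 0 <= augnorm s y ^+ 3.
Proof. by rewrite exprn_ge0// augnorm_ge0. Qed.

Lemma err_H_batch k s : (k < T)%N -> 0 <= s ->
  (\int[P]_w (augnorm s (err_H k w) ^+ 3)%:E <=
   \int[P]_w (augnorm (s + credit_H k w / (size_h X k w)%:R) (carry Sh err_H k w) ^+ 3)%:E)%E.
Proof.
move=> kT s0; under eq_integral do rewrite err_HE//.
apply: (@batch_potential _ _ _ P _ _ Z (past X k) (smp k Bh1) (smp k Bh2)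
  (past_sigma_algebra run k) (@past_meas k)
  (fun i => measurable_sample_Om Bh1 i kT) (fun i => measurable_sample_Om Bh2 i kT)
  (fresh_h kT) _ _ (size_h X k) (carry Sh err_H k) (@sample_err_H k)
  _ _ (meas_prev_err_H kT) (meas_sample_err_H (ltnW kT))
  (fun s y => augnorm s y ^+ 3) (credit_H k) s) => //.
- by move=> l; exact: (size_h_past run).
- by move=> w; have [] := size_gt0 run w kT.
- exact: meas_credit_H (ltnW kT).
- by move=> d0 V ms my; exact: meas_pot3.
move=> w y s' N s'0 N0; rewrite /sample_err_H /credit_H /=; case: ifP => _.
  apply: pot_cube_step => //.
  - exact: has_mean_centered (mean_sample_H fA sA beta _).
  - by rewrite !mulr_ge0.
  - exact: (sample_H_moment fA sA beta_gt).
apply: pot_cube_step => //.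
- exact: has_mean_centered (has_meanB (mean_sample_H fA sA beta _) (mean_sample_H fA sA beta _)).
- by rewrite !mulr_ge0// fnorm_ge0.
- exact: (sample_H_increment_moment fA sA beta_gt).
Qed.

Lemma err_g_batch k s : (k < T)%N -> 0 <= s ->
  (\int[P]_w (fnorm (err_g k w) ^+ 2 + s)%:E <=
   \int[P]_w (fnorm (carry Sg err_g k w) ^+ 2 + (s + credit_g k w / (size_g X k w)%:R))%:E)%E.
Proof.
move=> kT s0; under eq_integral do rewrite err_gE//.
have credit0 w : 0 <= s + credit_g k w / (size_g X k w)%:R by rewrite addr_ge0// divr_ge0.
under [leRHS]eq_integral => w _ do rewrite -(ger0_norm (credit0 w)).
(* [batch_potential] wants a potential that is nonnegative for all [s] *)
have Es : s = `|s| by rewrite ger0_norm.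
rewrite [in leLHS]Es.
apply: (@batch_potential _ _ _ P _ _ Z (past X k) (smp k Bg1) (smp k Bg2)
  (past_sigma_algebra run k) (@past_meas k)
  (fun i => measurable_sample_Om Bg1 i kT) (fun i => measurable_sample_Om Bg2 i kT)
  (fresh_g kT) _ _ (size_g X k) (carry Sg err_g k) (@sample_err_g k)
  _ _ (meas_prev_err_g kT) (meas_sample_err_g (ltnW kT))
  (fun s y => fnorm y ^+ 2 + `|s|) (credit_g k) s) => //.
- by move=> l; exact: (size_g_past run).
- by move=> w; have [] := size_gt0 run w kT.
- exact: meas_credit_g (ltnW kT).
- by move=> ? ?; rewrite addr_ge0// sqr_ge0.
- by move=> d0 V s' y ms my; apply: meas_pot2 => //; exact: measurableT_comp.
move=> w y s' N s'0 N0; rewrite /sample_err_g !ger0_norm ?addr_ge0 ?divr_ge0//.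
rewrite /credit_g /=; case: ifP => _; apply: pot_square_step => //.
- exact: has_mean_centered (mean_sample_g fA sA beta _).
- exact: (sample_g_moment fA sA beta_gt).
- exact: has_mean_centered (has_meanB (mean_sample_g fA sA beta _) (mean_sample_g fA sA beta _)).
- exact: (sample_g_increment_moment fA sA beta_gt).
Qed.

Lemma err_y_batch k : (k < T)%N ->
  (\int[P]_w (augnorm 0 (err_y k w) ^+ 3)%:E <=
   \int[P]_w (augnorm (0 + 3 * sigma1 ^+ 2 / (size_gy X k w)%:R) (0 : 'cV[R]_m) ^+ 3)%:E)%E.
Proof.
move=> kT; under eq_integral do rewrite err_yE//.
apply: (@batch_potential _ _ _ P _ _ Z (past X k) (smp k Bgy) (smp k Bg1)
  (past_sigma_algebra run k) (@past_meas k)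
  (fun i => measurable_sample_Om Bgy i kT) (fun i => measurable_sample_Om Bg1 i kT)
  (fresh_y kT) _ _ (size_gy X k) (fun=> 0) (@sample_err_y k)
  _ _ _ (meas_sample_err_y (ltnW kT))
  (fun s y => augnorm s y ^+ 3) (fun=> 3 * sigma1 ^+ 2) 0) => //.
- by move=> l; exact: (size_gy_past run).
- by move=> w; have [] := size_gt0 run w kT.
- by move=> w; rewrite mulr_ge0// sqr_ge0.
- by move=> d0 V ms my; exact: meas_pot3.
move=> w y s' N s'0 N0; rewrite /sample_err_y /=; apply: pot_cube_step => //.
- exact: has_mean_centered (mean_grad_y sA _).
- exact: (grad_y_moment sA).
Qed.

Local Notation tau := (Num.sqrt (c * eps)).
Let ce_gt0 : 0 < c * eps := mulr_gt0 c_gt0 eps_gt0.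
Let tau_gt0 : 0 < tau. Proof. by rewrite sqrtr_gt0. Qed.
Let tau2 : tau ^+ 2 = c * eps. Proof. by rewrite sqr_sqrtr// ltW. Qed.

Let meas_inv_size (N : Om -> nat) k : (forall l, past X k [set w | N w = l]) ->
  measurable_fun setT (fun w => (N w)%:R^-1 : R).
Proof.
move=> mN; apply: (@measurable_fun_countable _ _ _ _ _ N (fun l _ => (l%:R^-1)%R : R)) => //.
by move=> l; exact: past_meas (mN l).
Qed.

Let size_h_pos k w : (k < T)%N -> 0 < (size_h X k w)%:R :> R.
Proof. by move=> kT; have [_ h0 _] := size_gt0 run w kT; rewrite ltr0n. Qed.

Let size_g_pos k w : (k < T)%N -> 0 < (size_g X k w)%:R :> R.
Proof. by move=> kT; have [h0 _ _] := size_gt0 run w kT; rewrite ltr0n. Qed.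

Let size_y_pos k w : (k < T)%N -> 0 < (size_gy X k w)%:R :> R.
Proof. by move=> kT; have [_ _ h0] := size_gt0 run w kT; rewrite ltr0n. Qed.

Let lt_truncnS (x : R) (N : nat) : 0 <= x -> ((Num.truncn x).+1 <= N)%N -> x <= N%:R.
Proof.
move=> x0 xN; have /andP[_ /ltW x1] := truncn_itv x0.
by rewrite (le_trans x1)// ler_nat.
Qed.

Lemma credit_H_start k w : (k < T)%N -> (Sh %| k)%N ->
  credit_H k w / (size_h X k w)%:R <= 2 / 27 * (c * eps).
Proof.
move=> kT Sk; have N0 := size_h_pos w kT.
have := size_h_large run w kT; rewrite Sk ler_pdivrMr// => hN.
rewrite /credit_H Sk ler_pdivrMr//; move: (size_h X k w)%:R hN => N hN.
move: hN; move: (c * eps) => ce hN.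
(* 3 * 4 ^ 2 / 648 = 2 / 27 *)
have -> : 3 * (4 * (c3 * sigma2)) ^+ 2 = 2 / 27 * (648 * sigma2 ^+ 2 * c3 ^+ 2) by field.
by rewrite -[leRHS]mulrA (mulrC ce) ler_wpM2l.
Qed.

Lemma credit_H_carry k w : (k < T)%N -> ~~ (Sh %| k)%N ->
  credit_H k w / (size_h X k w)%:R <= c * eps / (6 * Sh%:R).
Proof.
move=> kT Sk; have N0 := size_h_pos w kT.
have k0 : (0 < k)%N by case: (k) Sk; rewrite ?dvdn0.
have S0 : 0 < Sh%:R :> R by rewrite ltr0n.
have := size_h_large run w kT; rewrite (negbTE Sk) => /lt_truncnS.
have x0 : 0 <= 648 * rho ^+ 2 * c3 ^+ 2 * Sh%:R * enorm (step X k.-1 w) ^+ 2 / (c * eps).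
  apply: divr_ge0; last exact: ltW.
  apply: mulr_ge0; last exact: sqr_ge0.
  apply: mulr_ge0; last exact: ler0n.
  by apply: mulr_ge0; [apply: mulr_ge0; [exact: ler0n|exact: sqr_ge0]|exact: sqr_ge0].
move=> /(_ x0) {x0}; rewrite ler_pdivrMr// => hN.
(* 3 * 6 ^ 2 / 648 = 1 / 6 *)
rewrite /credit_H (negbTE Sk) ler_pdivrMr// step_iterate ?k0//.
rewrite [leRHS]mulrAC ler_pdivlMr ?mulr_gt0// [leRHS]mulrC.
apply: le_trans hN; rewrite le_eqVlt; apply/orP; left; apply/eqP; rewrite /enorm; ring.
Qed.

Let R2_gt0 : 0 < Rd ^+ 2.
Proof.
have g0 := gamma_gt0 fA beta_gt; have mu0 := mu_gt0 fA.
by rewrite exprn_gt0// /R_Delta mulr_gt0// sqrtr_gt0 divr_gt0// mulr_gt0.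
Qed.

(** The partial gradient is below [Rd] in mean square only, not pointwise, and
    therefore remains in the bound. *)
Lemma credit_g_start k w : (k < T)%N -> (Sg %| k)%N ->
  credit_g k w / (size_g X k w)%:R <= eps ^+ 2 / 8 * (1 + (Rd ^+ 2)^-1 * a (zk k w) ^+ 2).
Proof.
move=> kT Sk; have N0 := size_g_pos w kT; have e2 : 0 < eps ^+ 2 by rewrite exprn_gt0.
have := size_g_large run w kT; rewrite Sk ler_pdivrMr// => hN.
rewrite /credit_g Sk ler_pdivrMr//; move: (size_g X k w)%:R hN => N hN.
set x := a (zk k w) ^+ 2; have x0 : 0 <= x by exact: sqr_ge0.
have y0 : 0 <= (Rd ^+ 2)^-1 * x by rewrite mulr_ge0// invr_ge0 ltW.
have xE : x = Rd ^+ 2 * ((Rd ^+ 2)^-1 * x) by rewrite mulrA mulfV ?mul1r// gt_eqF.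
move: hN; rewrite /cst_c1; set A := _ ^+ 2 * sigma1 ^+ 2; set B := beta ^+ 2 * _.
have A0 : 0 <= A by exact: mulr_ge0 (sqr_ge0 _) (sqr_ge0 _).
have B0 : 0 <= B by exact: mulr_ge0 (sqr_ge0 _) (sqr_ge0 _).
move: (Rd ^+ 2) ((Rd ^+ 2)^-1 * x) y0 xE R2_gt0 => r y y0 -> r0 hN.
have := ler_wpM2r (addr_ge0 ler01 y0) hN.
have := mulr_ge0 A0 y0; have := mulr_ge0 B0 (ltW r0).
have -> : 64 * (A + B * r) * (1 + y) = 64 * A + 64 * (A * y) + 64 * (B * r) + 64 * (B * (r * y)) by ring.
have -> : eps ^+ 2 / 8 * (1 + y) * N = (N * eps ^+ 2 * (1 + y)) / 8 by ring.
by move: (_ * (1 + y)) => Q *; lra.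
Qed.

Lemma credit_g_carry k w : (k < T)%N -> ~~ (Sg %| k)%N ->
  credit_g k w / (size_g X k w)%:R
    <= eps ^+ 2 / (4 * Sg%:R) * (1 + (Rd ^+ 2)^-1 * a (zk k.-1 w) ^+ 2).
Proof.
move=> kT Sk; have N0 := size_g_pos w kT; have e2 : 0 < eps ^+ 2 by rewrite exprn_gt0.
have k0 : (0 < k)%N by case: (k) Sk; rewrite ?dvdn0.
have S0 : 0 < Sg%:R :> R by rewrite ltr0n.
have := size_g_large run w kT; rewrite (negbTE Sk) => /lt_truncnS.
rewrite /credit_g (negbTE Sk) step_iterate ?k0// /cst_c2 /enorm.
set x := a (zk k.-1 w) ^+ 2; have x0 : 0 <= x by exact: sqr_ge0.
have y0 : 0 <= (Rd ^+ 2)^-1 * x by rewrite mulr_ge0// invr_ge0 ltW.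
have xE : x = Rd ^+ 2 * ((Rd ^+ 2)^-1 * x) by rewrite mulrA mulfV ?mul1r// gt_eqF.
set t := fnorm _ ^+ 2; have t0 : 0 <= t by exact: sqr_ge0.
set A := L ^+ 2 * _; set B := beta ^+ 2 * _; set s := sigma1 ^+ 2.
have s0 : 0 <= s by exact: sqr_ge0.
have A0 : 0 <= A by exact: mulr_ge0 (sqr_ge0 _) (sqr_ge0 _).
have B0 : 0 <= B by exact: mulr_ge0 (sqr_ge0 _) (sqr_ge0 _).
move: (Rd ^+ 2) ((Rd ^+ 2)^-1 * x) y0 xE R2_gt0 => r y y0 -> r0.
have c20 : 0 <= A + B * (s + r) by rewrite addr_ge0// mulr_ge0// addr_ge0// ltW.
have q0 : 0 <= 64 * (A + B * (s + r)) * Sg%:R * t / eps ^+ 2.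
  apply: divr_ge0; last exact: ltW.
  by apply: mulr_ge0 => //; apply: mulr_ge0; [exact: mulr_ge0|exact: ltW].
move=> /(_ q0).
rewrite ler_pdivrMr// => hN; rewrite ler_pdivrMr//.
have -> : eps ^+ 2 / (4 * Sg%:R) * (1 + y) * (size_g X k w)%:R =
   (size_g X k w)%:R * eps ^+ 2 * (1 + y) / (4 * Sg%:R) by field; rewrite gt_eqF.
rewrite ler_pdivlMr ?mulr_gt0//; apply: le_trans (ler_wpM2r (addr_ge0 ler01 y0) hN).
have -> : 16 * t * (A + B * (s + r * y)) * (4 * Sg%:R) = 64 * Sg%:R * t * (A + B * (s + r * y)) by ring.
have -> : 64 * (A + B * (s + r)) * Sg%:R * t * (1 + y) = 64 * Sg%:R * t * ((A + B * (s + r)) * (1 + y)) by ring.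
apply: ler_wpM2l; first by rewrite mulr_ge0// mulr_ge0// ltW.
have := mulr_ge0 A0 y0; have := mulr_ge0 B0 (ltW r0); have := mulr_ge0 (mulr_ge0 B0 s0) y0.
have -> : (A + B * (s + r)) * (1 + y) = A + A * y + B * s + B * r + B * s * y + B * (r * y) by ring.
by rewrite !mulrDr => *; lra.
Qed.

Let meas_Om_mx q r k (A : Om -> 'M[R]_(q, r)) :
  meas_mx (A : OmG k -> _) -> meas_mx A.
Proof. by move=> mA i j; exact: measurable_past_Om (mA i j). Qed.

Let integral_cst_le (X0 : Om -> R) (b : R) : measurable_fun setT X0 ->
  (forall w, 0 <= X0 w) -> (forall w, X0 w <= b) -> (\int[P]_w (X0 w)%:E <= b%:E)%E.
Proof.
move=> mX X00 Xb; have := @integral_le_affine _ _ _ P X0 (cst 0) b 0 0 mX X00.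
rewrite mul0r addr0; apply => //; by rewrite integral0.
Qed.

Let meas_credit_H_div k : (k < T)%N ->
  measurable_fun setT (fun w => credit_H k w / (size_h X k w)%:R).
Proof.
move=> kT; apply: measurable_funM; first exact: measurable_past_Om (meas_credit_H (ltnW kT)).
by apply: (@meas_inv_size _ k) => l; exact: (size_h_past run).
Qed.

Let meas_credit_g_div k : (k < T)%N ->
  measurable_fun setT (fun w => credit_g k w / (size_g X k w)%:R).
Proof.
move=> kT; apply: measurable_funM; first exact: measurable_past_Om (meas_credit_g (ltnW kT)).
by apply: (@meas_inv_size _ k) => l; exact: (size_g_past run).
Qed.

(** A cycle pays [2 / 27 * (c * eps)] at its start and at most
    [c * eps / (6 * Sh)] at each later iteration: less than [c * eps / 4] in all. *)
Lemma err_H_moment k : (k < T)%N ->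
  (\int[P]_w (fnorm (err_H k w) ^+ 3)%:E <= ((tau / 2) ^+ 3)%:E)%E.
Proof.
move=> kT; pose I k (s : R) := (\int[P]_w (augnorm s (err_H k w) ^+ 3)%:E)%E.
have S0 : 0 < Sh%:R :> R by rewrite ltr0n.
have v10 : 0 <= c * eps / (6 * Sh%:R) by apply: divr_ge0; [exact: ltW|apply: mulr_ge0 => //; exact: ltW].
have bound := @cycle_bound _ I (fun s => (Num.sqrt s ^+ 3)%:E) Sh T
  (2 / 27 * (c * eps)) (c * eps / (6 * Sh%:R)) Sh_gt0 v10 _ _ k 0 kT (lexx 0).
have -> : (\int[P]_w (fnorm (err_H k w) ^+ 3)%:E = I k 0%R)%E.
  by apply: eq_integral => w _; rewrite augnorm0.
apply: (le_trans (bound _ _)) => {bound}.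
- move=> j s jT s0 Sj; apply: (le_trans (err_H_batch jT s0)).
  have cr0 w : 0 <= credit_H j w / (size_h X j w)%:R by rewrite divr_ge0.
  apply: integral_cst_le.
  + apply: meas_pot3; last exact: meas_Om_mx (meas_prev_err_H jT).
    by apply: measurable_funD => //; exact: meas_credit_H_div.
  + by move=> w.
  move=> w; rewrite /carry Sj /augnorm fnorm0 expr0n add0r lerXn2r ?nnegrE ?sqrtr_ge0//.
  by rewrite ler_wsqrtr// lerD2l credit_H_start.
- move=> j s jT s0 Sj; apply: (le_trans (err_H_batch jT s0)).
  rewrite /I; have -> : err_H j.-1 = carry Sh err_H j by rewrite /carry (negbTE Sj).
  have mE := meas_Om_mx (meas_prev_err_H jT).
  apply: ge0_le_integral => //.
  + by move=> w _; rewrite lee_fin.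
  + by apply/measurable_EFinP; apply: meas_pot3 => //; apply: measurable_funD => //; exact: meas_credit_H_div.
  + by apply/measurable_EFinP; exact: meas_pot3.
  move=> w _; rewrite lee_fin lerXn2r ?nnegrE ?augnorm_ge0//.
  by rewrite augnorm_le// lerD2l credit_H_carry.
rewrite lee_fin lerXn2r ?nnegrE ?sqrtr_ge0 ?divr_ge0 ?(ltW tau_gt0)//.
have -> : tau / 2 = Num.sqrt (c * eps / 4).
  rewrite [RHS]sqrtrM ?(ltW ce_gt0)//; congr (_ * _).
  have -> : 4^-1 = (2^-1) ^+ 2 :> R by field.
  by rewrite sqrtr_sqr ger0_norm ?invr_ge0.
rewrite ler_wsqrtr// add0r.
have kS : (k %% Sh)%:R * (c * eps / (6 * Sh%:R)) <= c * eps / 6.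
  have -> : (k %% Sh)%:R * (c * eps / (6 * Sh%:R)) = (k %% Sh)%:R / Sh%:R * (c * eps / 6).
    by field; rewrite gt_eqF.
  rewrite ler_piMl ?divr_ge0 ?(ltW ce_gt0)// ler_pdivrMr// mul1r ler_nat.
  by rewrite ltnW// ltn_mod.
by move: kS ce_gt0; move: (c * eps) (_%:R * _) => t u; lra.
Qed.

Lemma err_y_moment k : (k < T)%N ->
  (\int[P]_w (fnorm (err_y k w) ^+ 3)%:E <= ((tau / (2 * (beta * rho))) ^+ 3)%:E)%E.
Proof.
move=> kT; have br0 : 0 < beta * rho by rewrite mulr_gt0 ?(beta_gt0 fA beta_gt)// (rho_gt0 fA).
have -> : (\int[P]_w (fnorm (err_y k w) ^+ 3)%:E = \int[P]_w (augnorm 0 (err_y k w) ^+ 3)%:E)%E.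
  by apply: eq_integral => w _; rewrite augnorm0.
apply: (le_trans (err_y_batch kT)); apply: integral_cst_le.
- apply: meas_pot3; last exact: meas_mx_cst.
  apply: measurable_funD => //; apply: measurable_funM => //.
  by apply: (@meas_inv_size _ k) => l; exact: (size_gy_past run).
- by move=> w.
move=> w; rewrite lerXn2r ?nnegrE ?augnorm_ge0//.
  by rewrite divr_ge0 ?(ltW tau_gt0)// mulr_ge0 ?(ltW br0).
rewrite -(@ler_pXn2r _ 2) ?nnegrE ?augnorm_ge0//; last first.
  by rewrite divr_ge0 ?(ltW tau_gt0)// mulr_ge0 ?(ltW br0).
rewrite augnorm_sqr; last by rewrite add0r divr_ge0// mulr_ge0// sqr_ge0.
rewrite fnorm0 expr0n !add0r.
have := size_gy_large run w kT; rewrite ler_pdivrMr// => hN.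
rewrite ler_pdivrMr ?size_y_pos// expr_div_n tau2 mulrAC ler_pdivlMr; last first.
  by rewrite exprn_gt0// mulr_gt0.
move: hN; rewrite -mulrA (mulrC (c * eps)) mulrA; move: (_%:R * (c * eps)) => Q.
have -> : 3 * sigma1 ^+ 2 * (2 * (beta * rho)) ^+ 2 = 12 * (sigma1 * beta * rho) ^+ 2 by ring.
by have := sqr_ge0 (sigma1 * beta * rho); move: ((sigma1 * beta * rho) ^+ 2) => *; lra.
Qed.

(** A cycle pays [eps ^+ 2 / 4] at its start, and [eps ^+ 2 / (2 * Sg)] at each
    later iteration, less than [eps ^+ 2 / 2] together. *)
Lemma err_g_moment k : (k < T)%N ->
  (forall j, (j <= k)%N -> (\int[P]_w (a (zk j w) ^+ 2)%:E <= (Rd ^+ 2)%:E)%E) ->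
  (\int[P]_w (fnorm (err_g k w) ^+ 2)%:E <= (3 / 4 * eps ^+ 2)%:E)%E.
Proof.
move=> kT aR; pose I k (s : R) := (\int[P]_w (fnorm (err_g k w) ^+ 2 + s)%:E)%E.
have S0 : 0 < Sg%:R :> R by rewrite ltr0n.
have e20 : 0 < eps ^+ 2 by rewrite exprn_gt0.
have v10 : 0 <= eps ^+ 2 / (2 * Sg%:R) by apply: divr_ge0; [exact: ltW|apply: mulr_ge0 => //; exact: ltW].
have bound := @cycle_bound _ I (fun s => s%:E) Sg k.+1
  (eps ^+ 2 / 4) (eps ^+ 2 / (2 * Sg%:R)) Sg_gt0 v10 _ _ k 0 (ltnSn k) (lexx 0).
have -> : (\int[P]_w (fnorm (err_g k w) ^+ 2)%:E = I k 0%R)%E.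
  by apply: eq_integral => w _; rewrite addr0.
have ma j : (j <= k)%N -> measurable_fun setT (fun w => a (zk j w) ^+ 2).
  move=> jk; apply: measurable_funX; apply: meas_a.
  exact: meas_Om_mx (adapted_iterate (leq_trans jk (ltnW kT))).
apply: (le_trans (bound _ _)) => {bound}.
- move=> j s; rewrite ltnS => jk s0 Sj; have jT := leq_ltn_trans jk kT.
  apply: (le_trans (err_g_batch jT s0)).
  have cr0 w : 0 <= credit_g j w / (size_g X j w)%:R by rewrite divr_ge0.
  have -> : s + eps ^+ 2 / 4 = (s + eps ^+ 2 / 8) + eps ^+ 2 / 8 / Rd ^+ 2 * Rd ^+ 2.
    by rewrite mulfVK ?gt_eqF// -addrA; congr (_ + _); field.
  apply: (@integral_le_affine _ _ _ P _ (fun w => a (zk j w) ^+ 2)) => //.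
  + apply: meas_pot2; last exact: meas_Om_mx (meas_prev_err_g jT).
    by apply: measurable_funD => //; exact: meas_credit_g_div.
  + by move=> w; rewrite addr_ge0 ?sqr_ge0// addr_ge0.
  + exact: ma.
  + by move=> w; rewrite sqr_ge0.
  + exact: aR.
  + by rewrite divr_ge0 ?(ltW R2_gt0)// divr_ge0 ?(ltW e20).
  move=> w; rewrite /carry Sj fnorm0 expr0n add0r -addrA lerD2l.
  rewrite (le_trans (credit_g_start w jT Sj))// mulrDr mulr1 mulrA.
  by [].
- move=> j s; rewrite ltnS => jk s0 Sj; have jT := leq_ltn_trans jk kT.
  apply: (le_trans (err_g_batch jT s0)).
  have jk' : (j.-1 <= k)%N by exact: leq_trans (leq_pred _) jk.
  have cr0 w : 0 <= credit_g j w / (size_g X j w)%:R by rewrite divr_ge0.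
  rewrite /I; have -> : err_g j.-1 = carry Sg err_g j by rewrite /carry (negbTE Sj).
  have mE := meas_Om_mx (meas_prev_err_g jT).
  have mEs : measurable_fun setT (fun w => (fnorm (carry Sg err_g j w) ^+ 2 + s)%:E).
    by apply/measurable_EFinP; exact: meas_pot2.
  under eq_integral => w _ do rewrite addrA EFinD.
  under [leRHS]eq_integral => w _ do rewrite addrA EFinD.
  have ge0E w : setT w -> (0 <= (fnorm (carry Sg err_g j w) ^+ 2 + s)%:E)%E.
    by rewrite lee_fin addr_ge0// sqr_ge0.
  rewrite ge0_integralD//; last 2 first.
  + by move=> w _; rewrite lee_fin.
  + by apply/measurable_EFinP; exact: meas_credit_g_div.
  rewrite ge0_integralD//.
  have := integral_cst P measurableT (eps ^+ 2 / (2 * Sg%:R))%:E.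
  rewrite /= probability_setT mule1 => ->; rewrite leeD2l//.
  have -> : eps ^+ 2 / (2 * Sg%:R) =
      eps ^+ 2 / (4 * Sg%:R) + eps ^+ 2 / (4 * Sg%:R) / Rd ^+ 2 * Rd ^+ 2.
    by rewrite mulfVK ?gt_eqF//; field; rewrite gt_eqF.
  apply: (@integral_le_affine _ _ _ P _ (fun w => a (zk j.-1 w) ^+ 2)) => //.
  + exact: meas_credit_g_div.
  + exact: ma.
  + by move=> w; rewrite sqr_ge0.
  + exact: aR.
  + by rewrite divr_ge0 ?(ltW R2_gt0)// divr_ge0 ?(ltW e20)// mulr_ge0// ltW.
  move=> w; rewrite (le_trans (credit_g_carry w jT Sj))// mulrDr mulr1 mulrA.
  by [].
rewrite lee_fin add0r.
have kS : (k %% Sg)%:R * (eps ^+ 2 / (2 * Sg%:R)) <= eps ^+ 2 / 2.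
  have -> : (k %% Sg)%:R * (eps ^+ 2 / (2 * Sg%:R)) = (k %% Sg)%:R / Sg%:R * (eps ^+ 2 / 2).
    by field; rewrite gt_eqF.
  rewrite ler_piMl ?divr_ge0 ?(ltW e20)// ler_pdivrMr// mul1r ler_nat.
  by rewrite ltnW// ltn_mod.
by move: kS e20; move: (eps ^+ 2) (_%:R * _) => t u; lra.
Qed.

End Run.

(** * One iteration *)

Section Young.
Context {R : realType}.
Implicit Types (c eps tau eg eH ey x u v w : R).

Let young1 v : 0 <= v -> v <= v ^+ 3 / 3 + 2 / 3.
Proof. by move=> v0; have := young_cube v0 ler01; rewrite !expr1n !mulr1. Qed.

(** By [tau ^+ 2 = c * eps], this is [eps ^+ 2 / tau] times a polynomial in the
    scale-free errors [eg / eps], [eH / tau] and [ey / tau]. *)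
Definition young_cost c eps tau eg eH ey : R := eps ^+ 2 / tau / 12 + eg ^+ 2 / tau
  + eH ^+ 3 / (6 * c ^+ 2) + ey ^+ 3 / (3 * c ^+ 2).

Section Scaled.
Variables (c eps tau eg eH ey x : R).
Hypotheses (e0 : 0 < eps) (t0 : 0 < tau) (tau2 : tau ^+ 2 = c * eps).
Hypotheses (eg0 : 0 <= eg) (eH0 : 0 <= eH) (ey0 : 0 <= ey) (x0 : 0 <= x).

(* In the scale-free unknowns [eg / eps], [eH / tau], [ey / tau], [x * tau / eps]
   the inequalities below are polynomial with numerical coefficients. *)
Let scaled (phi : R -> R -> R -> R -> R -> Prop) :
  (forall u w y v, 0 <= u -> 0 <= w -> 0 <= y -> 0 <= v ->
     phi (tau ^+ 2 / eps) (eps * u) (tau * w) (tau * y) (eps / tau * v)) ->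
  phi c eg eH ey x.
Proof.
move=> H.
have -> : c = tau ^+ 2 / eps by rewrite tau2 mulfK// gt_eqF.
have -> : eg = eps * (eg / eps) by rewrite mulrC mulfVK// gt_eqF.
have -> : eH = tau * (eH / tau) by rewrite mulrC mulfVK// gt_eqF.
have -> : ey = tau * (ey / tau) by rewrite mulrC mulfVK// gt_eqF.
have -> : x = eps / tau * (x * tau / eps) by field; rewrite !gt_eqF.
by apply: H; rewrite divr_ge0 ?mulr_ge0// ltW.
Qed.

Lemma young_step : eg * x + 2^-1 * (eH * x ^+ 2) + ey * x ^+ 2
  <= 7 / 6 * (c * x ^+ 3) + young_cost c eps tau eg eH ey.
Proof.
refine (@scaled (fun c eg eH ey x => eg * x + 2^-1 * (eH * x ^+ 2) + ey * x ^+ 2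
  <= 7 / 6 * (c * x ^+ 3) + young_cost c eps tau eg eH ey) _).
move=> u w y v u0 w0 y0 v0; rewrite -subr_ge0 /young_cost.
have -> : 7 / 6 * (tau ^+ 2 / eps * (eps / tau * v) ^+ 3) +
    (eps ^+ 2 / tau / 12 + (eps * u) ^+ 2 / tau + (tau * w) ^+ 3 / (6 * (tau ^+ 2 / eps) ^+ 2)
      + (tau * y) ^+ 3 / (3 * (tau ^+ 2 / eps) ^+ 2)) -
    (eps * u * (eps / tau * v) + 2^-1 * (tau * w * (eps / tau * v) ^+ 2)
      + tau * y * (eps / tau * v) ^+ 2) =
  eps ^+ 2 / tau * (7 / 6 * v ^+ 3 + 12^-1 + u ^+ 2 + w ^+ 3 / 6 + y ^+ 3 / 3
    - u * v - 2^-1 * (w * v ^+ 2) - y * v ^+ 2) by field; rewrite !gt_eqF.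
rewrite mulr_ge0 ?divr_ge0 ?sqr_ge0 ?(ltW t0)//.
have := young_cube w0 v0; have := young_cube y0 v0; have := young_cube ler01 v0; have := sqr_ge0 (u - v / 2).
have -> : (u - v / 2) ^+ 2 = u ^+ 2 - u * v + v ^+ 2 / 4 by field.
by rewrite expr1n mul1r => *; lra.
Qed.

Lemma young_grad : eg + eH * x + 2 * (ey * x) + 15 * (c * x ^+ 2)
  <= 13 / 2 * eps + tau / eps * (2 * young_cost c eps tau eg eH ey + 11 * (c * x ^+ 3)).
Proof.
refine (@scaled (fun c eg eH ey x => eg + eH * x + 2 * (ey * x) + 15 * (c * x ^+ 2)
  <= 13 / 2 * eps + tau / eps * (2 * young_cost c eps tau eg eH ey + 11 * (c * x ^+ 3))) _).
move=> u w y v u0 w0 y0 v0; rewrite -subr_ge0 /young_cost.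
have -> : 13 / 2 * eps + tau / eps * (2 *
    (eps ^+ 2 / tau / 12 + (eps * u) ^+ 2 / tau + (tau * w) ^+ 3 / (6 * (tau ^+ 2 / eps) ^+ 2)
      + (tau * y) ^+ 3 / (3 * (tau ^+ 2 / eps) ^+ 2)) +
      11 * (tau ^+ 2 / eps * (eps / tau * v) ^+ 3)) -
    (eps * u + tau * w * (eps / tau * v) + 2 * (tau * y * (eps / tau * v))
      + 15 * (tau ^+ 2 / eps * (eps / tau * v) ^+ 2)) =
  eps * (13 / 2 + 1 / 6 + 2 * u ^+ 2 + w ^+ 3 / 3 + 2 * y ^+ 3 / 3 + 11 * v ^+ 3
    - u - w * v - 2 * (y * v) - 15 * v ^+ 2) by field; rewrite !gt_eqF.
rewrite mulr_ge0 ?(ltW e0)//.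
have wv (p q : R) : 0 <= p -> 0 <= q -> p * q <= p ^+ 3 / 3 + q ^+ 3 / 3 + 1 / 3.
  move=> p0 q0; have : 0 <= (p + q + 1) * ((p - q) ^+ 2 + (p - 1) ^+ 2 + (q - 1) ^+ 2).
    exact: mulr_ge0 (addr_ge0 (addr_ge0 p0 q0) ler01) (addr_ge0 (addr_ge0 (sqr_ge0 _) (sqr_ge0 _)) (sqr_ge0 _)).
  have -> : (p + q + 1) * ((p - q) ^+ 2 + (p - 1) ^+ 2 + (q - 1) ^+ 2) =
      2 * p ^+ 3 + 2 * q ^+ 3 + 2 - 6 * (p * q) by ring.
  by lra.
have := wv _ _ w0 v0; have := wv _ _ y0 v0; have := young_cube ler01 v0; have := sqr_ge0 (u - 1 / 4).
have -> : (u - 1 / 4) ^+ 2 = u ^+ 2 - u / 2 + 1 / 16 by field.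
by rewrite expr1n mul1r => *; lra.
Qed.

Lemma young_lambda : eH + 2 * ey + 16 * (c * x)
  <= 13 * tau + c / eps * (2 * young_cost c eps tau eg eH ey + 16 / 3 * (c * x ^+ 3)).
Proof.
refine (@scaled (fun c eg eH ey x => eH + 2 * ey + 16 * (c * x)
  <= 13 * tau + c / eps * (2 * young_cost c eps tau eg eH ey + 16 / 3 * (c * x ^+ 3))) _).
move=> u w y v u0 w0 y0 v0; rewrite -subr_ge0 /young_cost.
have -> : 13 * tau + tau ^+ 2 / eps / eps * (2 *
    (eps ^+ 2 / tau / 12 + (eps * u) ^+ 2 / tau + (tau * w) ^+ 3 / (6 * (tau ^+ 2 / eps) ^+ 2)
      + (tau * y) ^+ 3 / (3 * (tau ^+ 2 / eps) ^+ 2)) +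
      16 / 3 * (tau ^+ 2 / eps * (eps / tau * v) ^+ 3)) -
    (tau * w + 2 * (tau * y) + 16 * (tau ^+ 2 / eps * (eps / tau * v))) =
  tau * (13 + 1 / 6 + 2 * u ^+ 2 + w ^+ 3 / 3 + 2 * y ^+ 3 / 3 + 16 / 3 * v ^+ 3
    - w - 2 * y - 16 * v) by field; rewrite !gt_eqF.
rewrite mulr_ge0 ?(ltW t0)//.
have := young1 w0; have := young1 y0; have := young1 v0; have := sqr_ge0 u.
by move=> *; lra.
Qed.

End Scaled.

Lemma dist_lb (p q k : R) : `|p - q| <= k -> q - k <= p.
Proof. by rewrite ler_norml => /andP[h _]; lra. Qed.

Lemma cst_c_ge (l r b : R) : 0 <= r -> 2 * (b * r) * l <= 4 * cst_c l r b.
Proof.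
rewrite /cst_c (_ : 4 * _ = 2 * (b * r) * l + 2 / 3 * r) => [r0|]; last by field.
by rewrite lerDl mulr_ge0.
Qed.

Lemma step_grad_arith (t k q q1 q2 s e : R) : 0 <= t * q1 -> 0 <= t * q2 -> q <= 3 * (t * q1) ->
  s <= 13 / 2 * e + t * (2 * k + 11 * q2) ->
  2 * s + q <= 13 * e + t * (4 * k + 33 * (2^-1 * q1 + 5 / 6 * q2)).
Proof. by move=> *; lra. Qed.

Lemma step_lambda_arith (t k q1 q2 q3 q4 s e : R) : 0 <= t * q1 -> 0 <= t * q2 -> q4 <= q3 ->
  s <= 13 * e + t * (2 * k + 16 / 3 * q2) ->
  s + q4 <= 13 * e + t * (2 * k + 7 * (2^-1 * q1 + 5 / 6 * q2)) + q3.
Proof. by move=> *; lra. Qed.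

Lemma grad_arith (F1 F2 a r ey eH eg x y c : R) :
  F1 <= r * a * x + 3 * c * x ^+ 2 -> F2 <= eH * x -> r * x * y <= r * x * (a + ey) ->
  F1 + eg + F2 + 2 * r * y * x + 6 * c * x ^+ 2
    <= eg + eH * x + 2 * (r * ey * x) + 9 * (c * x ^+ 2) + 3 * (r * (a * x)).
Proof. by move=> *; lra. Qed.

Lemma lambda_arith (M1 M2 M3 M4 r V a1 a0 ey eH x y c l : R) : 0 <= r -> 0 <= V ->
  M2 - r * a1 * V <= M1 -> M3 - 6 * c * x * V <= M2 -> M4 - eH * V <= M3 ->
  - (6 * c * x) * V <= M4 + 2 * r * y * V ->
  y <= a0 + ey -> a0 <= a1 + l -> 2 * r * l <= 4 * (c * x) ->
  - (eH + 2 * (r * ey) + 16 * (c * x) + 3 * r * a1) * V <= M1.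
Proof.
move=> r0 V0 h1 h2 h3 h4 h5 h6 h7.
have h8 := ler_wpM2r V0 h7; have h9 := ler_wpM2l (mulr_ge0 r0 V0) h5.
have h10 := ler_wpM2l (mulr_ge0 r0 V0) h6.
lra.
Qed.

End Young.

Section Step.
Context {R : realType} {n m : nat} (mu L rho : R) (f : 'cV[R]_(n + m) -> R).
Hypothesis fA : deterministic_assumptions mu L rho f.
Variables (beta eps : R).
Hypothesis beta_gt : mu^-1 < beta.
Hypothesis eps_gt0 : 0 < eps.
Variables (z xi gk : 'cV[R]_(n + m)) (Hk : 'M[R]_(n + m)) (yk : 'cV[R]_m).
Hypothesis Hk_sym : Hk^T = Hk.
Local Notation h := (h_ beta f).
Local Notation Hb := (Hbar f beta).
Local Notation a z := (enorm (grad_y f z)).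
Local Notation c := (cst_c L rho beta).
Local Notation tau := (Num.sqrt (c * eps)).
Local Notation gamma := (beta * mu - 1).
Hypothesis xi_min : forall v,
  let model := cubic_model gk (Hk + (alpha1 rho beta * enorm yk)%:M) (alpha2 L rho beta) in
  model xi <= model v.

Let c0 : 0 < c := cst_c_gt0 fA beta_gt.
Let b0 : 0 < beta := beta_gt0 fA beta_gt.
Let gamma0 : 0 < gamma := gamma_gt0 fA beta_gt.
Let rho0 : 0 < rho := rho_gt0 fA.
Let L0 : 0 < L := L_gt0 fA.
Let br0 : 0 < beta * rho := mulr_gt0 b0 rho0.
Let ce0 : 0 < c * eps := mulr_gt0 c0 eps_gt0.
Let tau0 : 0 < tau. Proof. by rewrite sqrtr_gt0. Qed.
Let tau2 : tau ^+ 2 = c * eps. Proof. by rewrite sqr_sqrtr// ltW. Qed.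

Let eg := fnorm (gk - grad h z).
Let eH := fnorm (Hk - Hb z).
Let ey := fnorm (yk - grad_y f z).
Let x := fnorm xi.
Let y := enorm yk.
Let A := Hk + (2 * (beta * rho) * y)%:M.

Let A_sym : A^T = A.
Proof. by rewrite linearD/= Hk_sym tr_scalar_mx. Qed.

Let s0 : 0 <= 6 * c. Proof. by rewrite mulr_ge0// ltW. Qed.

Let A_min v : cubic_model gk A (2 * (6 * c)) xi <= cubic_model gk A (2 * (6 * c)) v.
Proof.
have -> : 2 * (6 * c) = alpha2 L rho beta by rewrite /alpha2; ring.
by rewrite /A mulrA; exact: xi_min.
Qed.

Let eg0 : 0 <= eg := fnorm_ge0 _.
Let eH0 : 0 <= eH := fnorm_ge0 _.
Let ey0 : 0 <= ey := fnorm_ge0 _.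
Let x0 : 0 <= x := fnorm_ge0 _.
Let a0 : 0 <= a z := fnorm_ge0 _.

Let bey0 : 0 <= beta * rho * ey. Proof. by rewrite mulr_ge0// ltW. Qed.

Let y_le : y <= a z + ey.
Proof. exact: ler_distfnorm. Qed.

Let y_ge : a z <= y + ey.
Proof. by rewrite /ey fnormB; exact: ler_distfnorm. Qed.

Let a_step : a z <= a (z + xi) + L * x.
Proof. exact: (grad_y_step fA). Qed.

(** What the objective pays for the errors of the three estimates. *)
Definition step_cost : R := young_cost c eps tau eg eH (beta * rho * ey).

(** What it gains. The first term pays for the curvature that [Hbar] neglects. *)
Definition step_gain : R := 2^-1 * (beta * rho * a z * x ^+ 2) + 5 / 6 * (c * x ^+ 3).

Lemma step_gain_ge0 : 0 <= step_gain.
Proof.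
apply: addr_ge0; apply: mulr_ge0; rewrite ?divr_ge0 ?invr_ge0//.
  by rewrite mulr_ge0 ?sqr_ge0// mulr_ge0// ltW.
by rewrite mulr_ge0 ?exprn_ge0// ltW.
Qed.

(** Up to the errors, the model overestimates [h]: its cubic term is
    [2 * c * x ^+ 3] against a remainder [c * x ^+ 3] in [h_descent], and its
    regularization is twice the curvature that [Hbar] neglects. *)
Let descent_raw : h (z + xi) + 2^-1 * (beta * rho * a z * x ^+ 2) + 2 * (c * x ^+ 3)
  <= h z + eg * x + 2^-1 * (eH * x ^+ 2) + beta * rho * ey * x ^+ 2.
Proof.
have dec := cubic_model_decrease A_sym s0 A_min.
rewrite cubic_modelE formDl form_scalar -/x in dec.
have desc := h_descent fA beta_gt z xi; rewrite -/x in desc.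
have g1 : fdot (grad h z) xi <= fdot gk xi + eg * x.
  rewrite -lerBlDl -fdotNl -fdotDl (le_trans (fdot_le _ _))//.
  by rewrite /eg fnormB.
have H1 : form (Hb z) xi <= form Hk xi + eH * x ^+ 2.
  rewrite -lerBlDl -formBl (le_trans (ler_norm _))// (le_trans (normr_form_le_fnorm _ _))//.
  by rewrite /eH fnormB.
have yx := ler_wpM2l (mulr_ge0 (ltW br0) (sqr_ge0 x)) y_ge.
move: dec desc g1 H1 yx.
move: (h (z + xi)) (h z) (fdot _ _) (fdot _ _) (form _ _) (form _ _) => h1 h2 F1 F2 M1 M2.
by rewrite !exprS expr0 => *; nra.
Qed.

Let costE : step_cost = young_cost c eps tau eg eH (beta * rho * ey).
Proof. by []. Qed.

Lemma step_decrease : h (z + xi) + step_gain <= h z + step_cost.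
Proof.
have raw := descent_raw; rewrite costE /step_gain.
have := young_step eps_gt0 tau0 tau2 eg0 eH0 bey0 x0; move: raw.
move: (young_cost _ _ _ _ _ _) (beta * rho * a z * x ^+ 2) (beta * rho * ey * x ^+ 2) => p1 p2 p3.
move: (eg * x) (eH * x ^+ 2) (c * x ^+ 3) (h z) (h (z + xi)) => p4 p5 p6 p7 p8.
by move=> *; lra.
Qed.

Let N := fnorm (grad h (z + xi)).

Let grad_raw : N <= eg + eH * x + 2 * (beta * rho * ey * x) + 9 * (c * x ^+ 2)
  + 3 * (beta * rho * (a z * x)).
Proof.
have stat := cubic_model_stationary A_sym s0 A_min.
have T := grad_h_taylor fA beta_gt z xi; rewrite -/x in T.
have E : grad h (z + xi) = (grad h (z + xi) - grad h z - Hb z *m xi) + (grad h z - gk)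
   + (Hb z - Hk) *m xi - (2 * (beta * rho) * y) *: xi - (6 * c * x) *: xi.
  have : gk + Hk *m xi = - ((2 * (beta * rho) * y) *: xi) - (6 * c * x) *: xi.
    apply/eqP; rewrite -subr_eq0; apply/eqP; rewrite -stat /A mulmxDl mul_scalar_mx -/x.
    by rewrite opprB opprK !addrA addrAC.
  rewrite mulmxBl; move: (grad h (z + xi)) (grad h z) (Hb z *m xi) (Hk *m xi) (_ *: xi) (_ *: xi).
  move=> G1 G0 B K q1 q2 gkE.
  apply/matrixP => i j; move/matrixP: gkE => /(_ i j); rewrite !mxE.
  by move=> *; lra.
have n1 : fnorm ((2 * (beta * rho) * y) *: xi) = 2 * (beta * rho) * y * x.
  by rewrite fnormZ ger0_norm -?mulrA// !mulr_ge0 ?fnorm_ge0// ltW.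
have n2 : fnorm ((6 * c * x) *: xi) = 6 * c * x ^+ 2.
  by rewrite fnormZ ger0_norm; [rewrite -/x; ring|exact: mulr_ge0].
have n3 : fnorm ((Hb z - Hk) *m xi) <= eH * x.
  by rewrite (le_trans (fnorm_mulmx _ _))// /eH fnormB.
have n4 : fnorm (grad h z - gk) = eg by rewrite fnormB.
have yx := ler_wpM2l (mulr_ge0 (ltW br0) x0) y_le.
have tri (T1 T2 T3 T4 T5 : 'cV[R]_(n + m)) : fnorm (T1 + T2 + T3 - T4 - T5) <=
    fnorm T1 + fnorm T2 + fnorm T3 + fnorm T4 + fnorm T5.
  do 2 (apply: (le_trans (ler_fnormB _ _)); rewrite lerD2r).
  by do 2 (apply: (le_trans (ler_fnormD _ _)); rewrite ?lerD2r).
rewrite /N E; apply: (le_trans (tri _ _ _ _ _)); rewrite n1 n2 n4.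
exact: grad_arith T n3 yx.
Qed.

Let xbar := gamma / (6 * (beta * rho)).
Let xbar0 : 0 < xbar. Proof. by rewrite divr_gt0// mulr_gt0. Qed.

(** For a short step the curvature term is absorbed by the gradient itself; a
    long step has already been paid for by the decrease of the objective. *)
Let absorbed : N <= 2 * (eg + eH * x + 2 * (beta * rho * ey * x) + 15 * (c * x ^+ 2))
  + 3 * (beta * rho * a z * x ^+ 2) / xbar.
Proof.
have raw := grad_raw.
have p1 : 0 <= eH * x by rewrite mulr_ge0.
have p2 : 0 <= beta * rho * ey * x by rewrite mulr_ge0.
have p3 : 0 <= c * x ^+ 2 by rewrite mulr_ge0 ?sqr_ge0 ?ltW.
have p4 : 0 <= beta * rho * a z * x ^+ 2 by rewrite mulr_ge0 ?sqr_ge0// mulr_ge0// ltW.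
have [xs|xl] := leP x xbar; last first.
  have h1 : beta * rho * (a z * x) <= beta * rho * a z * x ^+ 2 / xbar.
    rewrite ler_pdivlMr// -!mulrA ler_wpM2l ?(ltW b0)// ler_wpM2l ?(ltW rho0)//.
    by rewrite ler_wpM2l// expr2 ler_wpM2l// ltW.
  rewrite (_ : 3 * (beta * rho * a z * x ^+ 2) / xbar = 3 * (beta * rho * a z * x ^+ 2 / xbar)); last exact: esym (mulrA _ _ _).
  move: h1 raw p1 p2 p3 eg0.
  move: (beta * rho * a z * x ^+ 2 / xbar) => q; move: (beta * rho * (a z * x)) => q1.
  by move: (eH * x) (beta * rho * ey * x) (c * x ^+ 2) => *; lra.
have h0 : 0 <= 3 * (beta * rho * a z * x ^+ 2) / xbar.
  exact: divr_ge0 (mulr_ge0 (ler0n _ 3) p4) (ltW xbar0).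
have h1 : beta * rho * (a z * x) <= N / 6 + beta * rho * L * x ^+ 2.
  have aN : gamma * a (z + xi) <= N := grad_h_ge fA beta_gt _.
  have h2 := ler_wpM2l (mulr_ge0 (ltW br0) x0) a_step.
  have h3 : beta * rho * x * a (z + xi) <= N / 6.
    have xg : beta * rho * x <= gamma / 6.
      have := ler_wpM2l (ltW br0) xs; rewrite /xbar.
      have -> // : beta * rho * (gamma / (6 * (beta * rho))) = gamma / 6.
      by field; rewrite !gt_eqF.
    have ap0 : 0 <= a (z + xi) := fnorm_ge0 _.
    apply: (le_trans (ler_wpM2r ap0 xg)).
    by rewrite (_ : gamma / 6 * a (z + xi) = gamma * a (z + xi) / 6) ?ler_wpM2r ?invr_ge0//; ring.
  rewrite (_ : beta * rho * (a z * x) = beta * rho * x * a z); last by ring.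
  apply: (le_trans h2); rewrite mulrDr (_ : beta * rho * x * (L * x) = beta * rho * L * x ^+ 2); last by ring.
  by rewrite lerD2r.
have h2 : beta * rho * L * x ^+ 2 <= 2 * (c * x ^+ 2).
  rewrite mulrA ler_wpM2r ?sqr_ge0// /cst_c.
  have := mulr_gt0 (mulr_gt0 b0 rho0) L0; move: rho0.
  by rewrite (_ : 2 * ((3 * beta * L + 1) * rho / 6) = beta * rho * L + rho / 3); [lra|field].
move: h0 h1 h2 raw p1 p2 p3 eg0.
move: (3 * _ / xbar) (beta * rho * (a z * x)) (beta * rho * L * x ^+ 2) => q q1 q2.
by move: (eH * x) (beta * rho * ey * x) (c * x ^+ 2) => *; lra.
Qed.

Lemma step_grad : eps / tau <= gamma / (6 * (beta * rho)) ->
  fnorm (grad h (z + xi)) <= 13 * eps + tau / eps * (4 * step_cost + 33 * step_gain).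
Proof.
move=> scale; apply: (le_trans absorbed).
have yg := young_grad eps_gt0 tau0 tau2 eg0 eH0 bey0 x0; rewrite -costE in yg.
have p4 : 0 <= beta * rho * a z * x ^+ 2 by rewrite mulr_ge0 ?sqr_ge0// mulr_ge0// ltW.
have h1 : 3 * (beta * rho * a z * x ^+ 2) / xbar <= 3 * (beta * rho * a z * x ^+ 2 * (tau / eps)).
  rewrite -mulrA; apply: ler_wpM2l => //; apply: ler_wpM2l => //.
  have sc : eps / tau <= xbar := scale.
  have et0 : 0 < eps / tau by exact: divr_gt0.
  by rewrite -(invf_div eps tau) lef_pV2 ?posrE.
have p5 : 0 <= tau / eps * (c * x ^+ 3).
  exact: mulr_ge0 (divr_ge0 (ltW tau0) (ltW eps_gt0)) (mulr_ge0 (ltW c0) (exprn_ge0 3 x0)).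
have p6 : 0 <= tau / eps * (beta * rho * a z * x ^+ 2) by rewrite mulr_ge0// divr_ge0// ltW.
by apply: step_grad_arith p6 p5 _ yg; rewrite mulrC (mulrC (tau / eps)) mulrC.
Qed.

(** Descend from the Hessian of [h] at the new point to [Hb] there, to [Hb] at the
    old point, to its estimate, and to [cubic_model_psd]. *)
Lemma step_lambda : - lambda_min (hess h (z + xi)) <=
  13 * tau + c / eps * (2 * step_cost + 7 * step_gain)
  + 3 * (beta * rho) / gamma * fnorm (grad h (z + xi)).
Proof.
set s := eH + 2 * (beta * rho * ey) + 16 * (c * x) + 3 * (beta * rho) * a (z + xi).
have ap0 : 0 <= a (z + xi) := fnorm_ge0 _.
have cx0 : 0 <= c * x by rewrite mulr_ge0// ltW.
have s_ge0 : 0 <= s.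
  by rewrite addr_ge0// ?addr_ge0// mulr_ge0// mulr_ge0// ltW.
have : - s <= lambda_min (hess h (z + xi)).
  apply: lambda_min_ge => // v; set V := fnorm v ^+ 2; have V0 : 0 <= V by exact: sqr_ge0.
  have h1 := form_hess_h_ge fA beta_gt (z + xi) v.
  have h2 : form (Hb z) v - 6 * c * x * V <= form (Hb (z + xi)) v.
    have : `|form (Hb (z + xi) - Hb z) v| <= 6 * c * x * V.
      by apply: normr_form_le => w; exact: (Hbar_step fA beta_gt z xi w).
    by rewrite formBl; exact: dist_lb.
  have h3 : form Hk v - eH * V <= form (Hb z) v.
    by rewrite lerBlDr -lerBlDl -formBl (le_trans (ler_norm _))// normr_form_le_fnorm.
  have h4 := cubic_model_psd A_sym s0 A_min v; rewrite formDl form_scalar -/V -/x in h4.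
  have h7 : 2 * (beta * rho) * (L * x) <= 4 * (c * x).
    have -> : 2 * (beta * rho) * (L * x) = 2 * (beta * rho) * L * x by ring.
    have -> : 4 * (c * x) = 4 * c * x by ring.
    by rewrite ler_wpM2r//; exact: cst_c_ge (ltW rho0).
  exact: (lambda_arith (ltW br0) V0 h1 h2 h3 h4 y_le a_step h7).
rewrite lerNl => /le_trans; apply; rewrite /s.
have yl := young_lambda eps_gt0 tau0 tau2 eg0 eH0 bey0 x0; rewrite -costE in yl.
have p4 : 0 <= beta * rho * a z * x ^+ 2 by rewrite mulr_ge0 ?sqr_ge0// mulr_ge0// ltW.
have ce : 0 <= c / eps by rewrite divr_ge0// ltW.
have p5 : 0 <= c / eps * (c * x ^+ 3) := mulr_ge0 ce (mulr_ge0 (ltW c0) (exprn_ge0 3 x0)).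
have p6 := mulr_ge0 ce p4.
have aN : a (z + xi) <= fnorm (grad h (z + xi)) / gamma.
  by rewrite ler_pdivlMr// mulrC; exact: (grad_h_ge fA beta_gt).
have aN3 := ler_wpM2l (mulr_ge0 (ler0n _ 3) (ltW br0)) aN.
apply: step_lambda_arith p6 p5 _ yl.
by rewrite -[leRHS]mulrA (mulrC gamma^-1).
Qed.

End Step.

(** * Averaging over a run *)

(** Freezing, applied to the indicator of [A]. *)
Lemma integral_indep_event {R : realType} {d : measure_display} {Om : measurableType d}
    (P : probability Om R) (G : set (set Om)) (A : set Om) (r : R)
    (Y : g_sigma_algebraType G -> R) :
  sigma_algebra setT G -> G `<=` measurable -> measurable A ->
  (forall E, G E -> fine (P (E `&` A)) = fine (P E) * r) ->
  measurable_fun setT Y -> (forall w, 0 <= Y w) ->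
  (\int[P]_w (\1_A w * Y w)%:E = r%:E * \int[P]_w (Y w)%:E)%E.
Proof.
move=> sG Gm mA indA mY Y0.
have GT : G setT by case: sG => G0 GC _; rewrite -[setT]setD0; exact: GC.
have PA : P A = r%:E.
  by have := indA _ GT; rewrite setTI probability_setT mul1r => <-; rewrite fineK// fin_num_measure.
have indE E : G E -> (P (E `&` A) = P E * r%:E)%E.
  move=> GE; have mE := Gm _ GE.
  rewrite -[LHS]fineK ?fin_num_measure//; last exact: measurableI.
  by rewrite indA// EFinM fineK// fin_num_measure.
pose zeta : Om -> R := \1_A.
have mzeta : measurable_fun setT zeta by exact: measurable_indic.
pose zf : {mfun Om >-> R} := HB.pack zeta (isMeasurableFun.Build _ _ _ _ _ mzeta).
pose nu := distribution P zf.
have zB (B : set R) : zeta @^-1` B = (if 1 \in B then A else set0) `|` (if 0 \in B then ~` A else set0).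
  apply/seteqP; split => w; rewrite /preimage /= /zeta indicE.
    have [wA|wA] := boolP (w \in A) => Bw.
      by left; rewrite (mem_set Bw) -[A _]/(A w); exact: set_mem.
    right; rewrite (mem_set Bw); rewrite notin_setE in wA; exact: wA.
  move=> []; case: ifPn => // B1 wA.
    by rewrite (mem_set wA); exact: set_mem.
  by rewrite memNset//; exact: set_mem.
have mAC : measurable (~` A) by exact: measurableC.
have PAC : (P (~` A) = 1 - r%:E)%E by rewrite probability_setC// PA.
have fresh E B : <<s G >> E -> measurable B -> (P (E `&` zeta @^-1` B) = P E * nu B)%E.
  rewrite sigma_algebra_id// => GE mB; have mE := Gm _ GE.
  rewrite -[nu B]/(P (zeta @^-1` B)) zB.
  have indC : (P (E `&` ~` A) = P E * P (~` A))%E.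
    rewrite -setDE measureD//; last exact: le_lt_trans (probability_le1 P mE) (ltry _).
    apply: (etrans (congr1 (fun x => P E - x)%E (indE E GE))).
    by rewrite PAC muleBr ?fin_num_measure// ?mule1.
  case: ifP => _; case: ifP => _.
  - by rewrite setUv setIT probability_setT mule1.
  - by rewrite setU0 PA indE.
  - by rewrite set0U.
  - by rewrite setU0 setI0 measure0 mule0.
pose phi (x : g_sigma_algebraType G * R) : \bar R := (`|x.2| * Y x.1)%:E.
have mphi : measurable_fun setT phi.
  apply/measurable_EFinP; apply: measurable_funM.
    exact: (measurableT_comp (@measurable_realfun.normr_measurable R setT) measurable_snd).
  exact: (measurableT_comp mY measurable_fst).
have phi0 x : (0 <= phi x)%E by rewrite lee_fin mulr_ge0.
have := integral_freeze Gm mzeta fresh mphi phi0.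
have mY' : measurable_fun setT (Y : Om -> R) := measurableT_comp mY (measurable_id_sub Gm).
have -> : (\int[P]_w phi (w, zeta w) = \int[P]_w (\1_A w * Y w)%:E)%E.
  by apply: eq_integral => w _; rewrite /phi /= ger0_norm// /zeta indicE ler0n.
move=> ->; rewrite /phi /=.
have nur : (\int[nu]_v (`|v|)%:E = r%:E)%E.
  rewrite /nu /distribution ge0_integral_pushforward//; last first.
    by apply/measurable_EFinP; exact: measurable_realfun.normr_measurable.
  rewrite preimage_setT -PA -[in RHS](setIT A) -(integral_indic P measurableT mA).
  by apply: eq_integral => w _; rewrite /= /zeta ger0_norm// indicE ler0n.
rewrite -nur -ge0_integralZl//; last 3 first.
- exact/measurable_EFinP.
- by move=> w _; rewrite lee_fin.
- by apply: integral_ge0 => v _; rewrite lee_fin.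
apply: eq_integral => w _; under eq_integral do rewrite mulrC EFinM.
rewrite ge0_integralZl_EFin//; first by rewrite muleC.
by apply/measurable_EFinP; exact: measurable_realfun.normr_measurable.
Qed.

Lemma telescope_arith {R : realType} (g1 g0 g00 d e s t : R) :
  g1 + d <= g0 + e -> g0 + s <= g00 + t -> g1 + (s + d) <= g00 + (t + e).
Proof. by move=> *; lra. Qed.

Section Convergence.
Context {R : realType} {n m : nat} {d : measure_display} {U : measurableType d}
  (Z : probability U R) (mu L rho sigma1 sigma2 : R)
  (f : 'cV[R]_(n + m) -> R) (F : 'cV[R]_(n + m) -> U -> R).
Hypothesis fA : deterministic_assumptions mu L rho f.
Hypothesis sA : stochastic_assumptions Z L rho sigma1 sigma2 f F.
Variables (beta Delta0 eps : R) (z0 : 'cV[R]_(n + m)) (Sg Sh T : nat).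
Hypothesis beta_gt : mu^-1 < beta.
Hypothesis Delta0_gt0 : 0 < Delta0.
Hypothesis eps_gt0 : 0 < eps.
Hypothesis gap0 : h_ beta f z0 - Phi_bar f <= Delta0.
Hypothesis Sg_gt0 : (0 < Sg)%N.
Hypothesis Sh_gt0 : (0 < Sh)%N.
Context {d' : measure_display} {Om : measurableType d'} (P : probability Om R)
  (X : process R n m U Om).
Hypothesis run : sacqrn_run Z F mu L rho sigma1 sigma2 beta Delta0 eps z0 Sg Sh T P X.

Local Notation zk k := (iterate X k).
Local Notation OmG k := (g_sigma_algebraType (past X k)).
Local Notation h := (h_ beta f).
Local Notation a z := (enorm (grad_y f z)).
Local Notation c := (cst_c L rho beta).
Local Notation tau := (Num.sqrt (c * eps)).
Local Notation eta := (eps ^+ 2 / tau).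
Local Notation gamma := (beta * mu - 1).
Local Notation Rd := (R_Delta mu beta Delta0).

(* [T] is the number of iterations that the budget [Delta0] allows at a
   price of [6 * eta] each. *)
Hypothesis T_gt0 : (0 < T)%N.
Hypothesis T_le : T.-1%:R * (6 * eta) <= Delta0.
Hypothesis T_ge : Delta0 <= T%:R * (6 * eta).

Let c0 : 0 < c := cst_c_gt0 fA beta_gt.
Let b0 : 0 < beta := beta_gt0 fA beta_gt.
Let gamma0 : 0 < gamma := gamma_gt0 fA beta_gt.
Let rho0 : 0 < rho := rho_gt0 fA.
Let mu0 : 0 < mu := mu_gt0 fA.
Let br0 : 0 < beta * rho := mulr_gt0 b0 rho0.
Let ce0 : 0 < c * eps := mulr_gt0 c0 eps_gt0.
Let tau0 : 0 < tau. Proof. by rewrite sqrtr_gt0. Qed.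
Let tau2 : tau ^+ 2 = c * eps. Proof. by rewrite sqr_sqrtr// ltW. Qed.
Let eta0 : 0 < eta. Proof. by rewrite divr_gt0// exprn_gt0. Qed.

Let past_meas k : past X k `<=` measurable.
Proof. exact: (past_measurable run). Qed.

Let meas_Om d2 (Y : measurableType d2) k (g : Om -> Y) :
  measurable_fun setT (g : OmG k -> Y) -> measurable_fun setT g.
Proof. by move=> mg; exact: (measurableT_comp mg (measurable_id_sub (@past_meas k))). Qed.

Let meas_Om_mx q r k (A : Om -> 'M[R]_(q, r)) : meas_mx (A : OmG k -> _) -> meas_mx A.
Proof. by move=> mA i j; exact: meas_Om (mA i j). Qed.

Lemma iter_H_sym k w : (k < T)%N -> (iter_H X k w)^T = iter_H X k w.
Proof.
have W_sym B b1 b2 z : (W_est beta F B b1 b2 z)^T = W_est beta F B b1 b2 z.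
  by rewrite /W_est; move: (_ *: \sum_(i < B) _) => A; rewrite linearZ/= linearD/= trmxK addrC.
have symD (A1 A2 A3 : 'M[R]_(n + m)) : A1^T = A1 -> A2^T = A2 -> A3^T = A3 ->
    (A1 - A2 + A3)^T = A1 - A2 + A3.
  by move=> h1 h2 h3; rewrite linearD linearB /= h1 h2 h3.
elim: k => [|k IH] kT; rewrite (iter_HE run w kT) /=; first by rewrite dvdn0 W_sym.
case: ifP => _; first by rewrite W_sym.
by apply: symD; rewrite ?W_sym// IH// ltnW.
Qed.

Definition cost k w : R := step_cost L rho f beta eps (zk k w)
  (iter_g X k w) (iter_H X k w) (iter_gy X k w).

Definition gain k w : R := step_gain L rho f beta (zk k w) (step X k w).

Definition gap k w : R := h (zk k w) - Phi_bar f.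

Lemma gain_ge0 k w : 0 <= gain k w.
Proof. exact: (step_gain_ge0 fA beta_gt). Qed.

Lemma cost_ge0 k w : 0 <= cost k w.
Proof.
rewrite /cost /step_cost /young_cost !addr_ge0// ?divr_ge0 ?(ltW eta0) ?sqr_ge0 ?(ltW tau0)//.
- by rewrite exprn_ge0// fnorm_ge0.
- by rewrite mulr_ge0// sqr_ge0.
- by rewrite exprn_ge0// mulr_ge0 ?fnorm_ge0// ltW.
- by rewrite mulr_ge0// sqr_ge0.
Qed.

Lemma gap_ge k w : gamma / (2 * mu) * a (zk k w) ^+ 2 <= gap k w.
Proof. exact: (h_gap fA). Qed.

Lemma gap_ge0 k w : 0 <= gap k w.
Proof.
apply: le_trans (gap_ge k w); apply: mulr_ge0; last exact: sqr_ge0.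
by apply: divr_ge0; [exact: ltW|apply: mulr_ge0 => //; exact: ltW].
Qed.

Lemma gap_step k w : (k < T)%N -> gap k.+1 w + gain k w <= gap k w + cost k w.
Proof.
move=> kT; rewrite /gap (iterateS run w kT).
have := step_decrease fA beta_gt eps_gt0 (zk k w) (iter_H_sym w kT)
  (fun v => step_argmin run w v kT).
by rewrite -/(gain k w) -/(cost k w); move: (h _) (h _) (Phi_bar f) (gain k w) (cost k w) => *; lra.
Qed.

Lemma gap_telescope k w : (k <= T)%N ->
  gap k w + \sum_(j < k) gain j w <= gap 0 w + \sum_(j < k) cost j w.
Proof.
elim: k => [_|k IH kT]; first by rewrite !big_ord0 addr0.
rewrite !big_ord_recr/=; have := IH (ltnW kT); have := gap_step w kT.
move: (gap _ _) (gap _ _) (gap _ _) (gain _ _) (cost _ _) (\sum_(j < k) _) (\sum_(j < k) _).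
by move=> g1 g2 g3 d1 e1 s1 t1 h1 h2; exact: telescope_arith h1 h2.
Qed.

Let meas_iter k : (k <= T)%N -> meas_mx (zk k).
Proof. by move=> kT; exact: meas_Om_mx (adapted_iterate run kT). Qed.

Let meas_gap k : (k <= T)%N -> measurable_fun setT (gap k).
Proof.
move=> kT; apply: measurable_funB => //.
exact: measurable_continuous (continuous_h fA (beta := beta)) (meas_iter kT).
Qed.

Let meas_a k : (k <= T)%N -> measurable_fun setT (fun w => a (zk k w)).
Proof. by move=> kT; exact: measurable_continuous (continuous_grad_y fA) (meas_iter kT). Qed.

Let meas_gain k : (k < T)%N -> measurable_fun setT (gain k).
Proof.
move=> kT; have mx : measurable_fun setT (fun w => fnorm (step X k w)).
  by apply: measurable_fnorm; exact: meas_Om_mx (adapted_step run kT).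
apply: measurable_funD; apply: measurable_funM => //.
  apply: measurable_funM; last exact: measurable_funX.
  by apply: measurable_funM => //; exact: meas_a (ltnW kT).
by apply: measurable_funM => //; exact: measurable_funX.
Qed.

Let meas_eg k : (k < T)%N -> measurable_fun setT (fun w => fnorm (err_g f beta X k w)).
Proof. by move=> kT; apply: measurable_fnorm; exact: meas_Om_mx (meas_err_g fA sA run kT). Qed.

Let meas_eH k : (k < T)%N -> measurable_fun setT (fun w => fnorm (err_H f beta X k w)).
Proof. by move=> kT; apply: measurable_fnorm; exact: meas_Om_mx (meas_err_H fA sA run kT). Qed.

Let meas_ey k : (k < T)%N -> measurable_fun setT (fun w => fnorm (err_y f X k w)).
Proof. by move=> kT; apply: measurable_fnorm; exact: meas_Om_mx (meas_err_y fA sA run kT). Qed.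

Let costE k w : cost k w = 1 * (eta / 12 + tau^-1 * fnorm (err_g f beta X k w) ^+ 2) +
  1 * ((6 * c ^+ 2)^-1 * fnorm (err_H f beta X k w) ^+ 3
       + (beta * rho) ^+ 3 / (3 * c ^+ 2) * fnorm (err_y f X k w) ^+ 3).
Proof.
rewrite /cost /step_cost /young_cost !mul1r -!addrA; congr (_ + (_ + (_ + _))).
- by rewrite mulrC.
- by rewrite mulrC.
- by rewrite exprMn mulrAC.
Qed.

Let cost_parts k : (k < T)%N ->
  [/\ measurable_fun setT (fun w => eta / 12 + tau^-1 * fnorm (err_g f beta X k w) ^+ 2)
    & measurable_fun setT (fun w => (6 * c ^+ 2)^-1 * fnorm (err_H f beta X k w) ^+ 3
       + (beta * rho) ^+ 3 / (3 * c ^+ 2) * fnorm (err_y f X k w) ^+ 3)].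
Proof.
move=> kT; split.
  apply: measurable_funD => //; apply: measurable_funM => //; apply: measurable_funX.
  exact: meas_eg.
by apply: measurable_funD; apply: measurable_funM => //; apply: measurable_funX;
  [exact: meas_eH|exact: meas_ey].
Qed.

Let meas_cost k : (k < T)%N -> measurable_fun setT (cost k).
Proof.
move=> kT; have [m1 m2] := cost_parts kT.
have -> : cost k = fun w => cost k w by [].
by under eq_fun do rewrite costE; apply: measurable_funD; apply: measurable_funM.
Qed.

Let Rd2 : Rd ^+ 2 = 4 * (mu * Delta0 / gamma).
Proof.
rewrite /R_Delta exprMn sqr_sqrtr; first by ring.
by rewrite divr_ge0 ?(ltW gamma0)// mulr_ge0 ?ltW.
Qed.

(** The four terms of the cost amount to 1/12, 3/4, 1/48 and 1/24 of [eta]. *)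
Let cost_small k : (k < T)%N ->
  (forall j, (j <= k)%N -> (\int[P]_w (a (zk j w) ^+ 2)%:E <= (Rd ^+ 2)%:E)%E) ->
  (\int[P]_w (cost k w)%:E <= eta%:E)%E.
Proof.
move=> kT aR; have [m1 m2] := cost_parts kT.
have tau3 : tau ^+ 3 / c ^+ 2 = eta.
  have cE : c = tau ^+ 2 / eps by rewrite tau2 mulfK// gt_eqF.
  rewrite [in X in _ / X = _]cE; move: tau tau0 => t t0.
  by field; rewrite !gt_eqF.
have i1 : (\int[P]_w (eta / 12 + tau^-1 * fnorm (err_g f beta X k w) ^+ 2)%:E
    <= (eta / 12 + tau^-1 * (3 / 4 * eps ^+ 2))%:E)%E.
  apply: (@integral_le_affine _ _ _ P _ (fun w => fnorm (err_g f beta X k w) ^+ 2)) => //.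
  - move=> w; apply: addr_ge0; first by rewrite divr_ge0// ltW.
    by rewrite mulr_ge0 ?sqr_ge0// invr_ge0 ltW.
  - by apply: measurable_funX; exact: meas_eg.
  - by move=> w; exact: sqr_ge0.
  - exact: (err_g_moment fA sA beta_gt Delta0_gt0 eps_gt0 Sg_gt0 run kT aR).
have p1 : 0 <= (6 * c ^+ 2)^-1 by rewrite invr_ge0 mulr_ge0 ?sqr_ge0.
have p2 : 0 <= (beta * rho) ^+ 3 / (3 * c ^+ 2).
  by apply: divr_ge0; [exact: exprn_ge0 (ltW br0)|rewrite mulr_ge0// sqr_ge0].
have i2 : (\int[P]_w ((6 * c ^+ 2)^-1 * fnorm (err_H f beta X k w) ^+ 3
       + (beta * rho) ^+ 3 / (3 * c ^+ 2) * fnorm (err_y f X k w) ^+ 3)%:E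
    <= ((6 * c ^+ 2)^-1 * (tau / 2) ^+ 3
       + (beta * rho) ^+ 3 / (3 * c ^+ 2) * (tau / (2 * (beta * rho))) ^+ 3)%:E)%E.
  apply: (@integral_le_lin2 _ _ _ P _ (fun w => fnorm (err_H f beta X k w) ^+ 3)
    (fun w => fnorm (err_y f X k w) ^+ 3)) => //.
  - by move=> w; rewrite addr_ge0// mulr_ge0// exprn_ge0// fnorm_ge0.
  - by apply: measurable_funX; exact: meas_eH.
  - by move=> w; rewrite exprn_ge0// fnorm_ge0.
  - by apply: measurable_funX; exact: meas_ey.
  - by move=> w; rewrite exprn_ge0// fnorm_ge0.
  - exact: (err_H_moment fA sA beta_gt eps_gt0 Sh_gt0 run kT).
  - exact: (err_y_moment fA sA beta_gt eps_gt0 run kT).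
have := @integral_le_lin2 _ _ _ P (cost k) _ _ 1 1 _ _ (meas_cost kT) (cost_ge0 k)
  m1 _ ler01 m2 _ ler01 i1 i2.
move=> /(_ _ _ _)H; apply: (le_trans (H _ _ _)).
- move=> w; apply: addr_ge0; first by rewrite divr_ge0// ltW.
  by rewrite mulr_ge0 ?sqr_ge0// invr_ge0 ltW.
- by move=> w; rewrite addr_ge0// mulr_ge0// exprn_ge0// fnorm_ge0.
- by move=> w; rewrite costE.
rewrite lee_fin !mul1r.
have -> : tau^-1 * (3 / 4 * eps ^+ 2) = 3 / 4 * eta by ring.
have -> : (6 * c ^+ 2)^-1 * (tau / 2) ^+ 3 = tau ^+ 3 / c ^+ 2 / 48 by field; rewrite gt_eqF.
have -> : (beta * rho) ^+ 3 / (3 * c ^+ 2) * (tau / (2 * (beta * rho))) ^+ 3 = tau ^+ 3 / c ^+ 2 / 24.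
  by field; rewrite !gt_eqF.
by rewrite tau3; move: eta0; move: eta => e e0; lra.
Qed.

Let integral_sum_le (K : nat) (Y : nat -> Om -> R) (b : R) :
  (forall k, (k < K)%N -> measurable_fun setT (Y k)) -> (forall k w, 0 <= Y k w) ->
  (forall k, (k < K)%N -> (\int[P]_w (Y k w)%:E <= b%:E)%E) ->
  (\int[P]_w (\sum_(k < K) Y k w)%:E <= (K%:R * b)%:E)%E.
Proof.
move=> mY Y0 Yb; under eq_integral do rewrite -sumEFin.
rewrite ge0_integral_sum//; first last.
- by move=> k w _; rewrite lee_fin.
- by move=> k; apply/measurable_EFinP; exact: mY.
apply: (@le_trans _ _ (\sum_(k < K) b%:E)%E); first by apply: lee_sum => k _; exact: Yb.
by rewrite sumEFin sumr_const card_ord mulr_natl.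
Qed.

Let gap_bound k (A : R) : (k <= T)%N ->
  (\int[P]_w (\sum_(j < k) cost j w)%:E <= A%:E)%E ->
  (\int[P]_w (gap k w + \sum_(j < k) gain j w)%:E <= (Delta0 + A)%:E)%E.
Proof.
move=> kT cA; rewrite -[X in Delta0 + X]mul1r.
have kj (j : 'I_k) : (j < T)%N by rewrite (leq_trans (ltn_ord j)).
apply: (@integral_le_affine _ _ _ P _ (fun w => \sum_(j < k) cost j w)) => //.
- apply: measurable_funD; first exact: meas_gap.
  by apply: measurable_sum => j; exact: meas_gain.
- by move=> w; rewrite addr_ge0 ?gap_ge0// sumr_ge0// => j _; exact: gain_ge0.
- by apply: measurable_sum => j; exact: meas_cost.
- by move=> w; rewrite sumr_ge0// => j _; exact: cost_ge0.
move=> w; rewrite mul1r (le_trans (gap_telescope w kT))// lerD2r.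
by rewrite /gap (iterate0 run).
Qed.

(** The batch sizes presuppose a bound on the partial gradients, which the
    decrease of the objective up to the current iteration provides. *)
Lemma cost_bound k : (k < T)%N -> (\int[P]_w (cost k w)%:E <= eta%:E)%E.
Proof.
elim/ltn_ind: k => k IH kT; apply: cost_small => // j jk.
have jT := leq_ltn_trans jk kT.
have sc : (\int[P]_w (\sum_(i < j) cost i w)%:E <= (j%:R * eta)%:E)%E.
  apply: integral_sum_le => [i ij|i w|i ij]; [|exact: cost_ge0|].
    by apply: meas_cost; exact: ltn_trans ij jT.
  by apply: IH; [exact: leq_trans ij jk|exact: ltn_trans ij jT].
have jD : j%:R * eta <= Delta0.
  have jT1 : j%:R <= T.-1%:R :> R by rewrite ler_nat -ltnS prednK.
  have := ler_wpM2r (ltW eta0) jT1; have := mulr_ge0 (ler0n R T.-1) (ltW eta0).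
  by move: T_le; rewrite mulrCA; move: (_ * eta) (_ * eta) => *; lra.
have := gap_bound (ltnW jT) sc => H.
have -> : Rd ^+ 2 = 0 + 2 * mu / gamma * (2 * Delta0) by rewrite Rd2; field; rewrite gt_eqF.
apply: (@integral_le_affine _ _ _ P _ (gap j)) => //.
- by apply: measurable_funX; exact: meas_a (ltnW jT).
- by move=> w; exact: sqr_ge0.
- exact: meas_gap (ltnW jT).
- exact: gap_ge0.
- apply: (@le_trans _ _ (Delta0 + j%:R * eta)%:E); last by rewrite lee_fin mulr2n mulrDl mul1r lerD2l.
  apply: le_trans H; apply: ge0_le_integral => //.
  + by move=> w _; rewrite lee_fin gap_ge0.
  + by apply/measurable_EFinP; exact: meas_gap (ltnW jT).
  + apply/measurable_EFinP; apply: measurable_funD; first exact: meas_gap (ltnW jT).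
    by apply: measurable_sum => i; apply: meas_gain; exact: ltn_trans (ltn_ord i) jT.
  + by move=> w _; rewrite lee_fin lerDl sumr_ge0// => i _; exact: gain_ge0.
- by rewrite divr_ge0 ?(ltW gamma0)// mulr_ge0// ltW.
move=> w; rewrite add0r.
have -> : a (zk j w) ^+ 2 = 2 * mu / gamma * (gamma / (2 * mu) * a (zk j w) ^+ 2).
  by field; rewrite !gt_eqF.
by rewrite ler_wpM2l ?gap_ge// divr_ge0 ?(ltW gamma0)// mulr_ge0// ltW.
Qed.

Lemma sum_cost : (\int[P]_w (\sum_(k < T) cost k w)%:E <= (T%:R * eta)%:E)%E.
Proof.
by apply: integral_sum_le => [k kT|k w|k kT]; [exact: meas_cost|exact: cost_ge0|exact: cost_bound].
Qed.

Lemma sum_gain : (\int[P]_w (\sum_(k < T) gain k w)%:E <= (T%:R * (7 * eta))%:E)%E.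
Proof.
have := gap_bound (leqnn T) sum_cost => H.
have mg : measurable_fun setT (fun w => \sum_(k < T) gain k w).
  by apply: measurable_sum => k; exact: meas_gain.
apply: (@le_trans _ _ (Delta0 + T%:R * eta)%:E).
  apply: le_trans H; apply: ge0_le_integral => //.
  - by move=> w _; rewrite lee_fin sumr_ge0// => i _; exact: gain_ge0.
  - exact/measurable_EFinP.
  - by apply/measurable_EFinP; apply: measurable_funD => //; exact: meas_gap.
  - by move=> w _; rewrite lee_fin lerDr gap_ge0.
have -> : T%:R * (7 * eta) = T%:R * (6 * eta) + T%:R * eta by ring.
by rewrite lee_fin lerD2r.
Qed.

Let meas_cont_T (G : 'cV[R]_(n + m) -> R) k : continuous G -> (k <= T)%N ->
  measurable_fun setT ((fun w => G (zk k w)) : OmG T -> R).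
Proof.
move=> cG kT; have sub : past X k `<=` <<s past X T >>.
  by move=> E kE; apply: sub_sigma_algebra; exact: (past_le run) kE.
apply: (measurable_sub_sigma sub).
exact: measurable_continuous cG (adapted_iterate run kT).
Qed.

Let out_event (k : nat) : set Om := [set w | out_index X w = k.+1].

Let out_decomposition (G : 'cV[R]_(n + m) -> R) w :
  G (z_out X w) = \sum_(k < T) \1_(out_event k) w * G (zk k.+1 w).
Proof.
have /andP[j0 jT] := out_index_range run w.
have jT' : ((out_index X w).-1 < T)%N by rewrite prednK.
rewrite (bigD1 (Ordinal jT'))//= big1 => [|k kj].
  by rewrite addr0 indicE mem_set ?mul1r /out_event /= ?prednK.
rewrite indicE memNset ?mul0r// => /= kE; case/negP: kj.
by apply/eqP/val_inj => /=; rewrite kE.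
Qed.

(** The index of the output is uniform and independent of the run. *)
Lemma integral_z_out (G : 'cV[R]_(n + m) -> R) : continuous G -> (forall z, 0 <= G z) ->
  (\int[P]_w (G (z_out X w))%:E =
   (T%:R^-1)%:E * \int[P]_w (\sum_(k < T) G (zk k.+1 w))%:E)%E.
Proof.
move=> cG G0.
have mG (k : 'I_T) : measurable_fun setT (fun w => G (zk k.+1 w)).
  by apply: meas_Om; apply: meas_cont_T.
have mA k : measurable (out_event k) by exact: (out_index_measurable run).
under eq_integral do rewrite out_decomposition -sumEFin.
rewrite ge0_integral_sum//; last 2 first.
- by move=> k; apply/measurable_EFinP; apply: measurable_funM.
- by move=> k w _; rewrite lee_fin mulr_ge0// indicE ler0n.
under [X in (_ = _ * X)%E]eq_integral do rewrite -sumEFin.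
rewrite ge0_integral_sum//; last 2 first.
- by move=> k; apply/measurable_EFinP.
- by move=> k w _; rewrite lee_fin.
rewrite ge0_sume_distrr; last by move=> k _; apply: integral_ge0 => w _; rewrite lee_fin.
apply: eq_bigr => k _.
apply: (@integral_indep_event _ _ _ P (past X T)) => //.
- exact: (past_sigma_algebra run).
- by move=> E TE; apply: (out_index_uniform run) => //; rewrite /= ltn_ord.
- exact: meas_cont_T.
Qed.

Local Notation N z := (fnorm (grad h z)).

Let continuous_N : continuous (fun z => N z).
Proof. by apply: cont_mx_fnorm; exact: (cont_grad_h fA (beta := beta)). Qed.

Let meas_sum_cost : measurable_fun setT (fun w => \sum_(k < T) cost k w).
Proof. by apply: measurable_sum => k; exact: meas_cost. Qed.

Let meas_sum_gain : measurable_fun setT (fun w => \sum_(k < T) gain k w).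
Proof. by apply: measurable_sum => k; exact: meas_gain. Qed.

Let sum_cost_ge0 w : 0 <= \sum_(k < T) cost k w.
Proof. by rewrite sumr_ge0// => k _; exact: cost_ge0. Qed.

Let sum_gain_ge0 w : 0 <= \sum_(k < T) gain k w.
Proof. by rewrite sumr_ge0// => k _; exact: gain_ge0. Qed.

Let budget (p q : R) : 0 <= p -> 0 <= q ->
  (\int[P]_w (p * (\sum_(k < T) cost k w) + q * (\sum_(k < T) gain k w))%:E
    <= ((p + 7 * q) * (T%:R * eta))%:E)%E.
Proof.
move=> p0 q0.
have -> : (p + 7 * q) * (T%:R * eta) = p * (T%:R * eta) + q * (T%:R * (7 * eta)) by ring.
apply: (@integral_le_lin2 _ _ _ P _ (fun w => \sum_(k < T) cost k w)
  (fun w => \sum_(k < T) gain k w)) => //.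
- by apply: measurable_funD; apply: measurable_funM.
- by move=> w; rewrite addr_ge0// mulr_ge0.
- exact: sum_cost.
- exact: sum_gain.
Qed.

Let meas_budget (p q : R) : measurable_fun setT
  (fun w => p * (\sum_(k < T) cost k w) + q * (\sum_(k < T) gain k w)).
Proof. by apply: measurable_funD; apply: measurable_funM. Qed.

Let budget_ge0 (p q : R) w : 0 <= p -> 0 <= q ->
  0 <= p * (\sum_(k < T) cost k w) + q * (\sum_(k < T) gain k w).
Proof. by move=> p0 q0; rewrite addr_ge0// mulr_ge0. Qed.

Let sum_lin (p q r s : R) w :
  \sum_(k < T) (p + q * (r * cost k w + s * gain k w)) =
  T%:R * p + q * (r * (\sum_(k < T) cost k w) + s * (\sum_(k < T) gain k w)).
Proof.
rewrite big_split/= sumr_const card_ord mulr_natl -mulr_sumr; congr (_ + _ * _).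
by rewrite big_split/= -!mulr_sumr.
Qed.

Hypothesis scale : eps / tau <= gamma / (6 * (beta * rho)).

Let meas_sum_N : measurable_fun setT (fun w => \sum_(k < T) N (zk k.+1 w)).
Proof.
by apply: measurable_sum => k; exact: (meas_Om (meas_cont_T continuous_N (ltn_ord k))).
Qed.

(** The weights of [step_grad] give [248 = 13 + 4 + 33 * 7]. *)
Lemma sum_grad :
  (\int[P]_w (\sum_(k < T) N (zk k.+1 w))%:E <= (T%:R * (248 * eps))%:E)%E.
Proof.
have -> : T%:R * (248 * eps) = T%:R * (13 * eps) + tau / eps * ((4 + 7 * 33) * (T%:R * eta)).
  by move: tau0; move: tau => t t0; field; rewrite !gt_eqF.
apply: (@integral_le_affine _ _ _ P _ (fun w => 4 * (\sum_(k < T) cost k w)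
  + 33 * (\sum_(k < T) gain k w))) => //.
- by move=> w; rewrite sumr_ge0// => k _; exact: fnorm_ge0.
- by move=> w; exact: budget_ge0.
- exact: budget.
- by rewrite divr_ge0// ltW.
move=> w; rewrite -sum_lin; apply: ler_sum => k _; rewrite (iterateS run w (ltn_ord k)).
have := step_grad fA beta_gt eps_gt0 (zk k w) (iter_H_sym w (ltn_ord k))
  (fun v => step_argmin run w v (ltn_ord k)) scale.
by [].
Qed.

Local Notation lmin z := (lambda_min (hess h z)).

Let neg_part z := Num.max 0 (- lmin z).

Let continuous_neg_part : continuous neg_part.
Proof.
move=> z; apply: (@continuous_max _ _ (fun=> 0) (fun z => - lmin z)).
  exact: cst_continuous.
by apply: continuousN; exact: (continuous_lambda_min_h fA).
Qed.

Hypothesis small : 744 * (beta * rho) / gamma * eps <= tau.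

(** The weights of [step_lambda] give [64 = 13 + 2 + 7 * 7], and a small [eps]
    makes the term in the gradient at most [tau]. *)
Lemma sum_neg_part :
  (\int[P]_w (\sum_(k < T) neg_part (zk k.+1 w))%:E <= (T%:R * (65 * tau))%:E)%E.
Proof.
have g3 : 0 <= 3 * (beta * rho) / gamma by rewrite divr_ge0 ?mulr_ge0// ltW.
have ce : 0 <= c / eps by rewrite divr_ge0// ltW.
pose M w := 2 * (\sum_(k < T) cost k w) + 7 * (\sum_(k < T) gain k w).
have M0 w : 0 <= M w by exact: budget_ge0.
have mM : measurable_fun setT M by exact: meas_budget.
have iM : (\int[P]_w (T%:R * (13 * tau) + c / eps * M w)%:E <= (T%:R * (64 * tau))%:E)%E.
  have -> : T%:R * (64 * tau) = T%:R * (13 * tau) + c / eps * ((2 + 7 * 7) * (T%:R * eta)).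
    have cE : c = tau ^+ 2 / eps by rewrite tau2 mulfK// gt_eqF.
    rewrite [in X in _ = _ + X / eps * _]cE; move: tau tau0 => t t0.
    by field; rewrite !gt_eqF.
  apply: (@integral_le_affine _ _ _ P _ M) => //.
  - by apply: measurable_funD => //; exact: measurable_funM.
  - by move=> w; apply: addr_ge0; rewrite mulr_ge0// mulr_ge0// ltW.
  - exact: budget.
apply: (@le_trans _ _ (1 * (T%:R * (64 * tau)) + 3 * (beta * rho) / gamma * (T%:R * (248 * eps)))%:E).
  apply: (@integral_le_lin2 _ _ _ P _ (fun w => T%:R * (13 * tau) + c / eps * M w)
    (fun w => \sum_(k < T) N (zk k.+1 w))) => //.
  - apply: measurable_sum => k.
    exact: (meas_Om (meas_cont_T continuous_neg_part (ltn_ord k))).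
  - by move=> w; rewrite sumr_ge0// => k _; rewrite le_max lexx.
  - by apply: measurable_funD => //; exact: measurable_funM.
  - by move=> w; apply: addr_ge0; rewrite mulr_ge0// mulr_ge0// ltW.
  - by move=> w; rewrite sumr_ge0// => k _; exact: fnorm_ge0.
  - exact: sum_grad.
  move=> w; rewrite mul1r /M -sum_lin mulr_sumr -big_split; apply: ler_sum => k _.
  rewrite ge_max; apply/andP; split.
    apply: addr_ge0; last by rewrite mulr_ge0// fnorm_ge0.
    apply: addr_ge0; first by rewrite mulr_ge0// ltW.
    by rewrite mulr_ge0// addr_ge0// mulr_ge0// ?cost_ge0// gain_ge0.
  rewrite (iterateS run w (ltn_ord k)).
  have := step_lambda fA beta_gt eps_gt0 (zk k w) (iter_H_sym w (ltn_ord k))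
    (fun v => step_argmin run w v (ltn_ord k)).
  by [].
rewrite lee_fin mul1r.
have -> : 3 * (beta * rho) / gamma * (T%:R * (248 * eps)) =
  T%:R * (744 * (beta * rho) / gamma * eps) by ring.
have -> : T%:R * (65 * tau) = T%:R * (64 * tau) + T%:R * tau by ring.
by rewrite lerD2l ler_wpM2l.
Qed.

Let meas_z_out (G : 'cV[R]_(n + m) -> R) : continuous G ->
  measurable_fun setT (fun w => G (z_out X w)).
Proof.
move=> cG; under eq_fun do rewrite out_decomposition.
apply: measurable_sum => k; apply: measurable_funM.
  by apply: measurable_indic; exact: (out_index_measurable run).
exact: (meas_Om (meas_cont_T cG (ltn_ord k))).
Qed.

Let mean_z_out_le (G : 'cV[R]_(n + m) -> R) b : continuous G -> (forall z, 0 <= G z) ->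
  (\int[P]_w (\sum_(k < T) G (zk k.+1 w))%:E <= (T%:R * b)%:E)%E ->
  (\int[P]_w (G (z_out X w))%:E <= b%:E)%E.
Proof.
move=> cG G0 Gb; rewrite integral_z_out//.
have T0 : 0 < T%:R^-1 :> R by rewrite invr_gt0 ltr0n.
apply: (@le_trans _ _ ((T%:R^-1)%:E * (T%:R * b)%:E)%E).
  by apply: lee_wpmul2l Gb; rewrite lee_fin ltW.
by rewrite -EFinM lee_fin mulrA mulVf ?mul1r// pnatr_eq0 -lt0n.
Qed.

Let integrable_z_out (G : 'cV[R]_(n + m) -> R) (b : R) : continuous G -> (forall z, 0 <= G z) ->
  (\int[P]_w (G (z_out X w))%:E <= b%:E)%E ->
  P.-integrable setT (EFin \o (fun w => G (z_out X w))).
Proof.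
move=> cG G0 Gb; apply/integrableP; split; first by apply/measurable_EFinP; exact: meas_z_out.
under eq_integral do rewrite /= ger0_norm//.
exact: le_lt_trans Gb (ltry _).
Qed.

Lemma mean_grad_out : (\int[P]_w (N (z_out X w))%:E <= (248 * eps)%:E)%E.
Proof. exact: (mean_z_out_le continuous_N (fun z => fnorm_ge0 _) sum_grad). Qed.

Lemma integrable_grad_out : P.-integrable setT (EFin \o (fun w => N (z_out X w))).
Proof. exact: (integrable_z_out continuous_N (fun z => fnorm_ge0 _) mean_grad_out). Qed.

(** Makes the eigenvalue integrable, since the norm of the gradient is and
    dominates [a z]. *)
Let normr_lmin_le z : `|lmin z| <= (L + beta * L ^+ 2) + beta * rho / gamma * N z.
Proof.
have s0 : 0 <= L + beta * L ^+ 2 + beta * rho * a z.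
  apply: addr_ge0; last exact: mulr_ge0 (ltW br0) (fnorm_ge0 _).
  exact: addr_ge0 (ltW (L_gt0 fA)) (mulr_ge0 (ltW b0) (sqr_ge0 _)).
have form_le := normr_form_hess_h fA beta_gt z.
apply: (@le_trans _ _ (L + beta * L ^+ 2 + beta * rho * a z)).
  rewrite ler_norml; apply/andP; split; last exact: lambda_min_le s0 form_le.
  apply: lambda_min_ge s0 _ => v.
  by have := form_le v; rewrite ler_norml mulNr => /andP[].
rewrite lerD2l -[leRHS]mulrA; apply: (ler_wpM2l (ltW br0)).
by rewrite ler_pdivlMl//; exact: (grad_h_ge fA beta_gt).
Qed.

Lemma integrable_lmin_out : P.-integrable setT (EFin \o (fun w => lmin (z_out X w))).
Proof.
have dom : P.-integrable setT (EFin \o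
    ((fun=> L + beta * L ^+ 2) \+ (fun w => beta * rho / gamma * N (z_out X w)))).
  rewrite compreDr//; apply: integrableD => //.
    exact: finite_measure_integrable_cst.
  by rewrite (_ : _ \o _ = fun w => (beta * rho / gamma)%:E * (EFin \o (fun w => N (z_out X w))) w)%E;
    [exact: integrableZl integrable_grad_out|].
apply: le_integrable dom => //.
  by apply/measurable_EFinP; exact: (meas_z_out (continuous_lambda_min_h fA (beta := beta))).
move=> w _; rewrite /= lee_fin; apply: le_trans (normr_lmin_le _) (ler_norm _).
Qed.

Lemma mean_lmin_out : (- (\int[P]_w (lmin (z_out X w))%:E) <= (65 * tau)%:E)%E.
Proof.
have neg0 z : 0 <= Num.max 0 (- lmin z) by rewrite le_max lexx.
have negb := mean_z_out_le continuous_neg_part neg0 sum_neg_part.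
apply: (le_trans _ negb).
rewrite leeNl.
have <- : (\int[P]_w (- (neg_part (z_out X w))%:E) = - \int[P]_w (neg_part (z_out X w))%:E)%E.
  by apply: integral_ge0N => w _; rewrite lee_fin; exact: neg0.
apply: le_integral => //.
- exact: (integrableN (integrable_z_out continuous_neg_part neg0 negb)).
- exact: integrable_lmin_out.
by move=> w _; rewrite -EFinN lee_fin lerNl le_max lexx orbT.
Qed.

End Convergence.

(** * The complexity bound *)

(** As [eta = eps `^ (3 / 2) / Num.sqrt c], the number truncated in [iterations] is
    [Delta0 / (6 * eta)]. *)
Lemma iterations_itv {R : realType} (L rho beta Delta0 eps : R) :
  0 < cst_c L rho beta -> 0 < Delta0 -> 0 < eps ->
  let eta := eps ^+ 2 / Num.sqrt (cst_c L rho beta * eps) in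
  let T := iterations L rho beta Delta0 eps in
  T.-1%:R * (6 * eta) <= Delta0 <= T%:R * (6 * eta).
Proof.
rewrite /iterations => c0 D0 e0 /=; move: (cst_c L rho beta) c0 => c c0.
set eta := eps ^+ 2 / _.
have s0 : 0 < Num.sqrt c by rewrite sqrtr_gt0.
have t0 : 0 < Num.sqrt eps by rewrite sqrtr_gt0.
have eta0 : 0 < 6 * eta by rewrite mulr_gt0// divr_gt0 ?exprn_gt0// sqrtr_gt0 mulr_gt0.
have -> : Delta0 * Num.sqrt c / (6 * eps `^ (3 / 2)) = Delta0 / (6 * eta).
  have -> : 3 / 2 = 1 + 2^-1 :> R by field.
  rewrite powRD; last by rewrite (gt_eqF e0) implybT.
  rewrite (powRr1 (ltW e0)) (powR12_sqrt (ltW e0)) /eta (sqrtrM _ (ltW c0)).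
  have := sqr_sqrtr (ltW e0); move: (Num.sqrt c) (Num.sqrt eps) s0 t0 => s t s0 t0 <-.
  by field; rewrite !gt_eqF.
have /truncn_itv/andP[] : 0 <= Delta0 / (6 * eta) by rewrite divr_ge0// ltW.
by rewrite ler_pdivlMr// ltr_pdivrMr// => -> /ltW.
Qed.

(** Both quantities on the left are of order [Num.sqrt eps] relative to those on the
    right. *)
Lemma small_eps {R : realType} (K c b gamma eps : R) : 6 <= K -> 0 < c -> 0 < b -> 0 < gamma ->
  0 < eps -> eps < c * (gamma / (K * b)) ^+ 2 ->
  K * b / gamma * eps <= Num.sqrt (c * eps) /\
  eps / Num.sqrt (c * eps) <= gamma / (6 * b).
Proof.
move=> K6 c0 b0 g0 e0 small.
have t0 : 0 < Num.sqrt (c * eps) by rewrite sqrtr_gt0 mulr_gt0.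
have K0 : 0 < K by apply: lt_le_trans K6; rewrite ltr0n.
have k0 : 0 < K * b by exact: mulr_gt0.
have s0 : 0 < gamma / (K * b) by exact: divr_gt0.
have le1 : eps <= gamma / (K * b) * Num.sqrt (c * eps).
  rewrite -(@ler_pXn2r _ 2) ?nnegrE ?(ltW e0)// ?(mulr_ge0 (ltW s0) (ltW t0))//.
  rewrite exprMn sqr_sqrtr ?(ltW (mulr_gt0 c0 e0))// expr2 mulrA ler_pM2r//.
  by rewrite mulrC ltW.
split; first by rewrite -(invf_div gamma) (ler_pdivrMl _ _ s0).
rewrite ler_pdivrMr//; apply: (le_trans le1); rewrite ler_pM2r//.
by rewrite ler_pM2l// lef_pV2 ?posrE ?mulr_gt0// ler_pM2r.
Qed.

Theorem theorem4p5 (R : realType) :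
  exists C1 C2 : R, forall (n m : nat)
    (d : measure_display) (U : measurableType d) (Z : probability U R)
    (f : 'cV[R]_(n + m) -> R) (F : 'cV[R]_(n + m) -> U -> R)
    (mu L rho sigma1 sigma2 : R),
  deterministic_assumptions mu L rho f ->
  stochastic_assumptions Z L rho sigma1 sigma2 f F ->
  forall beta Delta0 : R, mu^-1 < beta -> 0 < Delta0 ->
  exists2 eps0 : R, 0 < eps0 &
    forall (eps : R), 0 < eps < eps0 ->
    forall (z0 : 'cV[R]_(n + m)), h_ beta f z0 - Phi_bar f <= Delta0 ->
    forall (Sg Sh : nat), (0 < Sg)%N -> (0 < Sh)%N ->
    forall (d' : measure_display) (Omega : measurableType d')
      (P : probability Omega R) (X : process R n m U Omega),
    sacqrn_run Z F mu L rho sigma1 sigma2 beta Delta0 eps z0 Sg Sh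
      (iterations L rho beta Delta0 eps) P X ->
    let grad_norm := fun w => enorm (grad (h_ beta f) (z_out X w)) in
    let lmin := fun w => lambda_min (hess (h_ beta f) (z_out X w)) in
    [/\ P.-integrable setT (EFin \o grad_norm),
        ('E_P[grad_norm] <= (C1 * eps)%:E)%E,
        P.-integrable setT (EFin \o lmin) &
        (- 'E_P[lmin] <= (C2 * Num.sqrt (cst_c L rho beta * eps))%:E)%E].
Proof.
exists 248, 65 => n m d U Z f F mu L rho sigma1 sigma2 fA sA beta Delta0 beta_gt D0.
have c0 := cst_c_gt0 fA beta_gt; have g0 := gamma_gt0 fA beta_gt.
have br0 := mulr_gt0 (beta_gt0 fA beta_gt) (rho_gt0 fA).
exists (cst_c L rho beta * ((beta * mu - 1) / (744 * (beta * rho))) ^+ 2).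
  by apply: (mulr_gt0 c0); apply: exprn_gt0; apply: (divr_gt0 g0); apply: mulr_gt0 br0; rewrite ltr0n.
move=> eps /andP[e0 esmall] z0 gap0 Sg Sh Sg0 Sh0 d' Om P X run grad_norm lmin.
have K6 : 6 <= 744 :> R by rewrite ler_nat.
have [small scale] := small_eps K6 c0 br0 g0 e0 esmall.
have /andP[Tle Tge] := iterations_itv c0 D0 e0.
split.
- exact: (integrable_grad_out fA sA beta_gt D0 e0 gap0 Sg0 Sh0 run (ltn0Sn _) Tle Tge scale).
- rewrite unlock; exact: (mean_grad_out fA sA beta_gt D0 e0 gap0 Sg0 Sh0 run (ltn0Sn _) Tle Tge scale).
- exact: (integrable_lmin_out fA sA beta_gt D0 e0 gap0 Sg0 Sh0 run (ltn0Sn _) Tle Tge scale).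
- rewrite unlock; exact: (mean_lmin_out fA sA beta_gt D0 e0 gap0 Sg0 Sh0 run (ltn0Sn _) Tle Tge scale small).
Qed.
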